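(* Let $S\subseteq\mathbb R$ and let $X=(X_t)_{t\in[0,T]}$ be an $S$-valued Lévy process with characteristics $(b,a,F)$ and $X_0=x_0$. Assume that $\int_{|y|>1}\exp(\alpha|y|)F(dy)<\infty$ for some $\alpha>0$. Set $$\mathcal V:=\{h\in H(\mathbb C):h\text{ is of exponential type }\tau<\alpha\},\qquad \mathcal V^*:=\{\mathbf u\in\mathcal S^*:h_{\mathbf u}=h,\ h\in\mathcal V\}.$$ Then: (i) $X$ is an $S$-valued $\mathcal V$-holomorphic process. (ii) For all $h\in\mathcal V$ the process $N^h_t=h(X_t)-h(X_0)-\int_0^t\mathcal Ah(X_s)ds$, $t\in[0,T]$, is a true martingale. (iii) For all $\mathbf u\in\mathcal V^*$ there exists a $\mathcal V^*$-valued map $(\mathbf c(t))_{t\in[0,T]}$ such that $$h_{\mathbf c(t)}(x)=h_{\mathbf u}(x)+\int_0^th_{L(\mathbf c(s))}(x)\,ds\quad\text{for all }x\in S,\ t\in[0,T],$$ and $\int_0^T\int_0^T\mathbb E[|\mathcal Ah_{\mathbf c(s)}(X_t)|]\,ds\,dt<\infty$. In particular, for each $\mathbf u\in\mathcal V^*$, $\mathbb E[h_{\mathbf u}(X_T)]=h_{\mathbf c(T)}(x_0)$.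
   Context: Order and type. An entire function $h\in H(\mathbb C)$ has order $\eta=\inf\{c>0:|h(z)|<\exp(|z|^c)\text{ for sufficiently large }|z|\}$; if the order $\eta$ is finite, its type is $\tau=\inf\{c>0:|h(z)|<\exp(c|z|^\eta)\text{ for sufficiently large }|z|\}$. ''$h$ is of exponential type $\tau<\alpha$'' means that its order is $<1$, or its order is $1$ and its type $\tau$ satisfies $\tau<\alpha$; equivalently $|h(z)|\le C\exp(\tau|z|)$ on $\mathbb C$ for some $\tau<\alpha$, $C>0$. Lévy process. $T>0$ is fixed. The characteristics $(b,a,F)$, $b\in\mathbb R$, $a\ge0$, $F$ a Lévy measure on $\mathbb R$ with $F(\{0\})=0$ and $\int|y|\wedge|y|^2F(dy)<\infty$, are taken with respect to the truncation function $\chi(\xi)=\xi$; the extended generator is $$\mathcal Af(x)=bf'(x)+\tfrac12af''(x)+\int_{\mathbb R}f(x+y)-f(x)-f'(x)y\ F(dy),\quad x\in S,$$ with domain $\mathcal D(\mathcal A)=\{f\in C^2(\mathbb R;\mathbb C):\int|f(x+y)-f(x)-f'(x)y|F(dy)<\infty\ \forall x\in S\}$. Spaces. For complex sequences $\mathbf u=(\mathbf u_\alpha)_{\alpha\in\mathbb N_0}$, $h_{\mathbf u}(z)=\sum_\alpha\mathbf u_\alpha z^\alpha/\alpha!$. With $R(S)=\sup\{|x|:x\in S\}$ and $P_R=\{z\in\mathbb C:|z|<R\}$: $\mathcal O(S)$ is the set of $f:S\to\mathbb C$ which are restrictions to $S$ of functions holomorphic on $P_{R(S)+\varepsilon}$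 for some $\varepsilon>0$; $\mathcal S^*$ is the set of $\mathbf u$ whose power series $h_{\mathbf u}$ converges absolutely on $P_{R(S)}$ and coincides there with a function holomorphic on $P_{R(S)+\varepsilon}$ for some $\varepsilon>0$. For a linear subset $\mathcal V\subseteq\mathcal O(S)$ (functions being restricted to $S$), $X$ is an $S$-valued $\mathcal V$-holomorphic process if for each $f\in\mathcal V$: $f\in\mathcal D(\mathcal A)$, $\mathcal Af\in\mathcal O(S)$, and $N^f$ is a local martingale. $L:\mathcal V^*\to\mathcal S^*$ denotes a linear map with $\mathcal Ah_{\mathbf u}=h_{L(\mathbf u)}|_S$ for all $\mathbf u\in\mathcal V^*$. *)

(* Defs.v *)
From HB Require Import structures.
From mathcomp Require Import all_boot all_order all_algebra.
From mathcomp Require Import complex.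
From mathcomp Require Import all_classical all_reals all_analysis.
From mathcomp Require Import measurable_realfun.

Set Implicit Arguments.
Unset Strict Implicit.
Unset Printing Implicit Defensive.

Import Order.TTheory GRing.Theory Num.Theory.
Import numFieldNormedType.Exports.

Local Open Scope classical_set_scope.
Local Open Scope ring_scope.

Local Notation normc := Normc.normc.
Local Notation Re := complex.Re.
Local Notation Im := complex.Im.

Section ComplexValued.
Context {R : realType}.
Local Notation C := R[i].

Definition ofR (x : R) : C := Complex x 0.

Definition cexp (z : C) : C :=
  Complex (expR (Re z) * cos (Im z)) (expR (Re z) * sin (Im z)).

Definition cderive1 (f : R -> C) (x : R) : C :=
  Complex (derive1 (fun t => Re (f t)) x) (derive1 (fun t => Im (f t)) x).

Definition C2_real (g : R -> R) : Prop :=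
  [/\ forall x, derivable g x 1,
      forall x, derivable (derive1 g) x 1 &
      continuous (derive1 (derive1 g))].

Definition C2 (f : R -> C) : Prop :=
  C2_real (fun x => Re (f x)) /\ C2_real (fun x => Im (f x)).

Section Integral.
Context {d} {T : measurableType d} (mu : {measure set T -> \bar R}).

Definition cintegrable (D : set T) (f : T -> C) : Prop :=
  mu.-integrable D (fun x => (Re (f x))%:E) /\
  mu.-integrable D (fun x => (Im (f x))%:E).

Definition cintegral (D : set T) (f : T -> C) : C :=
  Complex (Rintegral mu D (fun x => Re (f x)))
          (Rintegral mu D (fun x => Im (f x))).
End Integral.

(* [C^o] carries the metric topology of the complex plane; derivability in
   the direction 1 over the field [C] is complex differentiability. *)
Definition holomorphic_on (D : set C) (f : C -> C) : Prop :=
  forall z, D z -> derivable (f : C^o -> C^o) z 1.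

Definition entire (h : C -> C) : Prop := holomorphic_on setT h.

Definition growth_order (h : C -> C) : \bar R :=
  ereal_inf [set c%:E | c in [set c : R | 0 < c /\
    exists M : R, forall z, M <= normc z ->
      normc (h z) < expR (normc z `^ c)]].

(* Only meaningful when [growth_order h] is finite. *)
Definition growth_type (h : C -> C) : \bar R :=
  ereal_inf [set c%:E | c in [set c : R | 0 < c /\
    exists M : R, forall z, M <= normc z ->
      normc (h z) < expR (c * normc z `^ fine (growth_order h))]].

Definition exp_type_lt (alpha : R) (h : C -> C) : Prop :=
  (growth_order h < 1)%E \/
  (growth_order h = 1%E /\ (growth_type h < alpha%:E)%E).

Definition Vexp (alpha : R) : set (C -> C) :=
  [set h | entire h /\ exp_type_lt alpha h].

Definition restrictR (h : C -> C) : R -> C := fun x => h (ofR x).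

Definition hterm (u : nat -> C) (z : C) : nat -> C :=
  fun k => u k * z ^+ k / k`!%:R.

Definition habs_cvg (u : nat -> C) (z : C) : Prop :=
  cvgn (series (fun k => normc (hterm u z k))).

Definition hser (u : nat -> C) (z : C) : C :=
  limn (series (fun k => hterm u z k : C^o)).

(* [sup_abs S] is infinite when [S] is unbounded, and then [disk] is all
   of the complex plane, whatever is added to the radius. *)
Definition sup_abs (S : set R) : \bar R := ereal_sup [set `|x|%:E | x in S].

Definition disk (r : \bar R) : set C := [set z | ((normc z)%:E < r)%E].

(* Functions are total on the real line; only the values on [S] matter. *)
Definition Ospace (S : set R) : set (R -> C) :=
  [set f | exists (e : R) (g : C -> C), [/\ 0 < e,
     holomorphic_on (disk (sup_abs S + e%:E)%E) g &
     forall x, S x -> f x = g (ofR x)]].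

Definition Sstar (S : set R) : set (nat -> C) :=
  [set u | exists (e : R) (g : C -> C), [/\ 0 < e,
     holomorphic_on (disk (sup_abs S + e%:E)%E) g &
     forall z, disk (sup_abs S) z -> habs_cvg u z /\ hser u z = g z]].

(* [h_u = h] is an identity of entire functions; convergence is required
   explicitly since [limn] has a default value. *)
Definition Vstar (S : set R) (V : set (C -> C)) : set (nat -> C) :=
  [set u | Sstar S u /\
     exists2 h, V h & forall z, habs_cvg u z /\ hser u z = h z].

Definition levy_measure
    (nu : {measure set (measurableTypeR R) -> \bar R}) : Prop :=
  nu [set 0] = 0%E /\
  (\int[nu]_y (Num.min `|y| (`|y| ^+ 2))%:E < +oo)%E.

Section Generator.
Variables (b a : R) (nu : {measure set (measurableTypeR R) -> \bar R}).

Definition jump_increment (f : R -> C) (x y : R) : C :=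
  f (x + y) - f x - cderive1 f x * ofR y.

Definition generator (f : R -> C) (x : R) : C :=
  ofR b * cderive1 f x + ofR (a / 2) * cderive1 (cderive1 f) x +
  cintegral nu setT (jump_increment f x).

Definition generator_domain (S : set R) : set (R -> C) :=
  [set f | C2 f /\ forall x, S x ->
     (\int[nu]_y (normc (jump_increment f x y))%:E < +oo)%E].

Definition levy_exponent (u : R) : C :=
  Complex 0 (u * b) - ofR (a * u ^+ 2 / 2) +
  cintegral nu setT
    (fun y => cexp (Complex 0 (u * y)) - 1 - Complex 0 (u * y)).

Definition dual_operator (S : set R) (V : set (C -> C))
    (L : (nat -> C) -> (nat -> C)) : Prop :=
  [/\ forall u, Vstar S V u -> Sstar S (L u),
      forall (k : C) u v, Vstar S V u -> Vstar S V v ->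
        L (fun n => k * u n + v n) = (fun n => k * L u n + L v n) &
      forall u, Vstar S V u -> forall x, S x ->
        generator (restrictR (hser u)) x = hser (L u) (ofR x)].
End Generator.

Definition linear_subset (V : set (R -> C)) : Prop :=
  V (fun=> 0) /\
  forall (k : C) f g, V f -> V g -> V (fun x => k * f x + g x).

Section Processes.
Context {d : measure_display} {Omega : measurableType d}.
Variables (P : probability Omega R) (T : R) (F : R -> set (set Omega)).

Definition filtration : Prop :=
  [/\ forall t : R, 0 <= t <= T -> sigma_algebra setT (F t),
      forall t : R, 0 <= t <= T -> F t `<=` measurable &
      forall s t : R, 0 <= s -> s <= t -> t <= T -> F s `<=` F t].

Definition adapted (X : R -> Omega -> R) : Prop :=
  forall t : R, 0 <= t <= T -> forall B : set (measurableTypeR R),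
    measurable B -> F t (X t @^-1` B).

Definition cadlag (X : R -> Omega -> R) : Prop :=
  forall w,
    (forall t : R, 0 <= t < T -> X s w @[s --> t^'+] --> X t w) /\
    (forall t : R, 0 < t <= T -> cvg (X s w @[s --> t^'-])).

(* The last clause is [E[M_t | F_s] = M_s], unfolded. *)
Definition real_martingale (M : R -> Omega -> R) : Prop :=
  [/\ adapted M, cadlag M,
      forall t : R, 0 <= t <= T -> P.-integrable setT (fun w => (M t w)%:E) &
      forall s t : R, 0 <= s -> s <= t -> t <= T -> forall A, F s A ->
        (\int[P]_(w in A) (M t w)%:E = \int[P]_(w in A) (M s w)%:E)%E].

Definition martingale (M : R -> Omega -> C) : Prop :=
  real_martingale (fun t w => Re (M t w)) /\
  real_martingale (fun t w => Im (M t w)).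

(* Values of [tau] beyond the horizon [T] play the role of infinity. *)
Definition stopping_time (tau : Omega -> R) : Prop :=
  (forall w, 0 <= tau w) /\
  forall t : R, 0 <= t <= T -> F t [set w | tau w <= t].

Definition stopped (M : R -> Omega -> C) (tau : Omega -> R) :=
  fun t w => M (Num.min t (tau w)) w.

Definition local_martingale (M : R -> Omega -> C) : Prop :=
  [/\ adapted (fun t w => Re (M t w)) /\ adapted (fun t w => Im (M t w)),
      cadlag (fun t w => Re (M t w)) /\ cadlag (fun t w => Im (M t w)) &
      exists tau : nat -> Omega -> R,
        [/\ forall n, stopping_time (tau n),
            forall n w, tau n w <= tau n.+1 w,
            {ae P, forall w, exists n, T <= tau n w} &
            forall n, martingale (stopped M (tau n))]].

Section Levy.
Variables (b a : R) (nu : {measure set (measurableTypeR R) -> \bar R}).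

Definition increment (X : R -> Omega -> R) (s t : R) (w : Omega) : R :=
  X t w - X s w.

(* The characteristics, relative to the truncation function [xi |-> xi],
   enter through the Levy-Khintchine formula. *)
Definition levy_process (X : R -> Omega -> R) : Prop :=
  [/\ adapted X,
      cadlag X,
      (forall s t : R, 0 <= s -> s <= t -> t <= T ->
        forall (A : set Omega) (B : set (measurableTypeR R)),
          F s A -> measurable B ->
          P (A `&` increment X s t @^-1` B) =
          (P A * P (increment X s t @^-1` B))%E),
      (forall s t : R, 0 <= s -> s <= t -> t <= T ->
        forall B : set (measurableTypeR R), measurable B ->
          P (increment X s t @^-1` B) =
          P (increment X 0 (t - s) @^-1` B)) &
      (forall t u : R, 0 <= t <= T ->
        cintegral P setT (fun w => cexp (Complex 0 (u * increment X 0 t w))) =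
        cexp (ofR t * levy_exponent b a nu u))].

Definition valued_in (S : set R) (X : R -> Omega -> R) : Prop :=
  forall (t : R) (w : Omega), 0 <= t <= T -> S (X t w).

Definition Nproc (X : R -> Omega -> R) (f : R -> C) (t : R) (w : Omega) : C :=
  f (X t w) - f (X 0 w) -
  cintegral lebesgue_measure `[0, t]
    (fun s => generator b a nu f (X s w)).

Definition holomorphic_process (S : set R) (V : set (R -> C))
    (X : R -> Omega -> R) : Prop :=
  [/\ linear_subset V, V `<=` Ospace S, valued_in S X &
      forall f, V f ->
        [/\ generator_domain nu S f,
            Ospace S (generator b a nu f) &
            local_martingale (Nproc X f)]].
End Levy.
End Processes.

End ComplexValued.

(* Main.v *)
(** An entire function has exponential type smaller than [alpha] iff its Taylor
    coefficients [u_k = h^(k)(0)] satisfy [|u_k| <= D t^k] for some [t < alpha]: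
    this is Cauchy's estimate on circles of radius [k / t].  On such sequences
    the generator becomes [(L u)_k = sum_n lam_n u_(n+k)], where [lam] lists the
    Taylor coefficients of the Levy symbol, with
    [sum_n |lam_n| alpha^n < oo]; so [L] is bounded for the weighted sup norm
    and [c(t) = exp(t L) u] is given by a power series in [t].
    The exponential moment is assumed of the Levy measure only.  It passes to
    the increments [Y] of the process through the characteristic function, which
    has Taylor expansions of all orders at 0: the alternating remainders of cos
    are nonnegative, hence Fatou's lemma yields the even moments of [Y] one
    after the other, and their sum bounds [E exp(alpha |Y|)].  Then
    [E h_u(x + Y_t) = h_(exp(t L) u)(x)], and independence of the increments
    gives, for [A] in [F_s],
    [E[1_A h_u(X_t)] = sum_j (t - s)^j / j! E[1_A h_(L^j u)(X_s)]].
    The derivative in [t] of the right-hand side is the same expression for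
    [L u]; integrating it proves the martingale property of [N^h].  As [N^h] is
    a true martingale, the constant times [T] localize it. *)

From HB Require Import structures.
Require Import Defs.
From mathcomp Require Import all_boot all_order all_algebra.
From mathcomp Require Import complex.
From mathcomp Require Import all_classical all_reals all_analysis.
From mathcomp Require Import measurable_realfun.
From mathcomp Require Import ring lra.

Import Order.TTheory GRing.Theory Num.Theory.
Import numFieldNormedType.Exports.

Local Open Scope classical_set_scope.
Local Open Scope ring_scope.

Local Notation normc := Normc.normc.
Local Notation Re := complex.Re.
Local Notation Im := complex.Im.

(** * Exponentially dominated power series *)

(** The coefficients [lam] are real, so the operators act on real and imaginary parts separately and
    are studied on real sequences; contour integration enters only to bound the coefficients of a
    function in [Vexp alpha]. Two facts about sequences do most of the work. A functional bounded
    for the weighted sup norm commutes with absolutely convergent series of sequences, hence with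
    [exp (t L)]; point evaluations, coordinates of [L u] and [u -> E[1_A h_u(X_s)]] are all of this
    kind. And for sequences whose rate is strictly below [alpha], such a functional is determined by
    its values on the monomials [x ^ n / n!], on which [exp (t L)] is a finite sum. The link to
    probability is that these finite sums, the coefficients of [exp (t lam(z))], are also the Taylor
    coefficients at 0 of the characteristic function of the increment, hence its moments divided by
    [n!]. As the process is constrained on [[0, T]] only, time is frozen outside that interval
    wherever joint measurability is used. *)

Section DominatedSeries.
Context {R : realType}.
Implicit Types (a b : nat -> R).

Lemma eq_ler (x y : R) : x = y -> x <= y. Proof. by move=> ->. Qed.

Lemma series_ord a n : series a n = \sum_(k < n) a k.
Proof. by rewrite /series /= big_mkord. Qed.

Lemma dom_cvg {a b} : (forall k, `|a k| <= b k) -> cvgn (series b) ->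
  cvgn (series a).
Proof.
move=> ab cb; apply: normed_cvg.
have b0 k : 0 <= b k by exact: le_trans (normr_ge0 _) (ab k).
exact: (@series_le_cvg _ _ b _ b0 ab cb).
Qed.

Lemma dom_lim {a b} : (forall k, `|a k| <= b k) -> cvgn (series b) ->
  `|limn (series a)| <= limn (series b).
Proof.
move=> ab cb.
have ca : cvgn (series (fun k => `|a k|)).
  by apply: (dom_cvg (b := b)) => // k; rewrite normr_id.
apply: le_trans (lim_series_norm ca) _.
exact: (lim_series_le ca cb ab).
Qed.

Lemma is_cvg_drop {a} N : cvgn (series a) -> cvgn (series (fun k => a (N + k)%N)).
Proof.
move=> ca.
have -> : series (fun k => a (N + k)%N) =
    (fun n => series a (n + N)%N) \- cst (series a N).
  apply/funext => n; rewrite /= /series /=.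
  rewrite [X in _ = X - _](@big_cat_nat _ _ _ N) ?leq_addl//=.
  rewrite addrAC subrr add0r.
  have -> : \sum_(N <= i < n + N) a i = \sum_(0 <= i < n) a (i + N)%N.
    by rewrite -{1}[N]add0n big_addn addnK.
  by apply: eq_bigr => i _; rewrite addnC.
apply: is_cvgB; last exact: is_cvg_cst.
by apply/cvg_ex; exists (limn (series a)); rewrite cvg_shiftn.
Qed.

Lemma lim_drop {a} N : cvgn (series a) ->
  limn (series (fun k => a (N + k)%N)) = limn (series a) - series a N.
Proof.
move=> ca.
have E : series (fun k => a (N + k)%N) =
    (fun n => series a (n + N)%N) \- cst (series a N).
  apply/funext => n; rewrite /= /series /=.
  rewrite [X in _ = X - _](@big_cat_nat _ _ _ N) ?leq_addl//=.
  rewrite addrAC subrr add0r.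
  have -> : \sum_(N <= i < n + N) a i = \sum_(0 <= i < n) a (i + N)%N.
    by rewrite -{1}[N]add0n big_addn addnK.
  by apply: eq_bigr => i _; rewrite addnC.
rewrite E; apply/cvg_lim => //; apply: cvgB; last exact: cvg_cst.
by rewrite cvg_shiftn.
Qed.

Lemma dom_tail {a b} N : (forall k, `|a k| <= b k) -> cvgn (series b) ->
  `|limn (series a) - series a N| <= limn (series b) - series b N.
Proof.
move=> ab cb; rewrite -!lim_drop//; last exact: dom_cvg cb.
by apply: dom_lim => //; exact: is_cvg_drop.
Qed.

Lemma lim_series0 {b} : cvgn (series b) ->
  (fun N => limn (series b) - series b N) @ \oo --> (0 : R).
Proof.
move=> cb; rewrite -[X in _ --> X](subrr (limn (series b))).
by apply: cvgB => //; exact: cvg_cst.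
Qed.

Lemma series_ge0_le_lim {b} N : (forall k, 0 <= b k) -> cvgn (series b) ->
  series b N <= limn (series b).
Proof.
move=> b0 cb.
have : forall k, `|(0 : R)| <= b k by move=> k; rewrite normr0.
move=> /(dom_tail N) /(_ cb) /(le_trans (normr_ge0 _)); lra.
Qed.

Lemma lim_series_lin {a b} c : cvgn (series a) -> cvgn (series b) ->
  limn (series (fun k => c * a k + b k)) = c * limn (series a) + limn (series b).
Proof.
move=> ca cb; apply/cvg_lim => //.
have -> : series (fun k => c * a k + b k) = (fun n => c * series a n + series b n).
  by apply/funext => n; rewrite /series /= big_split /= mulr_sumr.
by apply: cvgD => //; apply: cvgMr.
Qed.

Lemma cvg_series_lin {a b} c : cvgn (series a) -> cvgn (series b) ->
  cvgn (series (fun k => c * a k + b k)).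
Proof.
move=> ca cb; apply/cvg_ex; exists (c * limn (series a) + limn (series b)).
have -> : series (fun k => c * a k + b k) = (fun n => c * series a n + series b n).
  by apply/funext => n; rewrite /series /= big_split /= mulr_sumr.
by apply: cvgD => //; apply: cvgMr.
Qed.

Lemma cvg_series_scale {a} c : cvgn (series a) -> cvgn (series (fun k => c * a k)).
Proof.
move=> ca; have := @is_cvg_seriesZ _ a c ca.
by have -> : c *: (a : nat -> R^o) = (fun k => c * a k) by apply/funext.
Qed.

Lemma lim_series_scale {a} c : cvgn (series a) ->
  limn (series (fun k => c * a k)) = c * limn (series a).
Proof.
move=> ca; apply/cvg_lim => //.
have -> : series (fun k => c * a k) = (fun n => c * series a n).
  by apply/funext => n; rewrite /series /= mulr_sumr.
exact: cvgMr.
Qed.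

Lemma lim_series_fin {a} N : (forall k, (N <= k)%N -> a k = 0) ->
  limn (series a) = \sum_(k < N) a k.
Proof.
move=> a0; apply/cvg_lim => //.
rewrite -(cvg_shiftn N).
rewrite (_ : (fun n => _) = cst (\sum_(k < N) a k)); first exact: cvg_cst.
apply/funext => n; rewrite /series /= (@big_cat_nat _ _ _ N) ?leq_addl//=.
rewrite big_mkord [X in _ + X]big_nat_cond [X in _ + X]big1 ?addr0// => i /andP[/andP[+ _] _].
exact: a0.
Qed.

Lemma cvg_series_fin {a} N : (forall k, (N <= k)%N -> a k = 0) -> cvgn (series a).
Proof.
move=> a0; apply/cvg_ex; exists (\sum_(k < N) a k).
rewrite -(cvg_shiftn N).
rewrite (_ : (fun n => _) = cst (\sum_(k < N) a k)); first exact: cvg_cst.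
apply/funext => n; rewrite /series /= (@big_cat_nat _ _ _ N) ?leq_addl//=.
rewrite big_mkord [X in _ + X]big_nat_cond [X in _ + X]big1 ?addr0// => i /andP[/andP[+ _] _].
exact: a0.
Qed.

Lemma bounded_cvg_series {b} M : (forall k, 0 <= b k) ->
  (forall N, \sum_(k < N) b k <= M) -> cvgn (series b).
Proof.
move=> b0 bM; apply: nondecreasing_is_cvgn; first exact: nondecreasing_series.
by exists M => _ [n _ <-]; rewrite /series /= big_mkord.
Qed.

End DominatedSeries.

(** * Series with factorial denominators *)

Section PowerSeries.
Context {R : realType}.
Implicit Types (u v : nat -> R) (x y t A : R).

(** [C] bounds the sup norm with weights [t ^- k]; the rate [t] then bounds the exponential type of
    [rser u]. *)
Definition geo_bounded (C t : R) (u : nat -> R) := forall k, `|u k| <= C * t ^+ k.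

Definition rser v x := limn (series (fun k => v k * x ^+ k / k`!%:R)).

(** Differentiation on the level of coefficients: [rser (shiftn n u)] is the [n]-th derivative of
    [rser u]. *)
Definition shiftn n (u : nat -> R) : nat -> R := fun k => u (n + k)%N.

Lemma exp_coeffE x k : exp_coeff x k = x ^+ k / k`!%:R. Proof. by []. Qed.

Lemma geo_bounded_ge0 {C t u} : geo_bounded C t u -> 0 <= C.
Proof. by move=> /(_ 0%N); rewrite expr0 mulr1; apply: le_trans. Qed.

Lemma geo_bounded_shift {C t u} n : geo_bounded C t u ->
  geo_bounded (C * t ^+ n) t (shiftn n u).
Proof. by move=> bu k; rewrite -mulrA -exprD; exact: bu. Qed.

Lemma geo_bounded_lin {C D t u v} c : geo_bounded C t u -> geo_bounded D t v ->
  geo_bounded (`|c| * C + D) t (fun k => c * u k + v k).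
Proof.
move=> bu bv k; rewrite (le_trans (ler_normD _ _))// mulrDl lerD//.
by rewrite normrM -mulrA ler_wpM2l.
Qed.

Lemma geo_bounded_le {C t s u} : 0 <= t -> t <= s -> geo_bounded C t u ->
  geo_bounded C s u.
Proof.
move=> t0 ts bu k; apply: le_trans (bu k) _.
by rewrite ler_wpM2l ?(geo_bounded_ge0 bu)// lerXn2r// nnegrE// (le_trans t0).
Qed.

Lemma geo_bounded_term {C t u} x : 0 <= t -> geo_bounded C t u -> forall k,
  `|u k * x ^+ k / k`!%:R| <= C * exp_coeff (t * `|x|) k.
Proof.
move=> t0 bu k; rewrite exp_coeffE !normrM normrX normfV [`|_%:R|]ger0_norm ?ler0n//.
by rewrite exprMn !mulrA !ler_wpM2r ?invr_ge0 ?ler0n ?exprn_ge0//; exact: bu.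
Qed.

Lemma cvg_scaled_exp C x : cvgn (series (fun k => C * exp_coeff x k)).
Proof. by apply: cvg_series_scale; exact: is_cvg_series_exp_coeff. Qed.

Lemma rser_cvg {C t u} x : 0 <= t -> geo_bounded C t u ->
  cvgn (series (fun k => u k * x ^+ k / k`!%:R)).
Proof.
move=> t0 bu; apply: (dom_cvg (geo_bounded_term x t0 bu)); exact: cvg_scaled_exp.
Qed.

Lemma rser_le {C t u} x : 0 <= t -> geo_bounded C t u ->
  `|rser u x| <= C * expR (t * `|x|).
Proof.
move=> t0 bu; apply: le_trans (dom_lim (geo_bounded_term x t0 bu) _) _.
  exact: cvg_scaled_exp.
by rewrite lim_series_scale//; exact: is_cvg_series_exp_coeff.
Qed.

Lemma rser_lin {C D t u v} c x : 0 <= t -> geo_bounded C t u -> geo_bounded D t v ->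
  rser (fun k => c * u k + v k) x = c * rser u x + rser v x.
Proof.
move=> t0 bu bv.
rewrite /rser -(lim_series_lin c (rser_cvg x t0 bu) (rser_cvg x t0 bv)).
congr (limn (series _)); apply/funext => k; ring.
Qed.

Lemma rser0 u : rser u 0 = u 0%N.
Proof.
rewrite /rser (lim_series_fin 1).
  by rewrite big_ord1 expr0 fact0 mulr1 divr1.
by move=> [//|k] _; rewrite expr0n mulr0 mul0r.
Qed.

Lemma pseriesE u x : pseries (fun k => u k / k`!%:R) x =
  series (fun k => u k * x ^+ k / k`!%:R).
Proof.
rewrite /pseries; congr series; apply/funext => k /=; by rewrite mulrAC.
Qed.

Lemma pseries_diffsE u :
  pseries_diffs (fun k => u k / k`!%:R) = (fun k => shiftn 1 u k / k`!%:R).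
Proof.
apply/funext => k; rewrite /pseries_diffs /shiftn add1n factS natrM invfM.
by rewrite mulrCA [_ * (_ / _)]mulrA divff ?pnatr_eq0// mul1r.
Qed.

Lemma is_derive_rser {C t u} x : 0 <= t -> geo_bounded C t u ->
  is_derive x (1 : R) (rser u) (rser (shiftn 1 u) x).
Proof.
move=> t0 bu.
have E v : rser v = (fun x => limn (pseries (fun k => v k / k`!%:R) x)).
  by apply/funext => z; rewrite /rser -pseriesE.
rewrite !E -pseries_diffsE.
(* Termwise differentiation asks for convergence of the series and of its first two formal
   derivatives at a point beyond [x]. Shifting keeps the rate [t], so [|x| + 1] serves all three. *)
apply: (@pseries_snd_diffs _ _ (`|x| + 1)); rewrite ?pseries_diffsE ?pseriesE.
- exact: rser_cvg bu.
- by apply: (rser_cvg _ t0); apply: geo_bounded_shift bu.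
- by apply: (rser_cvg _ t0); apply/geo_bounded_shift/geo_bounded_shift/bu.
- by rewrite [ltRHS]ger0_norm ?addr_ge0// ltrDl.
Qed.

Lemma continuous_rser {C t u} : 0 <= t -> geo_bounded C t u -> continuous (rser u).
Proof.
move=> t0 bu x; apply/differentiable_continuous/derivable1_diffP.
by case: (is_derive_rser x t0 bu).
Qed.

Lemma derive1_rser {C t u} : 0 <= t -> geo_bounded C t u ->
  derive1 (rser u) = rser (shiftn 1 u).
Proof.
move=> t0 bu; apply/funext => x; rewrite derive1E.
by case: (is_derive_rser x t0 bu).
Qed.

End PowerSeries.

(** * Bounded functionals on coefficient sequences *)

Section LinearFunctionals.
Context {R : realType}.
Implicit Types (u v : nat -> R) (x y t A C : R).

Definition delta (n : nat) : nat -> R := fun k => (k == n)%:R.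

(** Linearity is asked on bounded sequences only, where the series defining the functionals in
    question converge. *)
Definition geo_functional (K t : R) (phi : (nat -> R) -> R) :=
  (forall C u, geo_bounded C t u -> `|phi u| <= K * C) /\
  (forall C D c u v, geo_bounded C t u -> geo_bounded D t v ->
    phi (fun k => c * u k + v k) = c * phi u + phi v).

Lemma geo_bounded0 t : 0 <= t -> geo_bounded 0 t (fun=> 0 : R).
Proof. by move=> t0 k; rewrite normr0 mul0r. Qed.

Lemma geo_functional0 {K t phi} : 0 <= t -> geo_functional K t phi -> phi (fun=> 0) = 0.
Proof.
move=> t0 [/(_ _ _ (geo_bounded0 t t0))]; rewrite mulr0 => + _.
by rewrite normr_le0 => /eqP.
Qed.

(* A functional that is bounded for the weighted sup norm commutes with
   absolutely convergent series of sequences. *)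
Lemma geo_functional_series {K t phi} (w : nat -> nat -> R) (c B : nat -> R) :
  0 <= t -> 0 <= K -> geo_functional K t phi ->
  (forall n, geo_bounded (B n) t (w n)) ->
  cvgn (series (fun n => `|c n| * B n)) ->
  cvgn (series (fun n => c n * phi (w n))) /\
  phi (fun k => limn (series (fun n => c n * w n k))) =
    limn (series (fun n => c n * phi (w n))).
Proof.
move=> t0 K0 [bphi lphi] bw cB.
have cwt k : forall n, `|c n * w n k| <= `|c n| * B n * t ^+ k.
  by move=> n; rewrite normrM -mulrA ler_wpM2l//; exact: bw.
have cBt a : cvgn (series (fun n => `|c n| * B n * a)).
  rewrite (_ : (fun n => _) = (fun n => a * (`|c n| * B n))); last first.
    by apply/funext => n; rewrite mulrC.
  exact: cvg_series_scale.
have cphi n : `|c n * phi (w n)| <= `|c n| * B n * K.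
  by rewrite normrM -mulrA ler_wpM2l// mulrC; exact: bphi.
have cvphi := dom_cvg cphi (cBt K).
split => //.
set v := (X in phi X).
pose part N k := \sum_(n < N) c n * w n k.
have bpart N : geo_bounded (\sum_(n < N) `|c n| * B n) t (part N).
  move=> k; rewrite (le_trans (ler_norm_sum _ _ _))// mulr_suml.
  by apply: ler_sum => n _; exact: cwt.
have phipart N : phi (part N) = \sum_(n < N) c n * phi (w n).
  elim: N => [|N IH].
    rewrite big_ord0 -[RHS](@geo_functional0 K t phi t0)//.
    by congr phi; apply/funext => k; rewrite /part big_ord0.
  rewrite big_ord_recr/= -IH addrC.
  rewrite -(lphi _ _ _ _ _ (bw N) (bpart N)).
  by congr phi; apply/funext => k; rewrite /part big_ord_recr/= addrC.
(* The tail of the scalar series bounds the remainder of the sequence-valued series in the weighted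
   norm, so [phi] of that remainder tends to 0. *)
pose r N := limn (series (fun n => `|c n| * B n)) - series (fun n => `|c n| * B n) N.
have brem N : geo_bounded (r N) t (fun k => -1 * part N k + v k).
  move=> k; rewrite mulN1r addrC.
  have := dom_tail N (cwt k) (cBt _).
  rewrite [series (fun n => c n * _) N]series_ord => /le_trans; apply.
  have -> : (fun n => `|c n| * B n * t ^+ k) = (fun n => t ^+ k * (`|c n| * B n)).
    by apply/funext => n; rewrite mulrC.
  rewrite lim_series_scale// !series_ord -mulr_sumr /r series_ord.
  by rewrite -mulrBr mulrC.
have bv : geo_bounded (r 0%N) t v.
  move=> k; have := brem 0%N k; rewrite /part big_ord0 mulr0 add0r.
  exact.
apply/esym/cvg_lim => //.
apply/cvgrPdist_le => e e0.
have Kr : (fun N => K * r N) @ \oo --> 0.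
  by rewrite -(mulr0 K); apply: cvgMr; exact: lim_series0.
near=> N.
have -> : phi v - series (fun n => c n * phi (w n)) N =
    phi (fun k => -1 * part N k + v k).
  by rewrite (lphi _ _ _ _ _ (bpart N) bv) phipart series_ord mulN1r addrC.
apply: le_trans (bphi _ _ (brem N)) _.
near: N.
have /cvgrPdist_le/(_ e e0) := Kr; apply: filterS => N.
by rewrite sub0r normrN; apply: le_trans; exact: ler_norm.
Unshelve. all: by end_near. Qed.

Lemma geo_bounded_delta A n : 0 < A -> geo_bounded (A ^- n) A (delta n).
Proof.
move=> A0 k; rewrite /delta; have [->|] := eqVneq k n.
  by rewrite normr1 mulVf// expf_neq0// gt_eqF.
by rewrite normr0 mulr_ge0// ?invr_ge0 exprn_ge0// ltW.
Qed.

(** A sequence is the sum of its coordinates times the [delta n]. For the weight [A] the norm of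
    [delta n] is [A ^- n], so the sum is dominated by a geometric series of ratio [t / A]; this is
    what [t < A] is spent on. *)
Lemma geo_functional_delta {K A phi} C t u : 0 <= t -> t < A -> 0 <= K ->
  geo_functional K A phi -> geo_bounded C t u ->
  cvgn (series (fun n => u n * phi (delta n))) /\
  phi u = limn (series (fun n => u n * phi (delta n))).
Proof.
move=> t0 tA K0 fphi bu.
have A0 : 0 < A by exact: le_lt_trans tA.
have cub n : `| `|u n| * A ^- n| <= C * (t / A) ^+ n.
  rewrite ger0_norm ?mulr_ge0 ?invr_ge0 ?exprn_ge0 ?(ltW A0)//.
  by rewrite expr_div_n mulrA ler_wpM2r ?invr_ge0 ?exprn_ge0 ?(ltW A0)//; exact: bu.
have cb : cvgn (series (fun n => C * (t / A) ^+ n)).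
  apply: is_cvg_geometric_series.
  by rewrite ger0_norm ?divr_ge0 ?(ltW A0)// ltr_pdivrMr// mul1r.
have [? E] := geo_functional_series delta u (fun n => A ^- n) (ltW A0) K0 fphi
  (fun n => geo_bounded_delta A n A0) (dom_cvg cub cb).
split => //; rewrite -E; congr phi; apply/funext => k.
rewrite (lim_series_fin k.+1); last first.
  by move=> n kn; rewrite /delta ltn_eqF ?mulr0.
rewrite big_ord_recr/= big1 ?add0r; first by rewrite /delta eqxx mulr1.
by move=> i _; rewrite /delta gtn_eqF ?mulr0.
Qed.

(** Identities between bounded functionals may be checked on the [delta n], that is, on the
    monomials [x ^ n / n!]. *)
Lemma geo_functional_ext {K K' A phi psi} C t u : 0 <= t -> t < A -> 0 <= K -> 0 <= K' ->
  geo_functional K A phi -> geo_functional K' A psi ->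
  (forall n, phi (delta n) = psi (delta n)) ->
  geo_bounded C t u -> phi u = psi u.
Proof.
move=> t0 tA K0 K'0 fphi fpsi E bu.
have [_ ->] := geo_functional_delta C t u t0 tA K0 fphi bu.
have [_ ->] := geo_functional_delta C t u t0 tA K'0 fpsi bu.
by congr (limn (series _)); apply/funext => n; rewrite E.
Qed.

Lemma geo_functional_rser x A : 0 <= A ->
  geo_functional (expR (A * `|x|)) A (rser ^~ x).
Proof.
move=> A0; split; first by move=> C u bu; rewrite mulrC; exact: rser_le.
by move=> C D c u v bu bv; exact: rser_lin bu bv.
Qed.

(** The derivatives of [rser u] at [x], hence the coefficients of its expansion around [x]. *)
Definition translate x u : nat -> R := fun k => rser (shiftn k u) x.

Lemma geo_bounded_translate {C t u} x : 0 <= t -> geo_bounded C t u ->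
  geo_bounded (C * expR (t * `|x|)) t (translate x u).
Proof.
move=> t0 bu k; rewrite /translate.
apply: le_trans (rser_le _ t0 (geo_bounded_shift k bu)) _.
by rewrite mulrAC.
Qed.

Lemma translate_lin {C D t u v} c x : 0 <= t -> geo_bounded C t u -> geo_bounded D t v ->
  translate x (fun k => c * u k + v k) = (fun k => c * translate x u k + translate x v k).
Proof.
move=> t0 bu bv; apply/funext => k; rewrite /translate.
exact: (rser_lin c x t0 (geo_bounded_shift k bu) (geo_bounded_shift k bv)).
Qed.

Lemma rser_delta n x : rser (delta n) x = x ^+ n / n`!%:R.
Proof.
rewrite /rser (lim_series_fin n.+1); last first.
  by move=> k kn; rewrite /delta gtn_eqF// !mul0r.
rewrite big_ord_recr/= big1 ?add0r; first by rewrite /delta eqxx mul1r.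
by move=> i _; rewrite /delta ltn_eqF ?mul0r.
Qed.

Lemma shiftn_delta n k : shiftn k (delta n) =
  if (k <= n)%N then delta (n - k) else fun=> 0.
Proof.
case: leqP => kn; apply/funext => j; rewrite /shiftn /delta.
  by rewrite -[in LHS](subnKC kn) eqn_add2l.
by rewrite gtn_eqF// (leq_trans kn)// leq_addr.
Qed.

Lemma translate_delta n x k : translate x (delta n) k =
  if (k <= n)%N then x ^+ (n - k) / (n - k)`!%:R else 0.
Proof.
rewrite /translate shiftn_delta; case: leqP => kn; first by rewrite rser_delta.
by rewrite /rser (lim_series_fin 0) ?big_ord0// => j _; rewrite !mul0r.
Qed.

(** Both sides are functionals of [u] bounded for the weight [t + 1], which lies strictly above the
    rate of [u]; on [delta n] the identity is the binomial theorem. No double series is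
    rearranged. *)
Lemma rserD {C t u} x y : 0 <= t -> geo_bounded C t u ->
  rser u (x + y) = rser (translate x u) y.
Proof.
move=> t0 bu.
have A0 : 0 <= t + 1 by rewrite addr_ge0.
apply: (@geo_functional_ext (expR ((t + 1) * `|x + y|))
  (expR ((t + 1) * `|x|) * expR ((t + 1) * `|y|)) (t + 1) (rser ^~ (x + y))
  (fun u => rser (translate x u) y) C t u) => //.
- by rewrite ltrDl.
- exact: geo_functional_rser.
- split.
    move=> D v bv; apply: le_trans (rser_le y A0 (geo_bounded_translate x A0 bv)) _.
    by rewrite -mulrA mulrC.
  move=> D E c v w bv bw; rewrite (translate_lin c x A0 bv bw).
  by apply: (rser_lin c y A0); apply: (geo_bounded_translate _ A0); eassumption.
move=> n; rewrite rser_delta /rser (lim_series_fin n.+1); last first.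
  by move=> k kn; rewrite translate_delta leqNgt kn/= !mul0r.
rewrite exprDn mulr_suml; apply: eq_bigr => i _.
have iN : (i <= n)%N by rewrite -ltnS.
rewrite translate_delta iN -mulr_natr -(bin_fact iN) !natrM; field.
by rewrite !pnatr_eq0 -!lt0n bin_gt0 iN !fact_gt0.
Qed.

End LinearFunctionals.

(** * Convolution operators on coefficient sequences *)

Section SymbolOperator.
Context {R : realType}.
Variables (lam : nat -> R) (A : R).
Hypothesis A0 : 0 < A.
Hypothesis lamA : cvgn (series (fun n => `|lam n| * A ^+ n)).
Implicit Types (u v : nat -> R) (x y s t C : R).

(** Bounds the norm of [opL] for every rate [t <= A] at once. *)
Definition symbol_norm := limn (series (fun n => `|lam n| * A ^+ n)).
Local Notation Lam := symbol_norm.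

(* If [f_u(x) = sum_k u_k x^k / k!], then [f_(opL u) = sum_n lam_n f_u^(n)]. *)
Definition opL u : nat -> R := fun k => limn (series (fun n => lam n * u (n + k)%N)).

Lemma symbol_norm_ge0 : 0 <= Lam.
Proof.
apply: le_trans (series_ge0_le_lim 0 _ lamA); first by rewrite series_ord big_ord0.
by move=> k; rewrite mulr_ge0// exprn_ge0// ltW.
Qed.

Lemma opL_dom {C t u} k : 0 <= t -> t <= A -> geo_bounded C t u ->
  forall n, `|lam n * u (n + k)%N| <= C * t ^+ k * (`|lam n| * A ^+ n).
Proof.
move=> t0 tA bu n; rewrite normrM mulrCA ler_wpM2l//.
apply: le_trans (bu _) _; rewrite exprD mulrA mulrAC -!mulrA.
rewrite ler_wpM2l ?(geo_bounded_ge0 bu)// ler_wpM2l ?exprn_ge0//.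
by rewrite lerXn2r// nnegrE// ltW.
Qed.

Lemma opL_cvg {C t u} k : 0 <= t -> t <= A -> geo_bounded C t u ->
  cvgn (series (fun n => lam n * u (n + k)%N)).
Proof.
by move=> t0 tA bu; apply: (dom_cvg (opL_dom k t0 tA bu)); exact: cvg_series_scale.
Qed.

Lemma geo_bounded_opL {C t u} : 0 <= t -> t <= A -> geo_bounded C t u ->
  geo_bounded (Lam * C) t (opL u).
Proof.
move=> t0 tA bu k; apply: le_trans (dom_lim (opL_dom k t0 tA bu) _) _.
  exact: cvg_series_scale.
by rewrite lim_series_scale// mulrC mulrA.
Qed.

Lemma opL_lin {C D t u v} c : 0 <= t -> t <= A ->
  geo_bounded C t u -> geo_bounded D t v ->
  opL (fun k => c * u k + v k) = (fun k => c * opL u k + opL v k).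
Proof.
move=> t0 tA bu bv; apply/funext => k.
rewrite /opL -(lim_series_lin c (opL_cvg k t0 tA bu) (opL_cvg k t0 tA bv)).
by congr (limn (series _)); apply/funext => n; rewrite mulrDr mulrCA.
Qed.

Lemma geo_functional_opL t k : 0 <= t -> t <= A ->
  geo_functional (Lam * t ^+ k) t (fun u => opL u k).
Proof.
move=> t0 tA; split.
  by move=> C u bu; rewrite mulrAC; exact: geo_bounded_opL.
by move=> C D c u v bu bv; rewrite (opL_lin c t0 tA bu bv).
Qed.

(** Evaluation at [x] is a bounded functional, so it passes through the series over [n]; shifts
    commute with each other. *)
Lemma translate_opL {C t u} x : 0 <= t -> t <= A -> geo_bounded C t u ->
  translate x (opL u) = opL (translate x u).
Proof.
move=> t0 tA bu; apply/funext => k; rewrite /translate.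
have cB : cvgn (series (fun n => `|lam n| * (C * t ^+ k * t ^+ n))).
  apply: (@dom_cvg _ _ (fun n => C * t ^+ k * (`|lam n| * A ^+ n))); last first.
    exact: cvg_series_scale.
  move=> n; rewrite ger0_norm ?mulr_ge0 ?exprn_ge0 ?(geo_bounded_ge0 bu)//.
  rewrite mulrCA ler_wpM2l ?mulr_ge0 ?exprn_ge0 ?(geo_bounded_ge0 bu)//.
  by rewrite ler_wpM2l// lerXn2r// nnegrE// ltW.
have bw n : geo_bounded (C * t ^+ k * t ^+ n) t (fun j => u (n + (k + j))%N).
  by move=> j; rewrite -!mulrA -!exprD [(k + (n + j))%N]addnCA; exact: bu.
have [_ E] := geo_functional_series _ lam _ t0 (expR_ge0 _)
  (geo_functional_rser x t t0) bw cB.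
rewrite [LHS]E /opL; congr (limn (series _)); apply/funext => n.
congr (_ * rser _ x); apply/funext => j; by rewrite /shiftn addnA.
Qed.

Lemma rser_opL {C t u} x : 0 <= t -> t <= A -> geo_bounded C t u ->
  rser (opL u) x = opL (translate x u) 0.
Proof.
move=> t0 tA bu; rewrite -(translate_opL x t0 tA bu).
by rewrite /translate; congr (rser _ x).
Qed.

Lemma geo_bounded_iter {C t u} j : 0 <= t -> t <= A -> geo_bounded C t u ->
  geo_bounded (Lam ^+ j * C) t (iter j opL u).
Proof.
move=> t0 tA bu; elim: j => [|j IH]; first by rewrite expr0 mul1r.
by rewrite exprS -mulrA; exact: geo_bounded_opL.
Qed.

Lemma translate_iter {C t u} x j : 0 <= t -> t <= A -> geo_bounded C t u ->
  translate x (iter j opL u) = iter j opL (translate x u).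
Proof.
move=> t0 tA bu; elim: j => [//|j IH].
by rewrite !iterS (translate_opL x t0 tA (geo_bounded_iter j t0 tA bu)) IH.
Qed.

Lemma iter_opL_lin {C D t u v} c j : 0 <= t -> t <= A ->
  geo_bounded C t u -> geo_bounded D t v ->
  iter j opL (fun k => c * u k + v k) =
  (fun k => c * iter j opL u k + iter j opL v k).
Proof.
move=> t0 tA bu bv; elim: j => [//|j IH]; rewrite !iterS IH.
exact: (opL_lin c t0 tA (geo_bounded_iter j t0 tA bu) (geo_bounded_iter j t0 tA bv)).
Qed.

(** The operator exponential [exp (s opL)], coordinate by coordinate; [rser] supplies the powers of
    [s] and the factorials. *)
Definition semi s u : nat -> R := fun k => rser (fun j => iter j opL u k) s.

Lemma geo_bounded_functional_iter {K C t u} phi : 0 <= t -> t <= A -> 0 <= K ->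
  geo_functional K t phi -> geo_bounded C t u ->
  geo_bounded (K * C) Lam (fun j => phi (iter j opL u)).
Proof.
move=> t0 tA K0 [bphi _] bu j; apply: le_trans (bphi _ _ (geo_bounded_iter j t0 tA bu)) _.
by rewrite mulrCA mulrC.
Qed.

Lemma geo_functional_coord t k : 0 <= t ->
  geo_functional (t ^+ k) t (fun u => u k).
Proof. by move=> t0; split => // C u bu; rewrite mulrC; exact: bu. Qed.

Lemma geo_bounded_semi {C t u} s : 0 <= t -> t <= A -> geo_bounded C t u ->
  geo_bounded (C * expR (Lam * `|s|)) t (semi s u).
Proof.
move=> t0 tA bu k; rewrite /semi.
have := geo_bounded_functional_iter _ t0 tA (exprn_ge0 k t0) (geo_functional_coord t k t0) bu.
move=> /(rser_le s symbol_norm_ge0) /le_trans; apply.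
by apply/eq_ler; ring.
Qed.

Lemma semi_lin {C D t u v} c s : 0 <= t -> t <= A ->
  geo_bounded C t u -> geo_bounded D t v ->
  semi s (fun k => c * u k + v k) = (fun k => c * semi s u k + semi s v k).
Proof.
move=> t0 tA bu bv; apply/funext => k; rewrite /semi.
under [in LHS]eq_fun do rewrite (iter_opL_lin c _ t0 tA bu bv).
apply: (rser_lin c s symbol_norm_ge0); apply: geo_bounded_functional_iter t0 tA (exprn_ge0 k t0) (geo_functional_coord t k t0) _; eassumption.
Qed.

Lemma geo_functional_semi s t k : 0 <= t -> t <= A ->
  geo_functional (expR (Lam * `|s|) * t ^+ k) t (fun u => semi s u k).
Proof.
move=> t0 tA; split.
  move=> C u bu; apply: le_trans (geo_bounded_semi s t0 tA bu k) _.
  by rewrite [X in X * _]mulrC mulrAC.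
by move=> C D c u v bu bv; rewrite (semi_lin c s t0 tA bu bv).
Qed.

(** [exp (s opL) u] is a series of sequences whose norms sum to at most [C exp (Lam |s|)], so
    bounded functionals act on it term by term. It is applied to evaluations, to coordinates of
    [opL], and finally to expectations. *)
Lemma functional_semi {K C t u} phi s : 0 <= t -> t <= A -> 0 <= K ->
  geo_functional K t phi -> geo_bounded C t u ->
  phi (semi s u) = rser (fun j => phi (iter j opL u)) s.
Proof.
move=> t0 tA K0 fphi bu.
have cB : cvgn (series (fun j => `|s ^+ j / j`!%:R| * (Lam ^+ j * C))).
  apply: (@dom_cvg _ _ (fun j => C * exp_coeff (Lam * `|s|) j)); last exact: cvg_scaled_exp.
  move=> j; rewrite ger0_norm ?mulr_ge0 ?exprn_ge0 ?symbol_norm_ge0 ?(geo_bounded_ge0 bu)//.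
  rewrite exp_coeffE normrM normrX normfV [`|_%:R|]ger0_norm// exprMn.
  by apply/eq_ler; ring.
have [_ E] := geo_functional_series (fun j => iter j opL u) (fun j => s ^+ j / j`!%:R) _
  t0 K0 fphi (fun j => geo_bounded_iter j t0 tA bu) cB.
have -> : semi s u = fun k => limn (series (fun j => s ^+ j / j`!%:R * iter j opL u k)).
  apply/funext => k; rewrite /semi /rser; congr (limn (series _)); apply/funext => j; ring.
rewrite E /rser; congr (limn (series _)); apply/funext => j; ring.
Qed.

Lemma opL_semi {C t u} s : 0 <= t -> t <= A -> geo_bounded C t u ->
  opL (semi s u) = semi s (opL u).
Proof.
move=> t0 tA bu; apply/funext => k.
have K0 : 0 <= Lam * t ^+ k by rewrite mulr_ge0 ?symbol_norm_ge0 ?exprn_ge0.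
rewrite (functional_semi _ s t0 tA K0 (geo_functional_opL t k t0 tA) bu).
by rewrite /semi; congr (rser _ s); apply/funext => j; rewrite -iterS iterSr.
Qed.

Lemma rser_semi {C t u} s x : 0 <= t -> t <= A -> geo_bounded C t u ->
  rser (semi s u) x = rser (fun j => rser (iter j opL u) x) s.
Proof.
move=> t0 tA bu.
exact: (functional_semi _ s t0 tA (expR_ge0 _) (geo_functional_rser x t t0) bu).
Qed.

Lemma rser_semi_translate {C t u} s x : 0 <= t -> t <= A -> geo_bounded C t u ->
  rser (semi s u) x = semi s (translate x u) 0.
Proof.
move=> t0 tA bu; rewrite (rser_semi s x t0 tA bu) /semi; congr (rser _ s).
apply/funext => j; rewrite -(translate_iter x j t0 tA bu) /translate.
by congr (rser _ x).
Qed.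

Lemma semi_deltas {C t u} s : 0 <= t -> t < A -> geo_bounded C t u ->
  semi s u 0 = limn (series (fun n => u n * semi s (delta n) 0)).
Proof.
move=> t0 tA bu.
have F := geo_functional_semi s A 0 (ltW A0) (lexx A).
have [|_ ->] := geo_functional_delta C t u t0 tA _ F bu => //.
by rewrite mulr_ge0 ?expR_ge0 ?exprn_ge0// ltW.
Qed.

(** The coefficients of the [j]-th power of the formal power series with coefficients [lam]. *)
Fixpoint conv_pow (j n : nat) : R :=
  if j is j'.+1 then \sum_(k < n.+1) lam k * conv_pow j' (n - k) else (n == 0)%:R.

Lemma conv_powS j n : conv_pow j.+1 n = \sum_(k < n.+1) lam k * conv_pow j (n - k).
Proof. by []. Qed.

(** Like differentiation, [opL] maps the monomial [delta n] to a combination of monomials of degree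
    at most [n]; its powers act there by finite convolutions. *)
Lemma iter_opL_delta j n k :
  iter j opL (delta n) k = if (k <= n)%N then conv_pow j (n - k) else 0.
Proof.
elim: j k => [|j IH] k.
  rewrite /= /delta subn_eq0; by have [//|_|//] := ltngtP k n.
rewrite iterS /opL.
have E m : iter j opL (delta n) (m + k)%N =
    if (m <= n - k)%N && (k <= n)%N then conv_pow j (n - k - m) else 0.
  rewrite IH; case: (leqP k n) => kn; rewrite ?andbT ?andbF.
    by rewrite leq_subRL// addnC -subnDA addnC.
  by rewrite leqNgt (leq_trans kn)// leq_addl.
under eq_fun do rewrite E.
case: (leqP k n) => kn.
  rewrite (lim_series_fin (n - k).+1); last first.
    by move=> m mn; rewrite leqNgt mn/= mulr0.
  rewrite conv_powS; apply: eq_bigr => i _.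
  by rewrite andbT -ltnS ltn_ord.
rewrite (lim_series_fin 0) ?big_ord0// => m _; by rewrite andbF mulr0.
Qed.

(** The weighted l1 norm is submultiplicative for Cauchy products, here in terms of finite partial
    sums. *)
Lemma conv_pow_norm j N : \sum_(n < N) `|conv_pow j n| * A ^+ n <= Lam ^+ j.
Proof.
have lam_le M : \sum_(n < M) `|lam n| * A ^+ n <= Lam.
  rewrite -(series_ord (fun n => `|lam n| * A ^+ n)); apply: series_ge0_le_lim lamA.
  by move=> k; rewrite mulr_ge0// exprn_ge0// ltW.
elim: j N => [|j IH] N.
  case: N => [|N]; first by rewrite big_ord0.
  rewrite big_ord_recl big1/=; first by rewrite normr1 !mulr1 addr0.
  by move=> i _; rewrite normr0 mul0r.
rewrite exprS.
(* The triangular double sum is completed to a square by zeros before the order of summation is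
   exchanged. *)
apply: (@le_trans _ _ (\sum_(n < N) \sum_(k < N) (`|lam k| * A ^+ k) *
    (if (k <= n)%N then `|conv_pow j (n - k)| * A ^+ (n - k) else 0))).
  apply: ler_sum => n _; rewrite conv_powS.
  apply: (@le_trans _ _ (\sum_(k < n.+1) `|lam k * conv_pow j (n - k)| * A ^+ n)).
    by rewrite -mulr_suml ler_wpM2r ?exprn_ge0 ?(ltW A0)// ler_norm_sum.
  rewrite (big_ord_widen N (fun k => `|lam k * conv_pow j (n - k)| * A ^+ n))//.
  rewrite [leRHS](bigID (fun k : 'I_N => (k < n.+1)%N))/=.
  rewrite [X in _ <= _ + X]big1 ?addr0; last first.
    by move=> k; rewrite ltnS => /negbTE ->; rewrite mulr0.
  apply: ler_sum => k; rewrite ltnS => kn; rewrite kn normrM.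
  rewrite -[in A ^+ n](subnKC kn) exprD; apply/eq_ler; ring.
rewrite exchange_big/=.
apply: (@le_trans _ _ (\sum_(k < N) (`|lam k| * A ^+ k) * Lam ^+ j)); last first.
  by rewrite -mulr_suml ler_wpM2r ?exprn_ge0 ?symbol_norm_ge0.
apply: ler_sum => k _; rewrite -mulr_sumr ler_wpM2l ?mulr_ge0 ?exprn_ge0 ?(ltW A0)//.
apply: le_trans (IH (N - k)%N).
rewrite -big_mkcond/=.
rewrite -(big_mkord (fun n => (k <= n)%N) (fun n => `|conv_pow j (n - k)| * A ^+ (n - k))).
rewrite -(@big_nat_widenl _ _ _ k 0 N xpredT)// -{1}[k : nat]add0n big_addn big_mkord.
by apply/eq_ler/eq_bigr => i _; rewrite addnK.
Qed.

Hypothesis lam0 : lam 0 = 0.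

(** A power series without constant term vanishes to order [j] when raised to the power [j]. Hence
    the sum over [j] in [semi_moment] is finite. *)
Lemma conv_pow_small j n : (n < j)%N -> conv_pow j n = 0.
Proof.
elim: j n => [//|j IH] n nj; rewrite conv_powS big_ord_recl lam0 mul0r add0r.
apply: big1 => i _; rewrite IH ?mulr0//= /bump/= add1n.
case: n nj i => [|n] nj [i iN]//=; rewrite subSS.
exact: leq_ltn_trans (leq_subr i n) nj.
Qed.

(* This will be the n-th moment, divided by n!, of the increment over a time [s]. *)
Definition semi_moment s n := semi s (delta n) 0.

Lemma semi_momentE s n N : (n < N)%N ->
  semi_moment s n = \sum_(j < N) conv_pow j n * s ^+ j / j`!%:R.
Proof.
move=> nN; rewrite /semi_moment /semi /rser (lim_series_fin N).
  by apply: eq_bigr => j _; rewrite iter_opL_delta subn0.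
move=> j Nj; rewrite iter_opL_delta subn0 conv_pow_small ?mul0r//.
exact: leq_trans Nj.
Qed.

(** The [semi_moment s n] are the coefficients of [exp (s lam(z))], so their weighted l1 norm is at
    most the exponential of that of [s lam]. This becomes the bound for exponential moments of
    increments. *)
Lemma semi_moment_norm s N :
  \sum_(n < N) `|semi_moment s n| * A ^+ n <= expR (Lam * `|s|).
Proof.
apply: (@le_trans _ _ (\sum_(n < N) \sum_(j < N)
    (`|conv_pow j n| * A ^+ n) * (`|s| ^+ j / j`!%:R))).
  apply: ler_sum => n _; rewrite (@semi_momentE s n N)//.
  apply: (@le_trans _ _ (\sum_(j < N) `|conv_pow j n * s ^+ j / j`!%:R| * A ^+ n)).
    by rewrite -mulr_suml ler_wpM2r ?exprn_ge0 ?(ltW A0)// ler_norm_sum.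
  apply: ler_sum => j _; rewrite !normrM normrX normfV [`|_%:R|]ger0_norm//.
  apply/eq_ler; ring.
rewrite exchange_big/=.
apply: (@le_trans _ _ (\sum_(j < N) exp_coeff (Lam * `|s|) j)); last first.
  rewrite -(series_ord (exp_coeff _)); apply: series_ge0_le_lim; last exact: is_cvg_series_exp_coeff.
  by move=> k; rewrite exp_coeff_ge0// mulr_ge0 ?symbol_norm_ge0.
apply: ler_sum => j _; rewrite -mulr_suml exp_coeffE exprMn -mulrA.
by rewrite ler_wpM2r ?conv_pow_norm// divr_ge0// exprn_ge0.
Qed.

End SymbolOperator.

(** * Integrals over compact intervals *)

Section Calculus.
Context {R : realType}.
Implicit Types (a b s t x : R).
Local Notation mu := (@lebesgue_measure R).

Lemma continuous_integrable_itv (f : R -> R) a b : continuous f ->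
  mu.-integrable `[a, b] (EFin \o f).
Proof.
move=> cf; apply: continuous_compact_integrable; first exact: segment_compact.
exact: continuous_subspaceT.
Qed.

Lemma integral_is_derive (F f : R -> R) a b : a <= b ->
  (forall x, is_derive x (1 : R) F (f x)) -> continuous f ->
  (\int[mu]_(x in `[a, b]) (f x)%:E = (F b - F a)%:E)%E.
Proof.
move=> ab dF cf.
have dF1 x : derivable F x 1 by case: (dF x).
have cF : continuous F.
  by move=> x; apply/differentiable_continuous/derivable1_diffP.
move: ab; rewrite le_eqVlt => /predU1P[->|ab].
  by rewrite set_itv1 integral_set1 subrr.
rewrite (@continuous_FTC2 _ f F a b ab); first by rewrite EFinB.
- exact: continuous_subspaceT.
- split => [x _| |]; first exact: dF1.
  + by apply: cvg_at_right_filter; exact: cF.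
  + by apply: cvg_at_left_filter; exact: cF.
- by move=> x _; rewrite derive1E; case: (dF x).
Qed.

Lemma Rintegral_is_derive (F f : R -> R) a b : a <= b ->
  (forall x, is_derive x (1 : R) F (f x)) -> continuous f ->
  (\int[mu]_(x in `[a, b]) f x = F b - F a)%R.
Proof. by move=> ab dF cf; rewrite /Rintegral (integral_is_derive _ _ _ _ ab dF cf). Qed.

Lemma is_derive_shift_arg (F : R -> R) x s l : is_derive (x - s) (1 : R) F l ->
  is_derive x (1 : R) (fun y => F (y - s)) l.
Proof.
move=> dF.
have dg : is_derive x (1 : R) (fun y => y - s) 1.
  by have := is_deriveB (is_derive_id x (1 : R)) (is_derive_cst s x (1 : R)); rewrite subr0.
have := @is_derive1_comp _ F (fun y => y - s) x _ _ dF dg.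
by rewrite mulr1.
Qed.

Lemma integral_rser {C r : R} {V : nat -> R} s t : 0 <= r -> geo_bounded C r V -> s <= t ->
  (\int[mu]_(v in `[s, t]) (rser (shiftn 1 V) (v - s))%:E = (rser V (t - s) - V 0%N)%:E)%E.
Proof.
move=> r0 bV st.
have dF x : is_derive x (1 : R) (fun v => rser V (v - s)) (rser (shiftn 1 V) (x - s)).
  by apply: is_derive_shift_arg; exact: is_derive_rser bV.
rewrite (integral_is_derive _ _ _ _ st dF); first by rewrite subrr rser0.
move=> x; apply: (@continuous_comp _ _ _ (fun v => v - s) (rser (shiftn 1 V))).
  by apply: cvgB; [exact: cvg_id|exact: cvg_cst].
exact: (continuous_rser r0 (geo_bounded_shift 1 bV)).
Qed.

Lemma Rintegral_le_const (f : R -> R) M a b : a <= b -> continuous f ->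
  (forall x, a <= x <= b -> `|f x| <= M) ->
  `|(\int[mu]_(x in `[a, b]) f x)%R| <= M * (b - a).
Proof.
move=> ab cf fM.
have if_ := continuous_integrable_itv f a b cf.
apply: le_trans (le_normr_Rintegral _ if_) _ => //.
have -> : M * (b - a) = (\int[mu]_(x in `[a, b]) (cst M) x)%R.
  rewrite Rintegral_cst//= lebesgue_measure_itv/= lte_fin.
  by move: ab; rewrite le_eqVlt => /predU1P[->|->]//=; rewrite ltxx subrr mulr0.
apply: le_Rintegral => //.
- exact: (@continuous_integrable_itv (fun x => `|f x|) a b (fun x => continuous_comp (cf x) (@norm_continuous _ R _))).
- by apply: (continuous_integrable_itv (cst M)) => x; exact: cvg_cst.
Qed.

End Calculus.

(** * Complex differentiability and Goursat's theorem *)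

Section ComplexNumbers.
Context {R : realType}.
Local Notation C := R[i].
Implicit Types (z w : C) (x y : R).

Lemma cReD z w : Re (z + w) = Re z + Re w. Proof. by case: z; case: w. Qed.
Lemma cImD z w : Im (z + w) = Im z + Im w. Proof. by case: z; case: w. Qed.
Lemma cReN z : Re (- z) = - Re z. Proof. by case: z. Qed.
Lemma cImN z : Im (- z) = - Im z. Proof. by case: z. Qed.
Lemma cReM z w : Re (z * w) = Re z * Re w - Im z * Im w.
Proof. by case: z; case: w. Qed.
Lemma cImM z w : Im (z * w) = Re z * Im w + Im z * Re w.
Proof. by case: z; case: w. Qed.
Lemma complexP z w : Re z = Re w -> Im z = Im w -> z = w.
Proof. by case: z => a b; case: w => c d /= -> ->. Qed.

Lemma normc_ge0 z : 0 <= normc z.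
Proof. by case: z => a b; exact: sqrtr_ge0. Qed.

Lemma normc_sqr z : normc z ^+ 2 = Re z ^+ 2 + Im z ^+ 2.
Proof. by case: z => a b /=; rewrite sqr_sqrtr// addr_ge0// sqr_ge0. Qed.

Lemma normcD z w : normc (z + w) <= normc z + normc w.
Proof. exact: le_normcD. Qed.

Lemma normcNr z : normc (- z) = normc z.
Proof. exact: normcN. Qed.

Lemma normcB z w : normc (z - w) <= normc z + normc w.
Proof. by rewrite -(normcNr w) normcD. Qed.

Lemma normc_sub_sym z w : normc (z - w) = normc (w - z).
Proof. by rewrite -opprB normcNr. Qed.

Lemma normcX z n : normc (z ^+ n) = normc z ^+ n.
Proof.
by elim: n => [|n IH]; rewrite ?expr0 ?Normc.normc1// !exprS Normc.normcM IH.
Qed.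

Lemma normc_Re z : `|Re z| <= normc z.
Proof.
by rewrite -ler_sqr ?nnegrE ?normc_ge0// normc_sqr real_normK ?num_real// lerDl sqr_ge0.
Qed.

Lemma normc_Im z : `|Im z| <= normc z.
Proof.
by rewrite -ler_sqr ?nnegrE ?normc_ge0// normc_sqr real_normK ?num_real// lerDr sqr_ge0.
Qed.

Lemma normc_ReIm z : normc z <= `|Re z| + `|Im z|.
Proof.
rewrite -ler_sqr ?nnegrE ?normc_ge0 ?addr_ge0// normc_sqr sqrrD !real_normK ?num_real//.
by rewrite -addrA lerD2l lerDr mulrn_wge0 ?mulr_ge0.
Qed.

Lemma ofRE x : ofR x = x%:C%C. Proof. by []. Qed.

Lemma normc_ofR x : normc (ofR x) = `|x|.
Proof. by rewrite /= expr0n addr0 sqrtr_sqr. Qed.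

Lemma normc_le0 z : normc z <= 0 -> z = 0.
Proof.
by move=> z0; apply: Normc.eq0_normc; apply/eqP; rewrite eq_le z0 normc_ge0.
Qed.

Lemma ofR_nat n : ofR (n%:R : R) = n%:R.
Proof. by rewrite ofRE rmorph_nat. Qed.

Lemma normc_natr n : normc (n%:R : C) = n%:R.
Proof.
by rewrite -ofR_nat normc_ofR ger0_norm.
Qed.

Lemma ofRD x y : ofR (x + y) = ofR x + ofR y.
Proof. by apply: complexP; rewrite ?cReD ?cImD//= addr0. Qed.
Lemma ofRM x y : ofR (x * y) = ofR x * ofR y.
Proof. by apply: complexP; rewrite ?cReM ?cImM/=; ring. Qed.
Lemma ofRX x n : ofR (x ^+ n) = ofR x ^+ n.
Proof. by rewrite !ofRE rmorphXn. Qed.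
Lemma cReMr z x : Re (z * ofR x) = Re z * x.
Proof. by rewrite cReM/= mulr0 subr0. Qed.
Lemma cImMr z x : Im (z * ofR x) = Im z * x.
Proof. by rewrite cImM/= mulr0 add0r. Qed.
Lemma cReMl z x : Re (ofR x * z) = x * Re z.
Proof. by rewrite mulrC cReMr mulrC. Qed.
Lemma cImMl z x : Im (ofR x * z) = x * Im z.
Proof. by rewrite mulrC cImMr mulrC. Qed.

Lemma normrc z : (`|z| : C) = ofR (normc z).
Proof. by rewrite normc_def; case: z. Qed.

Lemma ltcR x y : (ofR x < ofR y) = (x < y).
Proof. by rewrite !ofRE ltcR. Qed.
Lemma lecR x y : (ofR x <= ofR y) = (x <= y).
Proof. by rewrite !ofRE lecR. Qed.

Lemma gt0_ofR (e : C) : 0 < e -> exists2 d : R, 0 < d & e = ofR d.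
Proof.
case: e => a b; rewrite ltcE/= => /andP[/eqP -> a0]; by exists a.
Qed.

(** The norm of [C^o] is complex-valued, so its epsilons are complex; being positive they are real,
    by [gt0_ofR]. *)
Lemma cvgc_nbhsP (T : Type) (Fl : set_system T) (FF : Filter Fl) (f : T -> C) (l : C) :
  ((f : T -> C^o) x @[x --> Fl] --> (l : C^o)) <->
  (forall e : R, 0 < e -> \forall x \near Fl, normc (f x - l) <= e).
Proof.
split.
  move=> /cvgrPdist_le fl e e0.
  have := fl (ofR e); rewrite (ltcR 0) => /(_ e0); apply: filterS => x.
  by rewrite normrc lecR normc_sub_sym.
move=> fl; apply/cvgrPdist_le => e /gt0_ofR[d d0 ->].
by apply: filterS (fl d d0) => x; rewrite normrc lecR normc_sub_sym.
Qed.

Lemma limc_seq (f : nat -> C) (l : C) :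
  (forall e : R, 0 < e -> \forall n \near \oo, normc (f n - l) <= e) ->
  limn (f : nat -> C^o) = l.
Proof.
move=> fl; apply: cvg_lim; first exact: norm_hausdorff.
by apply/cvgc_nbhsP.
Qed.

Lemma limc_ReIm (f : nat -> C) (l : C) :
  (fun n => Re (f n)) @ \oo --> Re l -> (fun n => Im (f n)) @ \oo --> Im l ->
  limn (f : nat -> C^o) = l.
Proof.
move=> /cvgrPdist_le fR /cvgrPdist_le fI; apply: limc_seq => e e0.
have e2 : 0 < e / 2 by rewrite divr_gt0.
near=> n; apply: le_trans (normc_ReIm _) _.
rewrite cReD cReN cImD cImN [leRHS]splitr lerD//.
  by rewrite distrC; near: n; exact: fR.
by rewrite distrC; near: n; exact: fI.
Unshelve. all: by end_near. Qed.

(** Differentiability with derivative [l], with real epsilons and without quotient, so that [w = 0]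
    is no special case. The next two lemmas relate it to [derivable]. *)
Definition cdiff (f : C -> C) (z l : C) :=
  forall e : R, 0 < e -> exists2 d : R, 0 < d &
    forall w, normc w < d -> normc (f (z + w) - f z - l * w) <= e * normc w.

Lemma cdiff_derivable f z l : cdiff f z l -> derivable (f : C^o -> C^o) z 1.
Proof.
move=> fl; apply/cvg_ex; exists (l : C^o).
apply/cvgc_nbhsP => e e0.
have [d d0 H] := fl e e0.
near=> w.
have w0 : w != 0 by near: w; exact: nbhs_dnbhs_neq.
have wd : normc w < d.
  near: w; apply: nbhs_dnbhs; apply/nbhs_normP; exists (ofR d); rewrite /= ?(ltcR 0)//.
  by move=> w /=; rewrite sub0r normrN normrc ltcR.
have nw0 : 0 < normc w.
  by rewrite lt_neqAle normc_ge0 andbT eq_sym; apply: contra_neq w0 => /Normc.eq0_normc.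
rewrite -(ler_pM2r nw0) -Normc.normcM.
have := H w wd.
have -> // : f (z + w) - f z - l * w = (w^-1 *: (f (w *: (1 : C^o) + z) - f z) - l) * w.
rewrite mulrBl; congr (_ - _).
rewrite /GRing.scale/= mulr1 mulrAC mulVf// mul1r addrC //.
by rewrite [w + z]addrC [RHS]addrC.
Unshelve. all: by end_near. Qed.

Lemma derivable_cdiff f z : derivable (f : C^o -> C^o) z 1 -> exists l, cdiff f z l.
Proof.
move=> /cvg_ex[l /cvgc_nbhsP fl]; exists l => e e0.
have := fl e e0; rewrite /dnbhs /within /= => /nbhs_normP[d /gt0_ofR[r r0 ->]] H.
exists r => // w wr.
have [->|w0] := eqVneq w 0.
  by rewrite addr0 subrr mulr0 subr0 Normc.normc0 mulr0.
have nw0 : 0 < normc w.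
  by rewrite lt_neqAle normc_ge0 andbT eq_sym; apply: contra_neq w0 => /Normc.eq0_normc.
have := H w; rewrite /= sub0r normrN normrc ltcR => /(_ wr w0).
rewrite -(ler_pM2r nw0) -Normc.normcM.
have -> // : f (z + w) - f z - l * w = (w^-1 *: (f (w *: (1 : C^o) + z) - f z) - l) * w.
rewrite mulrBl; congr (_ - _).
rewrite /GRing.scale/= mulr1 mulrAC mulVf// mul1r addrC //.
by rewrite [w + z]addrC [RHS]addrC.
Qed.

End ComplexNumbers.

(** * The complex exponential and its Taylor remainders *)

Section ComplexExponential.
Context {R : realType}.
Local Notation C := R[i].
Implicit Types (z w : C) (x y t : R).

Definition is_cderive (f : R -> C) t (l : C) :=
  is_derive t (1 : R) (fun s => Re (f s)) (Re l) /\
  is_derive t (1 : R) (fun s => Im (f s)) (Im l).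

Lemma normc_cexp z : normc (cexp z) = expR (Re z).
Proof.
rewrite /cexp /= !exprMn -mulrDr cos2Dsin2 mulr1 sqrtr_sqr ger0_norm// expR_ge0.
Qed.

Lemma cexpD z w : cexp (z + w) = cexp z * cexp w.
Proof.
by apply: complexP; rewrite ?cReM ?cImM /cexp/= cReD cImD expRD ?cosD ?sinD; ring.
Qed.

Lemma cexp0 : cexp (0 : C) = 1.
Proof. by apply: complexP; rewrite /cexp/= expR0 ?cos0 ?sin0 ?mulr1 ?mulr0. Qed.

Lemma is_cderive_cexp z t : is_cderive (fun s => cexp (ofR s * z)) t (z * cexp (ofR t * z)).
Proof.
have dlin k : is_derive t (1 : R) (fun s : R => s * k) k.
  have := is_deriveM (is_derive_id t (1 : R)) (is_derive_cst k t (1 : R)).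
  by move=> H; apply: is_derive_eq => /=; rewrite /GRing.scale/= mulr0 add0r mulr1.
have dE := @is_derive1_comp _ expR (fun s => s * Re z) t _ _ (is_derive_expR _) (dlin (Re z)).
have dC := @is_derive1_comp _ cos (fun s => s * Im z) t _ _ (is_derive_cos _) (dlin (Im z)).
have dS := @is_derive1_comp _ sin (fun s => s * Im z) t _ _ (is_derive_sin _) (dlin (Im z)).
split.
- have := is_deriveM dE dC.
  have -> : (fun s => Re (cexp (ofR s * z))) =
      (expR \o (fun s => s * Re z)) * (cos \o (fun s => s * Im z)).
    by apply/funext => s; rewrite /cexp cReMl cImMl.
  move=> H; apply: is_derive_eq; rewrite cReM /cexp cReMl cImMl /GRing.scale/=.
  by ring.
- have := is_deriveM dE dS.
  have -> : (fun s => Im (cexp (ofR s * z))) =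
      (expR \o (fun s => s * Re z)) * (sin \o (fun s => s * Im z)).
    by apply/funext => s; rewrite /cexp cReMl cImMl.
  move=> H; apply: is_derive_eq; rewrite cImM /cexp cReMl cImMl /GRing.scale/=.
  by ring.
Qed.

Definition cexp_poly N z : C := \sum_(j < N) z ^+ j / j`!%:R.

Lemma is_cderive_cst (c : C) t : is_cderive (fun=> c) t 0.
Proof. by split; exact: is_derive_cst. Qed.

Lemma is_cderiveD f g t l m : is_cderive f t l -> is_cderive g t m ->
  is_cderive (fun s => f s + g s) t (l + m).
Proof.
move=> [f1 f2] [g1 g2]; split.
  have := is_deriveD f1 g1; rewrite cReD; congr (is_derive _ _ _ _).
  by apply/funext => s; rewrite cReD.
have := is_deriveD f2 g2; rewrite cImD; congr (is_derive _ _ _ _).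
by apply/funext => s; rewrite cImD.
Qed.

Lemma is_cderiveMl c f t l : is_cderive f t l -> is_cderive (fun s => c * f s) t (c * l).
Proof.
move=> [f1 f2]; split.
  have := is_deriveB (@is_deriveZ _ _ _ _ (Re c) _ _ _ f1) (@is_deriveZ _ _ _ _ (Im c) _ _ _ f2).
  rewrite cReM; congr (is_derive _ _ _ _).
  by apply/funext => s; rewrite cReM.
have := is_deriveD (@is_deriveZ _ _ _ _ (Re c) _ _ _ f2) (@is_deriveZ _ _ _ _ (Im c) _ _ _ f1).
rewrite cImM; congr (is_derive _ _ _ _).
by apply/funext => s; rewrite cImM.
Qed.

Lemma is_cderive_expn t n : is_cderive (fun s => ofR s ^+ n.+1) t (n.+1%:R * ofR t ^+ n).
Proof.
have E : is_derive t (1 : R) (fun s : R => s ^+ n.+1) (n.+1%:R * t ^+ n).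
  have := @is_deriveX _ _ (@id R) n.+1 t (1 : R) 1 (is_derive_id t (1 : R)).
  move=> H; rewrite (_ : (fun s => _) = (@id R) ^+ n.+1); last first.
    by apply/funext => s; rewrite exprfctE.
  by apply: is_derive_eq H _; rewrite /GRing.scale/= mulr1.
have -> : n.+1%:R * ofR t ^+ n = ofR (n.+1%:R * t ^+ n).
  by rewrite ofRM ofRX ofR_nat.
split => /=.
  by under eq_fun do rewrite -ofRX /=.
under eq_fun do rewrite -ofRX /=.
exact: is_derive_cst.
Qed.

Lemma is_cderive_cexp_poly N z t :
  is_cderive (fun s => cexp_poly N.+1 (ofR s * z)) t (z * cexp_poly N (ofR t * z)).
Proof.
elim: N => [|N IH].
  rewrite /cexp_poly big_ord0 mulr0.
  under eq_fun do rewrite big_ord1 expr0.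
  exact: is_cderive_cst.
have -> : (fun s => cexp_poly N.+2 (ofR s * z)) =
    (fun s => cexp_poly N.+1 (ofR s * z) + z ^+ N.+1 / N.+1`!%:R * ofR s ^+ N.+1).
  by apply/funext => s; rewrite /cexp_poly big_ord_recr/= exprMn; congr (_ + _); ring.
rewrite {2}/cexp_poly big_ord_recr/= mulrDr.
have -> : z * ((ofR t * z) ^+ N / N`!%:R) = z ^+ N.+1 / N.+1`!%:R * (N.+1%:R * ofR t ^+ N).
  rewrite factS natrM exprMn exprS; field.
  by rewrite nat1r !pnatr_eq0 -lt0n fact_gt0.
by apply: is_cderiveD => //; apply: is_cderiveMl; exact: is_cderive_expn.
Qed.

(** Real and imaginary parts are integrated separately, each contributing [M * t]; this is the
    origin of the factor 2 in the Taylor estimates below. *)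
Lemma is_cderive_bound (f f' : R -> C) M t : 0 <= t ->
  (forall s, is_cderive f s (f' s)) ->
  continuous (fun s => Re (f' s)) -> continuous (fun s => Im (f' s)) ->
  (forall s, 0 <= s <= t -> normc (f' s) <= M) -> f 0 = 0 ->
  normc (f t) <= 2 * M * t.
Proof.
move=> t0 df cR cI fM f0.
apply: le_trans (normc_ReIm _) _.
have -> : 2 * M * t = M * (t - 0) + M * (t - 0) by ring.
have ER := Rintegral_is_derive _ _ 0 t t0 (fun x => (df x).1) cR.
have EI := Rintegral_is_derive _ _ 0 t t0 (fun x => (df x).2) cI.
rewrite f0 subr0 in ER; rewrite f0 subr0 in EI.
rewrite -ER -EI; apply: lerD; apply: Rintegral_le_const => // s s0t.
  by apply: le_trans (fM s s0t); exact: normc_Re.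
by apply: le_trans (fM s s0t); exact: normc_Im.
Qed.

Lemma is_cderive_continuous (f f' : R -> C) :
  (forall s, is_cderive f s (f' s)) ->
  continuous (fun s => Re (f s)) /\ continuous (fun s => Im (f s)).
Proof.
move=> df; split => x; apply/differentiable_continuous/derivable1_diffP.
  by case: (df x) => [[]].
by case: (df x) => [_ []].
Qed.

(** Along the segment from 0 to [z], the derivative of the remainder of order [N.+1] is [z] times
    the remainder of order [N]; each integration contributes [2 |z|]. The length of the segment is
    bounded by 1, so the bound has no factorial. *)
Lemma cexp_taylor N z M :
  (forall t, 0 <= t <= 1 -> normc (cexp (ofR t * z)) <= M) ->
  normc (cexp z - cexp_poly N z) <= M * (2 * normc z) ^+ N.
Proof.
move=> zM.
suff H t : 0 <= t <= 1 ->
    normc (cexp (ofR t * z) - cexp_poly N (ofR t * z)) <= M * (2 * normc z) ^+ N.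
  by have := H 1; rewrite (_ : ofR 1 = 1)// mul1r; apply; rewrite ler01 lexx.
have M0 : 0 <= M.
  by apply: le_trans (zM 0 _); [exact: normc_ge0|rewrite lexx ler01].
elim: N t => [|N IH] t t01.
  by rewrite /cexp_poly big_ord0 subr0 expr0 mulr1; exact: zM.
pose f s := cexp (ofR s * z) + -1 * cexp_poly N.+1 (ofR s * z).
pose f' s := z * (cexp (ofR s * z) + -1 * cexp_poly N (ofR s * z)).
have df s : is_cderive f s (f' s).
  rewrite /f' mulrDr mulrCA; apply: is_cderiveD; first exact: is_cderive_cexp.
  by apply: is_cderiveMl; exact: is_cderive_cexp_poly.
(* A further derivative gives the continuity of [f'] that the integral bound requires. For [N = 0]
   the polynomial in [f'] is empty, hence the case distinction. *)
have [K dK] : exists K, forall s, is_cderive f' s (K s).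
  case: N {IH} @f @f' df => [|N] f f' df.
    eexists => s; apply: is_cderiveMl; apply: is_cderiveD; first exact: is_cderive_cexp.
    rewrite /cexp_poly; under eq_fun do rewrite big_ord0.
    exact: is_cderive_cst.
  eexists => s; apply: is_cderiveMl; apply: is_cderiveD; first exact: is_cderive_cexp.
  by apply: is_cderiveMl; exact: is_cderive_cexp_poly.
have [cR cI] := is_cderive_continuous _ _ dK.
case/andP: (t01) => t0 t1.
have := is_cderive_bound f f' (normc z * (M * (2 * normc z) ^+ N)) t t0 df cR cI.
have -> : cexp (ofR t * z) - cexp_poly N.+1 (ofR t * z) = f t by rewrite /f mulN1r.
move=> H; apply: le_trans (H _ _) _.
- move=> s /andP[s0 st]; rewrite /f' Normc.normcM ler_wpM2l ?normc_ge0// mulN1r.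
  by apply: IH; rewrite s0 (le_trans st).
- rewrite /f (_ : ofR 0 = 0)// mul0r cexp0 /cexp_poly big_ord_recl expr0 fact0 divr1 big1.
    by rewrite addr0 mulN1r subrr.
  by move=> i _; rewrite expr0n mul0r.
- rewrite exprS.
  have -> : 2 * (normc z * (M * (2 * normc z) ^+ N)) * t =
    (M * (2 * normc z * (2 * normc z) ^+ N)) * t by ring.
  rewrite ler_piMr// mulr_ge0// mulr_ge0 ?exprn_ge0 ?mulr_ge0 ?normc_ge0//.
Qed.

Lemma cexp_taylor_im N y :
  normc (cexp (Complex 0 y) - cexp_poly N (Complex 0 y)) <= (2 * `|y|) ^+ N.
Proof.
have ny : normc (Complex 0 y) = `|y| by rewrite /= expr0n add0r sqrtr_sqr.
have := @cexp_taylor N (Complex 0 y) 1; rewrite ny mul1r; apply => t _.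
by rewrite normc_cexp cReMl/= mulr0 expR0.
Qed.

Lemma cexp_taylor1 N z : normc z <= 1 ->
  normc (cexp z - cexp_poly N z) <= expR 1 * (2 * normc z) ^+ N.
Proof.
move=> z1; apply: cexp_taylor => t /andP[t0 t1].
rewrite normc_cexp cReMl ler_expR; apply: le_trans (ler_norm _) _.
rewrite normrM ger0_norm//; apply: le_trans z1.
by rewrite (le_trans _ (normc_Re z))// ler_piMl.
Qed.

Lemma cdiff_cexp z : cdiff cexp z (cexp z).
Proof.
move=> e e0; pose K := normc (cexp z) * (expR 1 * 4) + 1.
have K0 : 0 < K by rewrite ltr_wpDl// !mulr_ge0 ?normc_ge0 ?expR_ge0.
exists (Num.min 1 (e / K)); first by rewrite lt_min ltr01 divr_gt0.
move=> w; rewrite lt_min => /andP[w1 wK].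
have -> : cexp (z + w) - cexp z - cexp z * w = cexp z * (cexp w - cexp_poly 2 w).
  rewrite cexpD /cexp_poly !big_ord_recl big_ord0 /= expr0 expr1 !fact0 addr0 !divr1; ring.
rewrite Normc.normcM; apply: le_trans (ler_wpM2l (normc_ge0 _) (cexp_taylor1 2 _ (ltW w1))) _.
have -> : normc (cexp z) * (expR 1 * (2 * normc w) ^+ 2) =
  (normc (cexp z) * (expR 1 * 4) * normc w) * normc w by ring.
rewrite ler_wpM2r ?normc_ge0//.
apply: (@le_trans _ _ (K * normc w)); first by rewrite ler_wpM2r ?normc_ge0// lerDl.
by rewrite mulrC -ler_pdivlMr// ltW.
Qed.

End ComplexExponential.

(** * Integrals along the boundary of a rectangle *)

Section Goursat.
Context {R : realType}.
Local Notation C := R[i].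
Local Notation mu := (@lebesgue_measure R).
Implicit Types (z w : C) (x y a b c d : R).

Definition ccont (f : C -> C) := forall z (e : R), 0 < e ->
  exists2 d : R, 0 < d & forall w, normc w < d -> normc (f (z + w) - f z) <= e.

Definition lcont (f : R -> C) :=
  continuous (fun x => Re (f x)) /\ continuous (fun x => Im (f x)).

Lemma cdiff_cont f z l : cdiff f z l -> forall e : R, 0 < e ->
  exists2 d : R, 0 < d & forall w, normc w < d -> normc (f (z + w) - f z) <= e.
Proof.
move=> fl e e0; have [d d0 H] := fl 1 ltr01.
have K0 : 0 < 1 + normc l by rewrite ltr_pwDl// normc_ge0.
exists (Num.min d (e / (1 + normc l))); first by rewrite lt_min d0 divr_gt0.
move=> w; rewrite lt_min => /andP[wd we].
have -> : f (z + w) - f z = f (z + w) - f z - l * w + l * w by rewrite subrK.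
apply: le_trans (normcD _ _) _; apply: le_trans (lerD (H w wd) (lexx _)) _.
rewrite Normc.normcM -mulrDl mulrC -ler_pdivlMr//; exact: ltW.
Qed.

Lemma cdiff_ccont f : (forall z, exists l, cdiff f z l) -> ccont f.
Proof. by move=> df z; have [l fl] := df z; exact: cdiff_cont fl. Qed.

Lemma ccont_lcont f (p : R -> C) : ccont f ->
  (forall x y, normc (p y - p x) <= `|y - x|) -> lcont (fun x => f (p x)).
Proof.
move=> cf pl.
have H x (e : R) : 0 < e -> \forall y \near x, normc (f (p x) - f (p y)) <= e.
  move=> e0; have [d d0 fd] := cf (p x) e e0.
  near=> y; have -> : p y = p x + (p y - p x) by rewrite addrC subrK.
  rewrite normc_sub_sym; apply: fd; apply: le_lt_trans (pl _ _) _.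
  by rewrite distrC; near: y; apply/nbhs_normP; exists d.
split=> x; apply/cvgrPdist_le => e e0; apply: filterS (H x e e0) => y; apply: le_trans.
  by rewrite -cReN -cReD normc_Re.
by rewrite -cImN -cImD normc_Im.
Unshelve. all: by end_near. Qed.

Lemma ccont_horizontal f y : ccont f -> lcont (fun x => f (Complex x y)).
Proof.
move=> cf; apply: (ccont_lcont f (fun x => Complex x y)) => // x x'.
by rewrite /= subrr expr0n addr0 sqrtr_sqr.
Qed.

Lemma ccont_vertical f x : ccont f -> lcont (fun y => f (Complex x y)).
Proof.
move=> cf; apply: (ccont_lcont f (fun y => Complex x y)) => // y y'.
by rewrite /= subrr expr0n add0r sqrtr_sqr.
Qed.

Lemma lcont_cst (k : C) : lcont (fun=> k).
Proof. by split => x; exact: cvg_cst. Qed.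

Lemma lcont_lin (k : C) f g : lcont f -> lcont g -> lcont (fun x => k * f x + g x).
Proof.
move=> [f1 f2] [g1 g2]; split => x.
  rewrite /continuous_at cReD cReM; under eq_fun do rewrite cReD cReM.
  apply: cvgD; last exact: g1.
  by apply: cvgB; apply: cvgMr; [exact: f1|exact: f2].
rewrite /continuous_at cImD cImM; under eq_fun do rewrite cImD cImM.
apply: cvgD; last exact: g2.
by apply: cvgD; apply: cvgMr; [exact: f2|exact: f1].
Qed.

Lemma Rintegral_lin (k : R) (f g : R -> R) a b : continuous f -> continuous g ->
  (\int[mu]_(x in `[a, b]) (k * f x + g x) =
   k * \int[mu]_(x in `[a, b]) f x + \int[mu]_(x in `[a, b]) g x)%R.
Proof.
move=> cf cg; have intf := continuous_integrable_itv f a b cf.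
have ckf : continuous (fun x => k * f x) by move=> x; apply: cvgMr; exact: cf.
rewrite RintegralD//; [|exact: (continuous_integrable_itv (fun x => k * f x))|exact: continuous_integrable_itv].
by rewrite RintegralZl.
Qed.

Lemma Rintegral_split (f : R -> R) a m b : a <= m -> m <= b -> continuous f ->
  (\int[mu]_(x in `[a, b]) f x =
   \int[mu]_(x in `[a, m]) f x + \int[mu]_(x in `[m, b]) f x)%R.
Proof.
move=> am mb cf; have intf := continuous_integrable_itv f a b cf.
have E := Rintegral_itvB intf (x := m).
rewrite -(@Rintegral_itv_obnd_cbnd _ m (BRight b)).
  by rewrite -E ?bnd_simp//; rewrite addrC subrK.
apply: integrableS (continuous_integrable_itv f m b cf) => //.
by apply: subset_itvr; rewrite bnd_simp.
Qed.

Definition cint a b (f : R -> C) : C := cintegral mu `[a, b] f.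

Lemma cint_lin (k : C) f g a b : lcont f -> lcont g ->
  cint a b (fun x => k * f x + g x) = k * cint a b f + cint a b g.
Proof.
move=> [f1 f2] [g1 g2].
have cl (r : R) (u v : R -> R) : continuous u -> continuous v ->
    continuous (fun x => r * u x + v x).
  by move=> cu cv x; apply: cvgD; [apply: cvgMr; exact: cu|exact: cv].
apply: complexP; rewrite ?cReD ?cImD ?cReM ?cImM /=.
  under eq_Rintegral do rewrite cReD cReM -addrA -mulNr.
  by rewrite Rintegral_lin//; [rewrite Rintegral_lin//; ring|exact: cl].
under eq_Rintegral do rewrite cImD cImM -addrA.
by rewrite Rintegral_lin//; [rewrite Rintegral_lin//; ring|exact: cl].
Qed.

Lemma cint_cst (k : C) a b : a <= b -> cint a b (fun=> k) = k * ofR (b - a).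
Proof.
move=> ab; have E : fine (mu `[a, b]) = b - a.
  rewrite /= lebesgue_measure_itv/= lte_fin.
  by move: ab; rewrite le_eqVlt => /predU1P[->|->]//=; rewrite ltxx subrr.
by apply: complexP; rewrite ?cReMr ?cImMr /= Rintegral_cst// E.
Qed.

Lemma cint_le f M a b : a <= b -> lcont f ->
  (forall x, a <= x <= b -> normc (f x) <= M) -> normc (cint a b f) <= 2 * M * (b - a).
Proof.
move=> ab [f1 f2] fM; apply: le_trans (normc_ReIm _) _.
have -> : 2 * M * (b - a) = M * (b - a) + M * (b - a) by ring.
apply: lerD; apply: Rintegral_le_const => // x xab; apply: le_trans (fM x xab).
  exact: normc_Re.
exact: normc_Im.
Qed.

Lemma cint_split f a m b : a <= m -> m <= b -> lcont f ->
  cint a b f = cint a m f + cint m b f.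
Proof.
by move=> am mb [f1 f2]; apply: complexP; rewrite ?cReD ?cImD /=; exact: Rintegral_split.
Qed.

Lemma eq_cint f g a b : (forall x, a <= x <= b -> f x = g x) -> cint a b f = cint a b g.
Proof.
move=> fg; apply: complexP => /=; apply: eq_Rintegral => x;
  by rewrite inE/= in_itv/= => xab; rewrite fg.
Qed.

(** The contour integral, counterclockwise, around the rectangle with horizontal extent [a, b] and
    vertical extent [c, d]. *)
Definition boundary_integral f a b c d : C :=
  cint a b (fun x => f (Complex x c)) - cint a b (fun x => f (Complex x d)) +
  'i%C * (cint c d (fun y => f (Complex b y)) - cint c d (fun y => f (Complex a y))).
Local Notation B := boundary_integral.

Lemma boundary_split_re f a m b c d : ccont f -> a <= m -> m <= b ->
  B f a b c d = B f a m c d + B f m b c d.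
Proof.
move=> cf am mb; rewrite /B.
rewrite !(cint_split _ a m b am mb); [|exact: ccont_horizontal..].
ring.
Qed.

Lemma boundary_split_im f a b c m d : ccont f -> c <= m -> m <= d ->
  B f a b c d = B f a b c m + B f a b m d.
Proof.
move=> cf cm md; rewrite /B.
rewrite !(cint_split _ c m d cm md); [|exact: ccont_vertical..].
ring.
Qed.

(** The factor 4 is the 2 of [cint_le] times the two sides in each direction. *)
Lemma boundary_le f M a b c d : ccont f -> a <= b -> c <= d ->
  (forall x y, a <= x <= b -> c <= y <= d -> normc (f (Complex x y)) <= M) ->
  normc (B f a b c d) <= 4 * M * (b - a + (d - c)).
Proof.
move=> cf ab cd fM.
have ni : normc ('i%C : C) = 1 by rewrite /= expr0n add0r expr1n sqrtr1.
rewrite /B; apply: le_trans (normcD _ _) _.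
rewrite Normc.normcM ni mul1r.
have H1 y : c <= y <= d -> normc (cint a b (fun x => f (Complex x y))) <= 2 * M * (b - a).
  by move=> ycd; apply: cint_le => //; [exact: ccont_horizontal|move=> x xab; exact: fM].
have H2 x : a <= x <= b -> normc (cint c d (fun y => f (Complex x y))) <= 2 * M * (d - c).
  by move=> xab; apply: cint_le => //; [exact: ccont_vertical|move=> y ycd; exact: fM].
have := H1 c; have := H1 d; have := H2 a; have := H2 b.
rewrite !lexx ab cd => /(_ isT) h1 /(_ isT) h2 /(_ isT) h3 /(_ isT) h4.
apply: le_trans (lerD (normcB _ _) (normcB _ _)) _; lra.
Qed.

Lemma ccont_affine (k l : C) : ccont (fun z => k * z + l).
Proof.
apply: cdiff_ccont => z; exists k => e e0; exists 1 => // w _.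
have -> : k * (z + w) + l - (k * z + l) - k * w = 0 by ring.
by rewrite Normc.normc0 mulr_ge0 ?normc_ge0// ltW.
Qed.

(** On opposite sides the integrands differ by a constant; the horizontal and the vertical pair
    contribute [k i (b - a) (d - c)] with opposite signs. *)
Lemma boundary_affine (k l : C) a b c d : a <= b -> c <= d ->
  B (fun z => k * z + l) a b c d = 0.
Proof.
move=> ab cd; have cA := ccont_affine k l.
have Dh : cint a b (fun x => k * Complex x d + l) =
    1 * cint a b (fun x => k * Complex x c + l) + cint a b (fun=> k * 'i%C * ofR (d - c)).
  rewrite -cint_lin; [|exact: (ccont_horizontal (fun z => k * z + l))|exact: lcont_cst].
  apply: eq_cint => x _.
  have -> : Complex x d = Complex x c + 'i%C * ofR (d - c).
    by apply: complexP; rewrite ?cReD ?cImD ?cReM ?cImM/=; ring.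
  by ring.
have Dv : cint c d (fun y => k * Complex b y + l) =
    1 * cint c d (fun y => k * Complex a y + l) + cint c d (fun=> k * ofR (b - a)).
  rewrite -cint_lin; [|exact: (ccont_vertical (fun z => k * z + l))|exact: lcont_cst].
  apply: eq_cint => y _.
  have -> : Complex b y = Complex a y + ofR (b - a).
    by apply: complexP; rewrite ?cReD ?cImD/=; ring.
  by ring.
by rewrite /B Dh Dv !cint_cst//; ring.
Qed.

Lemma ccont_lin (k : C) f g : ccont f -> ccont g -> ccont (fun z => k * f z + g z).
Proof.
move=> cf cg z e e0.
have K0 : 0 < normc k + 1 by rewrite ltr_wpDl// normc_ge0.
have ek : 0 < e / (normc k + 1) by rewrite divr_gt0.
have [d1 d10 H1] := cf z _ ek; have [d2 d20 H2] := cg z _ ek.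
exists (Num.min d1 d2); first by rewrite lt_min d10.
move=> w; rewrite lt_min => /andP[w1 w2].
have -> : k * f (z + w) + g (z + w) - (k * f z + g z) =
  k * (f (z + w) - f z) + (g (z + w) - g z) by ring.
apply: le_trans (normcD _ _) _; rewrite Normc.normcM.
apply: le_trans (lerD (ler_wpM2l (normc_ge0 k) (H1 w w1)) (H2 w w2)) _.
rewrite -{2}[e / _]mul1r -mulrDl mulrC divfK// gt_eqF//.
Qed.

Lemma boundary_lin (k : C) f g a b c d : ccont f -> ccont g ->
  B (fun z => k * f z + g z) a b c d = k * B f a b c d + B g a b c d.
Proof.
move=> cf cg; rewrite /B.
rewrite !(cint_lin k (fun x => f (Complex x _)) (fun x => g (Complex x _)));
  try exact: ccont_horizontal.
rewrite !(cint_lin k (fun x => f (Complex _ x)) (fun x => g (Complex _ x)));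
  try exact: ccont_vertical.
ring.
Qed.

End Goursat.

(** * Goursat's theorem by quadrisection *)

Section GoursatTheorem.
Context {R : realType}.
Local Notation C := R[i].
Implicit Types (z w : C) (x y a b c d : R).
Local Notation B := boundary_integral.

Lemma boundary_quarter f x y l h : ccont f -> 0 <= l -> 0 <= h ->
  exists q : R * R, [/\ x <= q.1 <= x + l, y <= q.2 <= y + h &
    normc (B f x (x + (l + l)) y (y + (h + h))) <=
    4 * normc (B f q.1 (q.1 + l) q.2 (q.2 + h))].
Proof.
move=> cf l0 h0; rewrite !addrA.
rewrite (@boundary_split_re _ f x (x + l)) ?lerDl//.
rewrite !(@boundary_split_im _ f _ _ y (y + h) (y + h + h)) ?lerDl//.
set b1 := B f x _ y _; set b2 := B f x _ (y + h) _.
set b3 := B f (x + l) _ y _; set b4 := B f (x + l) _ (y + h) _.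
have sum4 : normc (b1 + b2 + (b3 + b4)) <= normc b1 + normc b2 + (normc b3 + normc b4).
  by apply: le_trans (normcD _ _) _; apply: lerD; exact: normcD.
set N := normc (b1 + b2 + (b3 + b4)) in sum4 *.
have [h1|h1] := leP N (4 * normc b1).
  by exists (x, y); split; rewrite /= ?lexx ?lerDl ?l0 ?h0.
have [h2|h2] := leP N (4 * normc b2).
  by exists (x, y + h); split; rewrite /= ?lexx ?lerDl ?l0 ?h0.
have [h3|h3] := leP N (4 * normc b3).
  by exists (x + l, y); split; rewrite /= ?lexx ?lerDl ?l0 ?h0.
exists (x + l, y + h); split; [by rewrite /= lexx lerDl l0|by rewrite /= lexx lerDl h0|].
by change (N <= 4 * normc b4); lra.
Qed.

Lemma small_mul_le0 {K x : R} : 0 <= K -> (forall e, 0 < e -> x <= e * K) -> x <= 0.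
Proof.
move=> K0 H; apply/ler_addgt0Pr => e e0; rewrite add0r.
have K1 : 0 < K + 1 by rewrite ltr_wpDl.
apply: le_trans (H (e / (K + 1)) _) _; first by rewrite divr_gt0.
by rewrite mulrAC ler_pdivrMr// ler_wpM2l ?(ltW e0)// lerDl.
Qed.

Lemma itv_dist (p l u v : R) : p <= u <= p + l -> p <= v <= p + l ->
  `|u - v| <= p + l - p.
Proof.
by move=> /andP[a1 a2] /andP[b1 b2]; rewrite ler_norml; apply/andP; split; lra.
Qed.

Theorem goursat f a b c d : ccont f -> a <= b -> c <= d ->
  (forall x y, a <= x <= b -> c <= y <= d -> exists l, cdiff f (Complex x y) l) ->
  B f a b c d = 0.
Proof.
move=> cf ab cd df; set L := b - a; set H := d - c.
have L0 : 0 <= L by rewrite subr_ge0.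
have H0 : 0 <= H by rewrite subr_ge0.
have p2 n : 0 < (2 : R) ^- n by rewrite invr_gt0 exprn_gt0.
have half n : (2 : R) ^- n = 2 ^- n.+1 + 2 ^- n.+1.
  by rewrite exprS invfM; have := p2 n; set t := _ ^- _; lra.
have Ln n : 0 <= L * 2 ^- n by rewrite mulr_ge0// ltW.
have Hn n : 0 <= H * 2 ^- n by rewrite mulr_ge0// ltW.
have quarter n (p : R * R) : exists q : R * R, [/\ p.1 <= q.1 <= p.1 + L * 2 ^- n.+1,
    p.2 <= q.2 <= p.2 + H * 2 ^- n.+1 &
    normc (B f p.1 (p.1 + L * 2 ^- n) p.2 (p.2 + H * 2 ^- n)) <=
    4 * normc (B f q.1 (q.1 + L * 2 ^- n.+1) q.2 (q.2 + H * 2 ^- n.+1))].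
  by have := boundary_quarter f p.1 p.2 _ _ cf (Ln n.+1) (Hn n.+1); rewrite -!mulrDr -half.
(* The lower left corners of nested rectangles, each a quarter that carries at least a fourth of the
   integral before it. *)
pose P := fix P n := if n is m.+1 then sval (cid (quarter m (P m))) else (a, c).
have PS n : [/\ (P n).1 <= (P n.+1).1 <= (P n).1 + L * 2 ^- n.+1,
    (P n).2 <= (P n.+1).2 <= (P n).2 + H * 2 ^- n.+1 &
    normc (B f (P n).1 ((P n).1 + L * 2 ^- n) (P n).2 ((P n).2 + H * 2 ^- n)) <=
    4 * normc (B f (P n.+1).1 ((P n.+1).1 + L * 2 ^- n.+1)
                   (P n.+1).2 ((P n.+1).2 + H * 2 ^- n.+1))].
  by rewrite /= ; case: cid.
have P0 : P 0%N = (a, c) by [].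
clearbody P.
have decay n : normc (B f a b c d) <=
    4 ^+ n * normc (B f (P n).1 ((P n).1 + L * 2 ^- n) (P n).2 ((P n).2 + H * 2 ^- n)).
  elim: n => [|n IH].
    by rewrite P0/= !expr0 invr1 !mulr1 mul1r /L /H [a + _]addrC [c + _]addrC !subrK.
  apply: le_trans IH _; rewrite exprSr -mulrA ler_wpM2l ?exprn_ge0//.
  by case: (PS n).
have shrink1 n m : (n <= m)%N ->
    (P n).1 <= (P m).1 /\ (P m).1 + L * 2 ^- m <= (P n).1 + L * 2 ^- n.
  elim: m => [|m IH]; first by rewrite leqn0 => /eqP ->.
  rewrite leq_eqVlt => /predU1P[->//|]; rewrite ltnS => /IH[h1 h2].
  have [/andP[g1 g2] _ _] := PS m; have E : L * 2 ^- m = L * 2 ^- m.+1 + L * 2 ^- m.+1 by rewrite -mulrDr -half.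
  rewrite E in h2; move: h2.
  by move: (L * 2 ^- m.+1) g1 g2 => u g1 g2 h2; split; lra.
have shrink2 n m : (n <= m)%N ->
    (P n).2 <= (P m).2 /\ (P m).2 + H * 2 ^- m <= (P n).2 + H * 2 ^- n.
  elim: m => [|m IH]; first by rewrite leqn0 => /eqP ->.
  rewrite leq_eqVlt => /predU1P[->//|]; rewrite ltnS => /IH[h1 h2].
  have [_ /andP[g1 g2] _] := PS m; have E : H * 2 ^- m = H * 2 ^- m.+1 + H * 2 ^- m.+1 by rewrite -mulrDr -half.
  rewrite E in h2; move: h2.
  by move: (H * 2 ^- m.+1) g1 g2 => u g1 g2 h2; split; lra.
(* Lower ends increase and upper ends decrease, so the limit of the lower ends lies in every
   interval; stated once for both coordinates. *)
have lim_in (s : nat -> R) (M : R) : 0 <= M ->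
    (forall n m, (n <= m)%N -> s n <= s m /\ s m + M * 2 ^- m <= s n + M * 2 ^- n) ->
    exists x, forall n, s n <= x <= s n + M * 2 ^- n.
  move=> M0 sm; exists (limn s).
  have nd : {homo s : n m / (n <= m)%N >-> n <= m} by move=> n m /sm[].
  have ub n m : s m <= s n + M * 2 ^- n.
    have Mn k : 0 <= M * 2 ^- k by rewrite mulr_ge0// ltW.
    have [/sm[h _]|/ltnW/sm[_ h]] := leqP m n; first by rewrite (le_trans h)// lerDl.
    by rewrite (le_trans _ h)// lerDl.
  have cs : cvgn s.
    by apply: nondecreasing_is_cvgn => //; exists (s 0%N + M * 2 ^- 0) => _ [m _ <-].
  move=> n; rewrite nondecreasing_cvgn_le//=.
  by apply: limr_le => //; near=> m; exact: ub.
have [x xP] := lim_in (fun n => (P n).1) L L0 shrink1.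
have [y yP] := lim_in (fun n => (P n).2) H H0 shrink2.
have xab : a <= x <= b.
  by have := xP 0%N; rewrite P0/= expr0 invr1 mulr1 /L [a + _]addrC subrK.
have ycd : c <= y <= d.
  by have := yP 0%N; rewrite P0/= expr0 invr1 mulr1 /H [c + _]addrC subrK.
have [l dfl] := df x y xab ycd.
set z0 := Complex x y in dfl.
have key (e : R) : 0 < e -> normc (B f a b c d) <= 4 * e * (L + H) ^+ 2.
  move=> e0; have [r r0 fr] := dfl e e0.
  have [n nr] : exists n, (L + H) * 2 ^- n < r.
    have LH1 : 0 < L + H + 1 by rewrite ltr_wpDl// addr_ge0.
    have : (fun n => (2 : R) ^- n) @ \oo --> 0.
      by under eq_fun do rewrite -exprVn; apply: cvg_expr; rewrite ger0_norm; lra.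
    move=> /cvgrPdist_lt /(_ (r / (L + H + 1))); rewrite divr_gt0// => /(_ isT).
    move=> [n _ /(_ n (leqnn n))/=]; rewrite sub0r normrN ger0_norm ?(ltW (p2 n))//.
    rewrite ltr_pdivlMr// => h; exists n; apply: le_lt_trans h.
    rewrite mulrC ler_wpM2l ?(ltW (p2 n))//; lra.
  apply: le_trans (decay n) _.
  set t := (2 : R) ^- n in nr xP yP *.
  have t0 : 0 < t by exact: p2.
  (* Subtracting the affine approximation at [z0] leaves the boundary integral unchanged. On the
     [n]-th rectangle what remains is at most [e (L + H) t], and its two factors [t = 2 ^- n] cancel
     against [4 ^ n]. *)
  pose g z := -1 * (l * z + (f z0 - l * z0)) + f z.
  have cg : ccont g by apply: ccont_lin => //; exact: ccont_affine.
  have Ef : B f (P n).1 ((P n).1 + L * t) (P n).2 ((P n).2 + H * t) =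
      B g (P n).1 ((P n).1 + L * t) (P n).2 ((P n).2 + H * t).
    rewrite /g boundary_lin//; last exact: ccont_affine.
    rewrite boundary_affine ?lerDl ?mulr_ge0 ?(ltW t0)//.
    by rewrite mulr0 add0r.
  have bg : normc (B g (P n).1 ((P n).1 + L * t) (P n).2 ((P n).2 + H * t)) <=
      4 * (e * ((L + H) * t)) * ((L + H) * t).
    have -> : (L + H) * t = ((P n).1 + L * t - (P n).1 + ((P n).2 + H * t - (P n).2)) by ring.
    apply: boundary_le; rewrite ?lerDl ?mulr_ge0 ?(ltW t0)// => u v uP vP.
    have -> : g (Complex u v) = f (z0 + (Complex u v - z0)) - f z0 - l * (Complex u v - z0).
      by rewrite [z0 + _]addrC subrK /g; ring.
    have nuv : normc (Complex u v - z0) <= (P n).1 + L * t - (P n).1 + ((P n).2 + H * t - (P n).2).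
      apply: le_trans (normc_ReIm _) _; apply: lerD.
        exact: (itv_dist _ _ _ _ uP (xP n)).
      exact: (itv_dist _ _ _ _ vP (yP n)).
    apply: le_trans (fr _ _) _; last by rewrite ler_wpM2l// ltW.
    by apply: le_lt_trans nuv _; apply: le_lt_trans nr; apply/eq_ler; ring.
  rewrite Ef; apply: le_trans (ler_wpM2l _ bg) _; first by rewrite exprn_ge0.
  have t2 : (4 : R) ^+ n * (t * t) = 1.
    have -> : (4 : R) = 2 * 2 by ring.
    by rewrite exprMn /t mulrACA divff ?expf_neq0// mulr1.
  have -> : 4 ^+ n * (4 * (e * ((L + H) * t)) * ((L + H) * t)) =
     (4 * e * (L + H) ^+ 2) * (4 ^+ n * (t * t)) by ring.
  by rewrite t2 mulr1.
apply: normc_le0; apply: (small_mul_le0 (K := 4 * (L + H) ^+ 2)).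
  by rewrite mulr_ge0// sqr_ge0.
by move=> e e0; apply: le_trans (key e e0) _; apply/eq_ler; ring.
Unshelve. all: by end_near. Qed.

End GoursatTheorem.

(** * Rules of differentiation, and Goursat's theorem with an exceptional point *)

Section ComplexDifferentiability.
Context {R : realType}.
Local Notation C := R[i].
Implicit Types (z w : C) (x y a b c d : R).
Local Notation B := boundary_integral.

Definition cdable (f : C -> C) z := exists l, cdiff f z l.

Lemma cdableP f z : cdable f z <-> differentiable (f : C^o -> C^o) (z : C^o).
Proof.
rewrite -derivable1_diffP; split; last exact: derivable_cdiff.
by move=> [l]; exact: cdiff_derivable.
Qed.

Lemma caddKC z w : z + (w - z) = w.
Proof. by rewrite addrC subrK. Qed.

Lemma ccontP f : ccont f <-> continuous (f : C^o -> C^o).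
Proof.
split=> cf z.
  apply/(@cvgc_nbhsP R C (nbhs (z : C^o)) _ f (f z)) => e e0; have [d d0 H] := cf z e e0.
  apply: (iffRL (@nbhs_normP C (C^o : normedModType C) z (fun w => normc (f w - f z) <= e))).
  exists (ofR d); rewrite /= ?(ltcR 0)// => w /=.
  rewrite normrc ltcR [normc (z - w)]normc_sub_sym => /H.
  by have -> : (z : C) + ((w : C) - (z : C)) = w by exact: caddKC.
move=> e e0; have /(@cvgc_nbhsP R C (nbhs (z : C^o)) _ f (f z))/(_ e e0)/nbhs_normP[d /gt0_ofR[r r0 ->] H] := cf z.
exists r => // w wr; apply: H => /=.
by rewrite opprD addrA subrr sub0r normrN normrc ltcR.
Qed.

Lemma cdable_comp f g z : cdable f z -> cdable g (f z) -> cdable (fun w => g (f w)) z.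
Proof. by move=> /cdableP df /cdableP dg; apply/cdableP; exact: (differentiable_comp df dg). Qed.

Lemma cdableM f g z : cdable f z -> cdable g z -> cdable (fun w => f w * g w) z.
Proof. by move=> /cdableP df /cdableP dg; apply/cdableP; exact: differentiableM. Qed.

Lemma cdableD f g z : cdable f z -> cdable g z -> cdable (fun w => f w + g w) z.
Proof. by move=> /cdableP df /cdableP dg; apply/cdableP; exact: differentiableD. Qed.

Lemma cdableN f z : cdable f z -> cdable (fun w => - f w) z.
Proof. by move=> /cdableP df; apply/cdableP; exact: differentiableN. Qed.

Lemma cdable_cst (k : C) z : cdable (fun=> k) z.
Proof. by apply/cdableP; exact: differentiable_cst. Qed.

Lemma cdable_id z : cdable id z.
Proof. exists 1 => e e0; exists 1 => // w _ /=; have -> : z + w - z - 1 * w = 0 by ring.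
by rewrite Normc.normc0 mulr_ge0 ?normc_ge0// ltW. Qed.

Lemma cdableX f n z : cdable f z -> cdable (fun w => f w ^+ n) z.
Proof.
move=> df; elim: n => [|n IH]; first exact: cdable_cst.
under eq_fun do rewrite exprS; exact: cdableM.
Qed.

Lemma normc_gt0 z : (0 < normc z) = (z != 0).
Proof.
rewrite lt_neqAle normc_ge0 andbT eq_sym; apply/idP/idP; apply: contra_neq.
  by move=> ->; exact: Normc.normc0.
exact: Normc.eq0_normc.
Qed.

Lemma cdable_inv z : z != 0 -> cdable (fun w => w^-1) z.
Proof.
move=> z0; have nz : 0 < normc z by rewrite normc_gt0.
have nz3 : 0 < normc z ^+ 3 / 2 by rewrite divr_gt0// exprn_gt0.
exists (- z ^- 2) => e e0; exists (Num.min (normc z / 2) (e * (normc z ^+ 3 / 2))).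
  by rewrite lt_min divr_gt0//= mulr_gt0.
move=> w; rewrite lt_min => /andP[w1 w2].
have nzw : normc z / 2 <= normc (z + w).
  have := normcB (z + w) w; rewrite addrK; lra.
have zw0 : z + w != 0 by rewrite -normc_gt0 (lt_le_trans _ nzw)// divr_gt0.
have -> : (z + w)^-1 - z^-1 - - z ^- 2 * w = w * w / (z ^+ 2 * (z + w)).
  by field; rewrite z0 zw0.
rewrite !Normc.normcM mulrAC ler_wpM2r ?normc_ge0// Normc.normcV Normc.normcM normcX.
rewrite ler_pdivrMr ?mulr_gt0 ?exprn_gt0 ?(lt_le_trans _ nzw) ?divr_gt0//.
apply: le_trans (ltW w2) _; rewrite ler_wpM2l ?(ltW e0)//.
have -> : normc z ^+ 3 / 2 = normc z ^+ 2 * (normc z / 2) by ring.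
by rewrite ler_wpM2l// exprn_ge0// ltW.
Qed.

Lemma cdableV f z : f z != 0 -> cdable f z -> cdable (fun w => (f w)^-1) z.
Proof.
move=> fz0 df; apply: (cdable_comp f (fun w => w^-1)) => //.
exact: cdable_inv.
Qed.

Lemma cdable_local f g z (r : R) : 0 < r -> (forall w, normc w < r -> f (z + w) = g (z + w)) ->
  cdable g z -> cdable f z.
Proof.
move=> r0 fg [l gl]; exists l => e e0; have [d d0 H] := gl e e0.
exists (Num.min r d); first by rewrite lt_min r0.
move=> w; rewrite lt_min => /andP[wr wd].
have := fg 0; rewrite Normc.normc0 addr0 => /(_ r0) ->.
by rewrite fg//; exact: H.
Qed.

Lemma cdable_cexp z : cdable cexp z.
Proof. by exists (cexp z); exact: cdiff_cexp. Qed.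


Definition difference_quotient (h : C -> C) z0 l z :=
  if z == z0 then l else (h z - h z0) / (z - z0).

Lemma cdable_difference_quotient h z0 l z : (forall w, cdable h w) -> z != z0 ->
  cdable (difference_quotient h z0 l) z.
Proof.
move=> dh zz0.
have r0 : 0 < normc (z - z0) by rewrite normc_gt0 subr_eq0.
apply: (cdable_local _ (fun z => (h z - h z0) / (z - z0)) z _ r0).
  move=> w wr; rewrite /difference_quotient; case: eqP => // E; move: wr.
  have -> : z - z0 = - w by rewrite -E opprD addrA subrr sub0r.
  by rewrite normcNr ltxx.
apply: cdableM; first by apply: cdableD => //; exact: cdable_cst.
apply: (cdableV (fun z => z - z0)); first by rewrite subr_eq0.
by apply: cdableD; [exact: cdable_id|exact: cdable_cst].
Qed.

Lemma ccont_difference_quotient h z0 l : (forall w, cdable h w) -> cdiff h z0 l ->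
  ccont (difference_quotient h z0 l).
Proof.
move=> dh hl z e e0; have [->|zz0] := eqVneq z z0; last first.
  have [m dm] := cdable_difference_quotient h z0 l z dh zz0; exact: (cdiff_cont _ _ _ dm e e0).
have [d d0 H] := hl e e0; exists d => // w wd.
rewrite /difference_quotient eqxx -subr_eq0 [z0 + w]addrC addrK.
have [w0|w0] := eqVneq w 0; first by rewrite subrr Normc.normc0 ltW.
rewrite -(ler_pM2r (_ : 0 < normc w)) ?normc_gt0// -Normc.normcM mulrBl divfK//.
by have := H w wd; rewrite [z0 + w]addrC.
Qed.

(** The rectangle is cut into a square of half-side [s] around the exceptional point and four
    rectangles avoiding it, to which [goursat] applies. Continuity bounds [f] by [M] on the square,
    whose contribution is then at most [16 M s]. *)
Lemma goursat_exceptional f a b c d px py : ccont f -> a < px < b -> c < py < d ->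
  (forall x y, a <= x <= b -> c <= y <= d -> Complex x y != Complex px py ->
     cdable f (Complex x y)) ->
  B f a b c d = 0.
Proof.
move=> cf /andP[ap pb] /andP[cp pd] df.
set p := Complex px py in df *; set M := normc (f p) + 1.
have M0 : 0 <= M by rewrite addr_ge0 ?normc_ge0.
have [r r0 fr] := cf p 1 ltr01.
apply: normc_le0; apply: (small_mul_le0 (K := 16 * M)); first by rewrite mulr_ge0.
move=> e e0.
have [s [s0 se sr [s1 s2 s3 s4]]] : exists s : R, [/\ 0 < s, s <= e, 2 * s < r &
    [/\ s <= px - a, s <= b - px, s <= py - c & s <= d - py]].
  exists (Num.min (Num.min e (r / 3)) (Num.min (Num.min (px - a) (b - px)) (Num.min (py - c) (d - py)))).
  split; last 1 first.
  - by rewrite !ge_min !lexx ?orbT.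
  - by rewrite !lt_min e0 divr_gt0// !subr_gt0 ap pb cp pd.
  - by rewrite !ge_min lexx.
  - apply: (@le_lt_trans _ _ (2 * (r / 3))); last by lra.
    by rewrite ler_pM2l// !ge_min lexx ?orbT.
rewrite (boundary_split_re f a (px - s) b)//; [|lra|lra].
rewrite (boundary_split_re f (px - s) (px + s) b)//; [|lra|lra].
rewrite (boundary_split_im f (px - s) (px + s) c (py - s) d)// ?(boundary_split_im f (px - s) (px + s) (py - s) (py + s) d)//; try lra.
have zero a' b' c' d' : a <= a' -> a' <= b' -> b' <= b -> c <= c' -> c' <= d' -> d' <= d ->
    (forall x y, a' <= x <= b' -> c' <= y <= d' -> Complex x y != p) -> B f a' b' c' d' = 0.
  move=> h1 h2 h3 h4 h5 h6 ne; apply: goursat => // x y /[dup] /ne ne' /andP[x1 x2] /[dup] /ne' ne'' /andP[y1 y2].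
  by apply: df => //; apply/andP; split; lra.
have ne x y : x < px \/ px < x \/ y < py \/ py < y -> Complex x y != p.
  move=> H; apply/eqP; rewrite /p => -[E1 E2]; move: H; rewrite E1 E2 !ltxx.
  by move=> [|[|[|]]].
rewrite (zero a (px - s) c d); [|lra|lra|lra|lra|lra|lra|by move=> x y /andP[? ?] /andP[? ?]; apply: ne; left; lra].
rewrite (zero (px + s) b c d); [|lra|lra|lra|lra|lra|lra|by move=> x y /andP[? ?] /andP[? ?]; apply: ne; right; left; lra].
rewrite (zero (px - s) (px + s) c (py - s)); [|lra|lra|lra|lra|lra|lra|by move=> x y /andP[? ?] /andP[? ?]; apply: ne; right; right; left; lra].
rewrite (zero (px - s) (px + s) (py + s) d); [|lra|lra|lra|lra|lra|lra|by move=> x y /andP[? ?] /andP[? ?]; apply: ne; right; right; right; lra].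
rewrite ?addr0 ?add0r.
apply: (@le_trans _ _ (4 * M * (px + s - (px - s) + (py + s - (py - s))))); last first.
  have : s * M <= e * M by rewrite ler_wpM2r.
  have -> : 4 * M * (px + s - (px - s) + (py + s - (py - s))) = 16 * (s * M) by ring.
  have -> : e * (16 * M) = 16 * (e * M) by ring.
  by rewrite ler_pM2l.
apply: boundary_le => //; [lra|lra|].
move=> x y /andP[x1 x2] /andP[y1 y2].
have -> : Complex x y = p + (Complex x y - p) by rewrite addrC subrK.
have -> : f (p + (Complex x y - p)) = f p + (f (p + (Complex x y - p)) - f p).
  by rewrite [f p + _]addrC subrK.
apply: le_trans (normcD _ _) _; rewrite /M lerD2l; apply: fr.
apply: le_lt_trans (normc_ReIm _) _; apply: le_lt_trans sr.
have -> : 2 * s = s + s by ring.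
by apply: lerD; rewrite /= ler_norml; apply/andP; split; lra.
Qed.

End ComplexDifferentiability.

(** * Cauchy estimates and exponential type *)

(* Circles are replaced by vertical segments of length [2 pi] through
   [z = exp w], so that Goursat's theorem on rectangles suffices. *)
Section CauchyExpansion.
Context {R : realType}.
Local Notation C := R[i].
Implicit Types (z w : C) (x y a b c d r : R) (h : C -> C).
Local Notation B := boundary_integral.

(* An angular window of length [2 * pi] whose interior contains the arguments
   [0] and [pi] of all nonzero real points. *)
Local Notation th0 := (- (pi / 2) : R).
Local Notation th1 := (pi + pi / 2 : R).

Lemma window_le : th0 <= th1.
Proof. have := @pi_gt0 R; lra. Qed.

Lemma window_size : th1 - th0 = 2 * pi.
Proof. by field. Qed.

Lemma cexp_window x : cexp (Complex x th1) = cexp (Complex x th0).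
Proof.
apply: complexP; rewrite /cexp /=.
  by rewrite addrC cosDpi cosN cos_pihalf oppr0.
by rewrite addrC sinDpi sinN.
Qed.

(** Periodicity cancels the two horizontal sides, so a vanishing boundary integral equates the
    vertical ones. *)
Lemma circle_integral_const h r1 r2 : ccont h -> r1 <= r2 ->
  (forall x, h (Complex x th1) = h (Complex x th0)) ->
  B h r1 r2 th0 th1 = 0 ->
  cint th0 th1 (fun y => h (Complex r1 y)) = cint th0 th1 (fun y => h (Complex r2 y)).
Proof.
move=> ch r12 per; rewrite /B.
rewrite (@eq_cint _ (fun x => h (Complex x th1)) (fun x => h (Complex x th0))); last first.
  by move=> x _; exact: per.
rewrite subrr add0r => /eqP; rewrite mulf_eq0 => /orP[/eqP/(congr1 (@complex.Im R))/= /eqP|].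
  by rewrite oner_eq0.
by rewrite subr_eq0 => /eqP ->.
Qed.

(** On the line [Re w = x] this is [h z / z ^ n] on the circle of radius [e ^ x], whose integral
    over the angle is [2 pi] times the [n]-th Taylor coefficient of [h]. *)
Definition log_circle h n w : C := h (cexp w) * cexp (- w) ^+ n.

Definition circle_coef h x n := cint th0 th1 (fun y => log_circle h n (Complex x y)).

Lemma cdable_log_circle h n w : (forall z, cdable h z) -> cdable (log_circle h n) w.
Proof.
move=> dh; apply: cdableM.
  by apply: (cdable_comp cexp h); [exact: cdable_cexp|exact: dh].
apply: cdableX; apply: (cdable_comp (fun w => - w) cexp); last exact: cdable_cexp.
by apply: cdableN; exact: cdable_id.
Qed.

Lemma lcont_log_circle h n x : (forall z, cdable h z) ->
  lcont (fun y => log_circle h n (Complex x y)).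
Proof.
move=> dh; apply: ccont_vertical; apply: cdiff_ccont => w; exact: cdable_log_circle.
Qed.

Lemma cexp_window_opp x : cexp (- Complex x th1) = cexp (- Complex x th0).
Proof.
have P w : cexp w * cexp (- w) = 1 by rewrite -cexpD subrr cexp0.
have c0 w : cexp w != 0.
  by rewrite -normc_gt0 normc_cexp expR_gt0.
by apply: (mulfI (c0 (Complex x th0))); rewrite P -{1}cexp_window P.
Qed.

Lemma circle_coef_const h n x y : (forall z, cdable h z) -> circle_coef h x n = circle_coef h y n.
Proof.
move=> dh; wlog xy : x y / x <= y.
  by move=> H; have [/H//|/ltW/H ->] := leP x y.
apply: circle_integral_const => //.
- by apply: cdiff_ccont => w; exact: cdable_log_circle.
- by move=> t; rewrite /log_circle cexp_window cexp_window_opp.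
- apply: goursat => //; last by move=> ? ? _ _; exact: cdable_log_circle.
    by apply: cdiff_ccont => w; exact: cdable_log_circle.
  exact: window_le.
Qed.

Lemma normc_cexp_opp w : normc (cexp (- w)) = expR (- Re w).
Proof. by rewrite normc_cexp cReN. Qed.

Lemma circle_coef_le h n x M : (forall z, cdable h z) ->
  (forall z, normc z = expR x -> normc (h z) <= M) ->
  normc (circle_coef h x n) <= 4 * pi * (M * expR (- x) ^+ n).
Proof.
move=> dh hM.
have -> : 4 * pi * (M * expR (- x) ^+ n) = 2 * (M * expR (- x) ^+ n) * (th1 - th0).
  by rewrite window_size; ring.
apply: cint_le; [exact: window_le|exact: lcont_log_circle|].
move=> y _; rewrite /log_circle Normc.normcM normcX normc_cexp_opp/=.
by rewrite ler_wpM2r ?exprn_ge0 ?expR_ge0//; apply: hM; rewrite normc_cexp.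
Qed.

Lemma expR_small (e : R) : 0 < e -> exists x, expR x <= e.
Proof. by move=> e0; exists (ln e); rewrite lnK. Qed.

(** The coefficient does not depend on the radius; for [n > 0] it vanishes as the radius tends to
    infinity. *)
Lemma circle_coef_one n x :
  circle_coef (fun=> 1) x n = (n == 0%N)%:R * ofR (2 * pi).
Proof.
have d1 z : cdable (fun=> 1 : C) z by exact: cdable_cst.
case: n => [|n].
  rewrite /circle_coef mul1r -window_size -[ofR _]mul1r -cint_cst ?window_le//.
  by apply: eq_cint => y _; rewrite /log_circle expr0 mulr1.
rewrite mul0r; apply: normc_le0; apply: (small_mul_le0 (K := 4 * pi)).
  by rewrite mulr_ge0// pi_ge0.
move=> e e0; have e1 : 0 < Num.min e 1 by rewrite lt_min e0 ltr01.
have [y ye] := expR_small _ e1.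
rewrite (circle_coef_const _ _ _ (- y) d1).
apply: le_trans (circle_coef_le _ _ _ 1 d1 _) _; first by move=> z _; rewrite Normc.normc1.
rewrite mulrC mul1r ler_wpM2r ?mulr_ge0 ?pi_ge0// opprK.
move: ye; rewrite le_min => /andP[ye y1]; rewrite exprS; apply: le_trans ye.
by rewrite ler_piMr ?expR_ge0// exprn_ile1 ?expR_ge0.
Qed.

(** Independence of the radius again, now with the radius tending to 0, where [h] is close to
    [h 0]. *)
Lemma circle_coef0 h x : (forall z, cdable h z) -> circle_coef h x 0 = h 0 * ofR (2 * pi).
Proof.
move=> dh; apply/eqP; rewrite -subr_eq0; apply/eqP.
apply: normc_le0; apply: (small_mul_le0 (K := 4 * pi)); first by rewrite mulr_ge0 ?pi_ge0.
move=> e e0; have [d d0 hd] := cdiff_ccont h dh 0 e e0.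
have [y yd] := expR_small (d / 2) (divr_gt0 d0 (ltr0n _ 2)).
rewrite (circle_coef_const _ _ _ y dh) -window_size -cint_cst ?window_le//.
rewrite addrC -mulN1r -cint_lin; [|exact: lcont_cst|exact: lcont_log_circle].
have -> : e * (4 * pi) = 2 * e * (th1 - th0) by rewrite window_size; ring.
apply: cint_le; [exact: window_le|by apply: lcont_lin; [exact: lcont_cst|exact: lcont_log_circle]|].
move=> t _; rewrite /log_circle expr0 mulr1 mulN1r addrC.
have := hd (cexp (Complex y t)); rewrite add0r; apply.
by rewrite normc_cexp/= (le_lt_trans yd)//; lra.
Qed.

Lemma sin0_window t : th0 <= t <= th1 -> sin t = 0 -> t = 0 \/ t = pi.
Proof.
have pi0 := @pi_gt0 R.
move=> /andP[t0 t1] st.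
have pos (s : R) : 0 < s < (pi : R) -> sin s != 0 by move=> /sin_gt0_pi; rewrite lt0r => /andP[].
have [tn|tp|<-] := ltgtP t 0; last by left.
  have := pos (- t); rewrite sinN st oppr0 eqxx => H.
  suff: false by []; apply: H; apply/andP; split; lra.
right; have [tn|tg|//] := ltgtP t pi.
  have := pos t; rewrite st eqxx => H; suff: false by []; apply: H; apply/andP; split; lra.
have := pos (t - pi); rewrite -[t](subrK pi) sinDpi in st *.
move/eqP: st; rewrite oppr_eq0 => /eqP st; rewrite addrK st eqxx => H.
suff: false by []; apply: H; apply/andP; split; lra.
Qed.

Lemma cexp_eq_real x r t : th0 <= t <= th1 -> x != 0 -> cexp (Complex r t) = ofR x ->
  r = ln `|x| /\ t = if 0 < x then 0 else pi.
Proof.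
move=> tw x0 E; have Er : expR r = `|x| by rewrite -normc_ofR -E normc_cexp.
split; first by rewrite -Er expRK.
have /(congr1 (@complex.Im R))/= /eqP := E; rewrite mulf_eq0 gt_eqF ?expR_gt0//= => /eqP st.
have /(congr1 (@complex.Re R))/= Ec := E.
have [t0|tpi] := sin0_window t tw st; move: Ec.
  by rewrite t0 cos0 mulr1 => <-; rewrite expR_gt0.
rewrite tpi cospi mulrN1 => <-; by rewrite oppr_gt0 ltNge expR_ge0.
Qed.

(** Cauchy's formula with the singularity removed: [k w] is [q (e ^ w) e ^ w] for the difference
    quotient [q] of [h] at [x]. In the window [x] has one logarithm, an interior point where [q] is
    known to be continuous, so [goursat_exceptional] makes the integral independent of the radius.
    As the radius tends to 0, the factor [e ^ w] makes it vanish. *)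
Lemma cauchy_quotient h x r : (forall z, cdable h z) -> x != 0 -> `|x| < expR r ->
  exists k, [/\ ccont k, (forall y, k (Complex r y) = (h (cexp (Complex r y)) - h (ofR x)) *
      (cexp (Complex r y) / (cexp (Complex r y) - ofR x))) &
    cint th0 th1 (fun y => k (Complex r y)) = 0].
Proof.
move=> dh x0 xr; have [l hl] := dh (ofR x).
pose q := difference_quotient h (ofR x) l.
have cq : ccont q by exact: ccont_difference_quotient.
pose k w := q (cexp w) * cexp w.
have ck : ccont k.
  have /ccontP cc : ccont (@cexp R) by apply: cdiff_ccont => z; exact: cdable_cexp.
  move/ccontP : cq => cq'; apply/ccontP => w.
  have c1 := continuous_comp (cc w) (cq' (cexp w)).
  exact: (@cvgM C _ (nbhs (w : C^o)) (nbhs_filter (w : C^o)) _ _ _ _ c1 (cc w)).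
exists k; split => //.
  move=> y; rewrite /k /q /difference_quotient.
  case: eqP => [E|_]; last by rewrite mulrA mulrAC.
  by move: xr; rewrite -[`|x|]normc_ofR -E normc_cexp ltxx.
set x1 := ln `|x|.
have nx0 : 0 < `|x| by rewrite normr_gt0.
set tx : R := if 0 < x then 0 else pi.
have pi0 := @pi_gt0 R.
have txw : th0 < tx < th1 by rewrite /tx; case: ifP => _; apply/andP; split; lra.
have rx1 : x1 < r by rewrite -ltr_expR lnK.
have konst r0 : r0 < x1 -> cint th0 th1 (fun y => k (Complex r0 y)) = cint th0 th1 (fun y => k (Complex r y)).
  move=> r0x; apply: circle_integral_const => //; first lra.
    by move=> t; rewrite /k cexp_window.
  apply: (goursat_exceptional k _ _ _ _ x1 tx) => //; first by rewrite r0x rx1.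
  move=> u v _ vw ne.
  apply: cdableM; last exact: cdable_cexp.
  apply: (cdable_comp cexp q); first exact: cdable_cexp.
  apply: cdable_difference_quotient => //; apply: contra_neq ne.
  by move=> /(cexp_eq_real _ _ _ vw x0)[-> ->].
apply: normc_le0; apply: (small_mul_le0 (K := 4 * pi)); first by rewrite mulr_ge0 ?pi_ge0.
move=> e e0; have [d d0 qd] := cq 0 1 ltr01.
have M0 : 0 < normc (q 0) + 1 by rewrite ltr_wpDl ?normc_ge0.
have m0 : 0 < Num.min (e / (normc (q 0) + 1)) (Num.min (d / 2) (`|x| / 2)).
  by rewrite !lt_min !divr_gt0.
have [r0] := expR_small _ m0; rewrite !le_min => /and3P[re rd rx].
rewrite -(konst r0); last by rewrite -ltr_expR lnK//; lra.
have -> : e * (4 * pi) = 2 * e * (th1 - th0) by rewrite window_size; ring.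
apply: cint_le; [exact: window_le|exact: ccont_vertical|move=> y _].
rewrite /k Normc.normcM normc_cexp/=.
apply: (@le_trans _ _ ((normc (q 0) + 1) * expR r0)); last by rewrite mulrC -ler_pdivlMr.
rewrite ler_wpM2r ?expR_ge0//.
have -> : q (cexp (Complex r0 y)) = q 0 + (q (0 + cexp (Complex r0 y)) - q 0).
  by rewrite add0r addrC subrK.
apply: le_trans (normcD _ _) _; rewrite lerD2l; apply: qd.
by rewrite normc_cexp/=; lra.
Qed.

End CauchyExpansion.

(** * Taylor coefficients of functions of exponential type *)

Section ExponentialType.
Context {R : realType}.
Local Notation C := R[i].
Implicit Types (z w : C) (x y a b c d r : R) (h : C -> C).
Local Notation th0 := (- (pi / 2) : R).
Local Notation th1 := (pi + pi / 2 : R).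

Lemma lcont_sum (I : nat) (F : nat -> R -> C) : (forall n, lcont (F n)) ->
  lcont (fun y => \sum_(n < I) F n y).
Proof.
move=> cF; elim: I => [|I IH].
  under eq_fun do rewrite big_ord0; exact: lcont_cst.
under eq_fun do rewrite big_ord_recr /= addrC -[F I _]mul1r.
exact: lcont_lin.
Qed.

Lemma cint_sum (I : nat) (F : nat -> R -> C) a b : a <= b -> (forall n, lcont (F n)) ->
  cint a b (fun y => \sum_(n < I) F n y) = \sum_(n < I) cint a b (F n).
Proof.
move=> ab cF; elim: I => [|I IH].
  under eq_fun do rewrite big_ord0; by rewrite cint_cst// mul0r big_ord0.
under eq_fun do rewrite big_ord_recr /= addrC -[F I _]mul1r.
rewrite cint_lin//; last exact: lcont_sum.
by rewrite IH big_ord_recr/= mul1r addrC.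
Qed.

Lemma lcont_scale (k : C) f : lcont f -> lcont (fun y => k * f y).
Proof.
by move=> cf; under eq_fun do rewrite -[_ * _]addr0; apply: lcont_lin => //; exact: lcont_cst.
Qed.

Lemma cint_scale (k : C) f a b : a <= b -> lcont f ->
  cint a b (fun y => k * f y) = k * cint a b f.
Proof.
move=> ab cf; under eq_fun do rewrite -[_ * _]addr0.
by rewrite cint_lin//; [rewrite cint_cst// mul0r addr0|exact: lcont_cst].
Qed.

Lemma geometric_remainder (z w : C) N : w != 0 -> w != z ->
  w / (w - z) = \sum_(n < N) (z / w) ^+ n + (z / w) ^+ N * (w / (w - z)).
Proof.
move=> w0 wz; have wz0 : w - z != 0 by rewrite subr_eq0.
elim: N => [|N IH]; first by rewrite big_ord0 add0r expr0 mul1r.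
rewrite big_ord_recr/= exprSr -addrA.
rewrite [LHS]IH; congr (_ + _).
have -> : (z / w) ^+ N * (z / w) * (w / (w - z)) = (z / w) ^+ N * (z / (w - z)).
  by field; rewrite w0 wz0.
rewrite -[X in _ = X + _]mulr1 -mulrDr; congr (_ * _).
by field.
Qed.

(** The kernel of [cauchy_quotient] is expanded into a geometric series in [x / e ^ w], and the
    remainder is estimated directly on the circle. *)
Lemma cauchy_expansion h x r M N : (forall z, cdable h z) -> x != 0 -> `|x| < expR r ->
  (forall z, normc z = expR r -> normc (h z) <= M) ->
  normc (h (ofR x) * ofR (2 * pi) - \sum_(n < N.+1) ofR x ^+ n * circle_coef h r n) <=
  4 * pi * (M + normc (h (ofR x))) * (expR r / (expR r - `|x|)) * (`|x| / expR r) ^+ N.+1.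
Proof.
move=> dh x0 xr hM; have [k [ck Ek k0]] := cauchy_quotient h x r dh x0 xr.
(* The numerator of the difference quotient; subtracting the value at [x] affects the coefficient of
   order 0 only. *)
pose h1 z := h z - h (ofR x).
have dh1 z : cdable h1 z by apply: cdableD => //; exact: cdable_cst.
have wle := @window_le R.
pose F n y := ofR x ^+ n * log_circle h1 n (Complex r y).
have cF n : lcont (F n) by apply: lcont_scale; exact: lcont_log_circle.
have coefE n : circle_coef h1 r n = circle_coef h r n - h (ofR x) * ((n == 0%N)%:R * ofR (2 * pi)).
  have d1 z : cdable (fun=> 1 : C) z by exact: cdable_cst.
  rewrite -(circle_coef_one n r) addrC -mulNr -[RHS]cint_lin; last 2 first.
  - exact: lcont_log_circle.
  - exact: lcont_log_circle.
  by apply: eq_cint => y _; rewrite /log_circle /h1; ring.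
have sumE : \sum_(n < N.+1) ofR x ^+ n * circle_coef h1 r n =
    \sum_(n < N.+1) ofR x ^+ n * circle_coef h r n - h (ofR x) * ofR (2 * pi).
  under eq_bigr do rewrite coefE mulrBr.
  rewrite sumrB; congr (_ - _); rewrite big_ord_recl big1 ?addr0/=.
    by rewrite expr0 !mul1r.
  by move=> i _; rewrite mul0r !mulr0.
rewrite -opprB -sumE.
have cvk : lcont (fun y => k (Complex r y)) by exact: ccont_vertical.
have -> : - (\sum_(n < N.+1) ofR x ^+ n * circle_coef h1 r n) =
    cint th0 th1 (fun y => -1 * (\sum_(n < N.+1) F n y) + k (Complex r y)).
  rewrite cint_lin//; last exact: lcont_sum.
  rewrite k0 addr0 mulN1r cint_sum//; congr (- _); apply: eq_bigr => n _.
  by rewrite /F cint_scale//; exact: lcont_log_circle.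
have rx0 : 0 < expR r - `|x| by rewrite subr_gt0.
set q := _ / (expR r - _).
have -> : 4 * pi * (M + normc (h (ofR x))) * q * (`|x| / expR r) ^+ N.+1 =
    2 * ((M + normc (h (ofR x))) * q * (`|x| / expR r) ^+ N.+1) * (th1 - th0).
  by rewrite window_size; ring.
apply: cint_le => //; first by apply: lcont_lin => //; exact: lcont_sum.
move=> y _; set w := Complex r y.
have nw : normc (cexp w) = expR r by rewrite normc_cexp.
have w0 : cexp w != 0 by rewrite -normc_gt0 nw expR_gt0.
have wx : cexp w != ofR x.
  by apply: contraTneq xr => E; rewrite -normc_ofR -E nw ltxx.
have wV : cexp (- w) = (cexp w)^-1.
  by apply: (mulfI w0); rewrite -cexpD subrr cexp0 mulfV.
have -> : -1 * (\sum_(n < N.+1) F n y) + k w =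
    h1 (cexp w) * ((ofR x / cexp w) ^+ N.+1 * (cexp w / (cexp w - ofR x))).
  have E1 : \sum_(n < N.+1) F n y = h1 (cexp w) * \sum_(n < N.+1) (ofR x / cexp w) ^+ n.
    rewrite mulr_sumr; apply: eq_bigr => n _; rewrite /F /log_circle -/w wV exprMn.
    by rewrite mulrCA.
  rewrite E1 /w Ek -/w -/(h1 (cexp w)).
  rewrite [in LHS](geometric_remainder (ofR x) _ N.+1 w0 wx).
  by move: (\sum_(n < _) _) (_ ^+ N.+1 * _) => u v; ring.
rewrite !Normc.normcM normcX Normc.normcM !Normc.normcV normc_ofR nw -mulrA.
apply: ler_pM; rewrite ?normc_ge0//.
- by rewrite mulr_ge0 ?exprn_ge0 ?divr_ge0 ?expR_ge0 ?normc_ge0.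
- by apply: le_trans (normcB _ _) _; rewrite lerD2r; exact: hM.
- rewrite mulrC ler_wpM2r ?exprn_ge0 ?divr_ge0 ?expR_ge0//.
  rewrite /q ler_wpM2l ?expR_ge0// lef_pV2 ?posrE//; last first.
    by rewrite normc_gt0 subr_eq0.
  have := normcB (cexp w - ofR x) (- ofR x); rewrite opprK subrK normcNr nw normc_ofR.
  by rewrite lerBlDr.
Qed.

(** A weak Stirling bound. The quotient of consecutive values of [n! e ^ n / n ^ n] is at most
    [e ^ (1 / n.+1)], which eventually drops below [rho]. *)
Lemma fact_growth (rho : R) : 1 < rho ->
  exists2 K : R, 0 <= K & forall n, (0 < n)%N ->
    n`!%:R * expR n%:R <= K * rho ^+ n * n%:R ^+ n.
Proof.
move=> rho1; pose s n := n`!%:R * expR n%:R / n%:R ^+ n : R.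
have s0 n : 0 <= s n by rewrite /s !mulr_ge0 ?expR_ge0 ?invr_ge0 ?exprn_ge0.
have step n : (0 < n)%N -> s n.+1 <= expR (n.+1%:R^-1) * s n.
  move=> n0; have nR : (0 : R) < n%:R by rewrite ltr0n.
  have n1R : (0 : R) < n.+1%:R by rewrite ltr0n.
  have E : n%:R / n.+1%:R <= expR (- n.+1%:R^-1) :> R.
    apply: le_trans (expR_ge1Dx _); rewrite -natr1; apply/eq_ler; field.
    by rewrite natr1 gt_eqF.
  have En : (n%:R / n.+1%:R) ^+ n <= expR (- (n%:R / n.+1%:R)) :> R.
    by rewrite -mulrN expRM_natl lerXn2r// nnegrE ?expR_ge0// divr_ge0.
  have -> : s n.+1 = s n * (expR 1 * (n%:R / n.+1%:R) ^+ n).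
    rewrite /s factS natrM -[in expR _]natr1 expRD exprS expr_div_n; field.
    by rewrite nat1r !gt_eqF ?exprn_gt0.
  rewrite mulrC ler_wpM2r//.
  apply: le_trans (ler_wpM2l (expR_ge0 1) En) _; rewrite -expRD ler_expR.
  by rewrite -natr1; apply/eq_ler; field; rewrite natr1 gt_eqF.
have lrho : 0 < ln rho by rewrite ln_gt0.
have [n0 n0P] : exists n0, forall n, (n0 < n)%N -> expR (n%:R^-1) <= rho.
  exists (Num.truncn (ln rho)^-1).+1 => n n0n.
  rewrite -[leRHS](lnK (_ : rho \is Num.pos)) ?posrE ?(lt_trans _ rho1)// ler_expR.
  rewrite -[leRHS]invrK lef_pV2 ?posrE ?invr_gt0// ?ltr0n ?(leq_ltn_trans _ n0n)//.
  apply: (@le_trans _ _ (Num.truncn (ln rho)^-1).+1%:R); last by rewrite ler_nat ltnW.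
  by apply/ltW; exact: truncnS_gt.
have r1 n : 1 <= rho ^+ n by rewrite exprn_ege1// ltW.
exists (\sum_(k < n0.+1) s k); first by apply: sumr_ge0.
have Kn0 k : (k <= n0)%N -> s k <= \sum_(k < n0.+1) s k.
  move=> kn; rewrite (bigD1 (Ordinal (kn : (k < n0.+1)%N)))//= lerDl.
  by apply: sumr_ge0.
have H n : s n <= (\sum_(k < n0.+1) s k) * rho ^+ n.
  elim: n => [|n IH]; first by rewrite expr0 mulr1 Kn0.
  have [nn|nn] := leqP n.+1 n0.
    by apply: le_trans (Kn0 _ nn) _; rewrite ler_peMr// sumr_ge0.
  case: n IH nn => [|n] IH nn.
    move: nn; rewrite ltnS leqn0 => /eqP E0; rewrite E0 in n0P *.
    rewrite big_ord1 /s fact0 expr0 expR0 divr1 mul1r !mul1r expr1.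
    by rewrite invr1 mul1r; have := n0P 1%N isT; rewrite invr1.
  apply: le_trans (step _ _) _ => //.
  apply: le_trans (ler_wpM2l (expR_ge0 _) IH) _.
  rewrite [rho ^+ n.+2]exprS mulrCA ler_wpM2l ?sumr_ge0//.
  rewrite ler_wpM2r ?exprn_ge0 ?(le_trans ler01 (ltW rho1))//.
  by apply: n0P; rewrite ltnS.
move=> n nn; have := H n; rewrite /s ler_pdivrMr// exprn_gt0// ltr0n//.
Qed.

(** At radius [n / tau] the bound on the coefficient is a multiple of [(e tau / n) ^ n]; after
    multiplication by [n!] the excess over [tau ^ n] is absorbed by the passage to [tau']. The
    growth bound says nothing for [|z| < M0], so the finitely many orders with a smaller radius are
    covered by [D0]. *)
Theorem entire_exp_power h (tau tau' K M0 : R) : (forall z, cdable h z) ->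
  0 < tau -> tau < tau' ->
  (forall z, M0 <= normc z -> normc (h z) <= K * expR (tau * normc z)) ->
  exists (u : nat -> C) (D : R), (forall k, normc (u k) <= D * tau' ^+ k) /\
    forall x, hser u (ofR x) = h (ofR x).
Proof.
move=> dh t0 tt hK.
have t'0 : 0 < tau' by exact: lt_trans tt.
have pi0 := @pi_gt0 R.
have pi2 : ofR (2 * pi : R) != 0 :> C by rewrite -normc_gt0 normc_ofR normr_gt0 gt_eqF// mulr_gt0.
(* Taken on the unit circle; [circle_coef_const] moves them to whatever radius is convenient. *)
pose a n := circle_coef h 0 n / ofR (2 * pi).
have K0 : 0 <= K.
  have := hK (ofR (Num.max 0 M0)); rewrite normc_ofR.
  have -> : `|Num.max 0 M0| = Num.max 0 M0 by rewrite ger0_norm// le_max lexx.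
  rewrite le_max lexx orbT => /(_ isT) /(le_trans (normc_ge0 _)).
  by rewrite pmulr_lge0// expR_gt0.
have aK n r : 0 < r -> M0 <= r -> normc (a n) <= 2 * K * expR (tau * r) / r ^+ n.
  move=> r0 Mr; rewrite /a (circle_coef_const h n 0 (ln r) dh) Normc.normcM Normc.normcV normc_ofR.
  rewrite [`|2 * pi|]gtr0_norm ?mulr_gt0// ler_pdivrMr ?mulr_gt0//.
  apply: le_trans (circle_coef_le h n (ln r) (K * expR (tau * r)) dh _) _.
    by move=> z; rewrite lnK// => E; rewrite -E; apply: hK; rewrite E.
  rewrite expRN lnK// exprVn; apply/eq_ler; ring.
exists (fun n => n`!%:R * a n).
have [k0 k0P] : exists k0, forall n, (k0 < n)%N -> M0 <= n%:R / tau.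
  exists (Num.truncn (`|M0| * tau)) => n nk.
  rewrite ler_pdivlMr//; apply: (@le_trans _ _ (`|M0| * tau)).
    by rewrite ler_wpM2r ?(ltW t0)// ler_norm.
  by apply: le_trans (ltW (truncnS_gt _)) _; rewrite ler_nat.
have [|K1 K10 K1P] := fact_growth (tau' / tau); first by rewrite ltr_pdivlMr// mul1r.
pose D0 := \sum_(k < k0.+1) normc (k`!%:R * a k) / tau' ^+ k.
have D00 : 0 <= D0 by apply: sumr_ge0 => k _; rewrite mulr_ge0 ?normc_ge0 ?invr_ge0 ?exprn_ge0// ltW.
exists (D0 + 2 * K * K1); split.
  move=> n; have [nk|nk] := leqP n k0.
    apply: (@le_trans _ _ (D0 * tau' ^+ n)); last first.
      by rewrite ler_wpM2r ?exprn_ge0 ?(ltW t'0)// lerDl !mulr_ge0.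
    rewrite -ler_pdivrMr ?exprn_gt0// /D0 (bigD1 (Ordinal (nk : (n < k0.+1)%N)))//= lerDl.
    by apply: sumr_ge0 => k _; rewrite mulr_ge0 ?normc_ge0 ?invr_ge0 ?exprn_ge0// ltW.
  apply: (@le_trans _ _ (2 * K * K1 * tau' ^+ n)); last first.
    by rewrite ler_wpM2r ?exprn_ge0 ?(ltW t'0)// lerDr.
  have n0 : (0 < n)%N by exact: leq_ltn_trans nk.
  have nR : (0 : R) < n%:R by rewrite ltr0n.
  rewrite Normc.normcM normc_natr.
  apply: le_trans (ler_wpM2l _ (aK n (n%:R / tau) _ (k0P n nk))) _ => //.
    by rewrite divr_gt0.
  have -> : tau * (n%:R / tau) = n%:R by field; rewrite gt_eqF.
  have -> : n`!%:R * (2 * K * expR n%:R / (n%:R / tau) ^+ n) =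
      2 * K * (n`!%:R * expR n%:R * tau ^+ n / n%:R ^+ n).
    by rewrite expr_div_n; field; rewrite !expf_neq0 ?gt_eqF.
  rewrite -!mulrA ler_wpM2l// ler_wpM2l// !mulrA ler_pdivrMr ?exprn_gt0//.
  have := K1P n n0; rewrite -(ler_pM2r (exprn_gt0 n t0)) => /le_trans; apply.
  by rewrite expr_div_n; apply/eq_ler; field; rewrite expf_neq0 ?gt_eqF.
move=> x; apply: limc_seq => e e0.
have serE N : series (fun k => hterm (fun n => n`!%:R * a n) (ofR x) k : C^o) N =
    \sum_(n < N) ofR x ^+ n * a n.
  rewrite /series/= big_mkord; apply: eq_bigr => n _; rewrite /hterm; field.
  by rewrite pnatr_eq0 -lt0n fact_gt0.
have [x00|x0] := eqVneq x 0.
  near=> N; rewrite serE x00.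
  have [N' ->] : exists N', N = N'.+1.
    by exists N.-1; rewrite prednK//; near: N; exists 1%N.
  rewrite big_ord_recl big1 ?addr0 ?expr0 ?mul1r/=; last first.
    by move=> i _; rewrite -ofRX expr0n/= (_ : ofR 0 = 0)// mul0r.
  rewrite /a circle_coef0// mulfK// subrr Normc.normc0; exact: ltW.
pose r := Num.max M0 (`|x| + 1).
have rM : M0 <= r by rewrite le_max lexx.
have rx : `|x| < r by rewrite lt_max ltrDl ltr01 orbT.
have r0 : 0 < r by exact: le_lt_trans rx.
pose M := K * expR (tau * r).
have hM z : normc z = expR (ln r) -> normc (h z) <= M.
  by rewrite lnK// => E; rewrite /M -E; apply: hK; rewrite E.
have xr : `|x| < expR (ln r) by rewrite lnK.
pose Q := 4 * pi * (M + normc (h (ofR x))) * (expR (ln r) / (expR (ln r) - `|x|)).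
have Q0 : 0 <= Q.
  have M00 : 0 <= M by rewrite mulr_ge0 ?expR_ge0.
  apply: mulr_ge0; last by rewrite divr_ge0 ?expR_ge0// subr_ge0 ltW.
  by apply: mulr_ge0; [rewrite mulr_ge0// ltW|rewrite addr_ge0 ?normc_ge0].
have cv : (fun N => Q * (`|x| / expR (ln r)) ^+ N) @ \oo --> 0.
  rewrite -(mulr0 Q); apply: cvgMr; apply: cvg_expr.
  by rewrite ger0_norm ?divr_ge0 ?expR_ge0// ltr_pdivrMr ?expR_gt0// mul1r.
near=> N; rewrite serE.
have [N' EN] : exists N', N = N'.+1.
  by exists N.-1; rewrite prednK//; near: N; exists 1%N.
have := cauchy_expansion h x (ln r) M N' dh x0 xr hM.
have -> : h (ofR x) * ofR (2 * pi) - \sum_(n < N'.+1) ofR x ^+ n * circle_coef h (ln r) n =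
  - ofR (2 * pi) * (\sum_(n < N'.+1) ofR x ^+ n * a n - h (ofR x)).
  rewrite mulrBr mulr_sumr addrC mulNr opprK [ofR (2 * pi) * _]mulrC; congr (_ + _).
  rewrite -sumrN; apply: eq_bigr => n _.
  rewrite /a (circle_coef_const h n 0 (ln r) dh); field; exact: pi2.
rewrite -EN Normc.normcM normcNr normc_ofR => H.
apply: (@le_trans _ _ (`|2 * pi| * normc (\sum_(n < N) ofR x ^+ n * a n - h (ofR x)))).
  rewrite ler_peMl ?normc_ge0// ger0_norm ?mulr_ge0 ?(ltW pi0)//.
  have := @pi_ge2 R; lra.
apply: le_trans H _; rewrite -/Q; near: N.
have /cvgrPdist_le/(_ e e0) := cv; apply: filterS => N.
by rewrite sub0r normrN; apply: le_trans; exact: ler_norm.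
Unshelve. all: by end_near. Qed.

End ExponentialType.

(** * Dominated complex series and entire power series *)

Section ComplexSeries.
Context {R : realType}.
Local Notation C := R[i].
Implicit Types (z w : C) (x y t : R) (u v : nat -> C).

Definition csum (a : nat -> C) : C := limn (series (fun k => a k : C^o)).

Definition cdominated (a : nat -> C) (b : nat -> R) :=
  (forall k, normc (a k) <= b k) /\ cvgn (series b).

Lemma cdominated_Re {a b} : cdominated a b -> forall k, `|Re (a k)| <= b k.
Proof. by move=> [ab _] k; apply: le_trans (ab k); exact: normc_Re. Qed.

Lemma cdominated_Im {a b} : cdominated a b -> forall k, `|Im (a k)| <= b k.
Proof. by move=> [ab _] k; apply: le_trans (ab k); exact: normc_Im. Qed.

Lemma Re_sum (I : Type) (r : seq I) (P : pred I) (a : I -> C) :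
  Re (\sum_(i <- r | P i) a i) = \sum_(i <- r | P i) Re (a i).
Proof. by apply: (big_morph (@complex.Re R)) => // z w; exact: cReD. Qed.

Lemma Im_sum (I : Type) (r : seq I) (P : pred I) (a : I -> C) :
  Im (\sum_(i <- r | P i) a i) = \sum_(i <- r | P i) Im (a i).
Proof. by apply: (big_morph (@complex.Im R)) => // z w; exact: cImD. Qed.

Lemma csumE {a b} : cdominated a b ->
  csum a = Complex (limn (series (fun k => Re (a k)))) (limn (series (fun k => Im (a k)))).
Proof.
move=> ab; apply: limc_ReIm => /=.
- have -> : (fun n => Re (series (fun k => a k : C^o) n)) = series (fun k => Re (a k)).
    by apply/funext => n; rewrite /series /= Re_sum.
  exact: (dom_cvg (cdominated_Re ab) ab.2).
- have -> : (fun n => Im (series (fun k => a k : C^o) n)) = series (fun k => Im (a k)).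
    by apply/funext => n; rewrite /series /= Im_sum.
  exact: (dom_cvg (cdominated_Im ab) ab.2).
Qed.

Lemma csum_le {a b} : cdominated a b -> normc (csum a) <= 2 * limn (series b).
Proof.
move=> ab; rewrite (csumE ab); apply: le_trans (normc_ReIm _) _ => /=.
have -> : 2 * limn (series b) = limn (series b) + limn (series b) by ring.
by apply: lerD; apply: dom_lim ab.2; [exact: cdominated_Re|exact: cdominated_Im].
Qed.

Lemma cdominated_lin {a b a' b'} (c : C) : cdominated a b -> cdominated a' b' ->
  cdominated (fun k => c * a k + a' k) (fun k => normc c * b k + b' k).
Proof.
move=> [ab cb] [ab' cb']; split; last exact: cvg_series_lin.
move=> k; apply: le_trans (normcD _ _) _; rewrite Normc.normcM.
by rewrite lerD// ler_wpM2l ?normc_ge0.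
Qed.

Lemma csum_lin {a b a' b'} (c : C) : cdominated a b -> cdominated a' b' ->
  csum (fun k => c * a k + a' k) = c * csum a + csum a'.
Proof.
move=> ab ab'; rewrite (csumE (cdominated_lin c ab ab')) (csumE ab) (csumE ab').
have c1 := dom_cvg (cdominated_Re ab) ab.2.
have c2 := dom_cvg (cdominated_Im ab) ab.2.
have c3 := dom_cvg (cdominated_Re ab') ab'.2.
have c4 := dom_cvg (cdominated_Im ab') ab'.2.
apply: complexP; rewrite ?cReD ?cImD ?cReM ?cImM /=.
  under eq_fun do rewrite cReD cReM -addrA -mulNr.
  rewrite (lim_series_lin _ c1 (cvg_series_lin _ c2 c3)) (lim_series_lin _ c2 c3); ring.
under eq_fun do rewrite cImD cImM -addrA.
rewrite (lim_series_lin _ c2 (cvg_series_lin _ c1 c4)) (lim_series_lin _ c1 c4); ring.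
Qed.

Lemma csum_recl {a b} : cdominated a b -> csum a = a 0%N + csum (fun k => a k.+1).
Proof.
move=> ab.
have ab1 : cdominated (fun k => a k.+1) (fun k => b (1 + k)%N).
  by split; [move=> k; exact: ab.1|exact: (is_cvg_drop 1 ab.2)].
rewrite (csumE ab) (csumE ab1); apply: complexP; rewrite ?cReD ?cImD /=.
  have := lim_drop 1 (dom_cvg (cdominated_Re ab) ab.2).
  by rewrite series_ord big_ord1 => ->; rewrite addrC subrK.
have := lim_drop 1 (dom_cvg (cdominated_Im ab) ab.2).
by rewrite series_ord big_ord1 => ->; rewrite addrC subrK.
Qed.

Definition cgeo_bounded (D t : R) u := forall k, normc (u k) <= D * t ^+ k.

Lemma cgeo_bounded_Re {D t u} : cgeo_bounded D t u -> geo_bounded D t (fun k => Re (u k)).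
Proof. by move=> bu k; apply: le_trans (bu k); exact: normc_Re. Qed.

Lemma cgeo_bounded_Im {D t u} : cgeo_bounded D t u -> geo_bounded D t (fun k => Im (u k)).
Proof. by move=> bu k; apply: le_trans (bu k); exact: normc_Im. Qed.

Lemma cgeo_bounded_ReIm {D E t u} : geo_bounded D t (fun k => Re (u k)) ->
  geo_bounded E t (fun k => Im (u k)) -> cgeo_bounded (D + E) t u.
Proof.
by move=> bR bI k; apply: le_trans (normc_ReIm _) _; rewrite mulrDl lerD.
Qed.

Lemma cgeo_bounded_ge0 {D t u} : cgeo_bounded D t u -> 0 <= D.
Proof. by move=> /cgeo_bounded_Re/geo_bounded_ge0. Qed.

Lemma hterm_dominated {D t u} z : 0 <= t -> cgeo_bounded D t u ->
  cdominated (hterm u z) (fun k => D * exp_coeff (t * normc z) k).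
Proof.
move=> t0 bu; split; last exact: cvg_scaled_exp.
move=> k; rewrite /hterm !Normc.normcM Normc.normcV normcX normc_natr exp_coeffE exprMn.
by rewrite !mulrA !ler_wpM2r ?invr_ge0 ?exprn_ge0 ?normc_ge0//; exact: bu.
Qed.

Lemma hser_csum u z : hser u z = csum (hterm u z). Proof. by []. Qed.

Lemma habs_cvg_geo {D t u} z : 0 <= t -> cgeo_bounded D t u -> habs_cvg u z.
Proof.
move=> t0 bu; have [H c] := hterm_dominated z t0 bu.
apply: dom_cvg c => k; rewrite ger0_norm ?normc_ge0//; exact: H.
Qed.

Lemma hser_ofR {D t u} x : 0 <= t -> cgeo_bounded D t u ->
  hser u (ofR x) = Complex (rser (fun k => Re (u k)) x) (rser (fun k => Im (u k)) x).
Proof.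
move=> t0 bu; rewrite hser_csum (csumE (hterm_dominated (ofR x) t0 bu)).
have E k : hterm u (ofR x) k = u k * ofR (x ^+ k / k`!%:R).
  rewrite /hterm -ofRX -mulrA; congr (_ * _).
  by rewrite -ofR_nat !ofRE -fmorphV -rmorphM.
by congr Complex; rewrite /rser; congr (limn (series _)); apply/funext => k;
  rewrite E ?cReMr ?cImMr mulrA.
Qed.

Lemma hser_le {D t u} z : 0 <= t -> cgeo_bounded D t u ->
  normc (hser u z) <= 2 * D * expR (t * normc z).
Proof.
move=> t0 bu; apply: le_trans (csum_le (hterm_dominated z t0 bu)) _.
by rewrite lim_series_scale ?mulrA//; exact: is_cvg_series_exp_coeff.
Qed.

Definition cshift u : nat -> C := fun k => u k.+1.

Lemma cgeo_bounded_cshift {D t u} : cgeo_bounded D t u -> cgeo_bounded (D * t) t (cshift u).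
Proof. by move=> bu k; rewrite -mulrA -exprS; exact: bu. Qed.

(** The factor [2 ^ k] absorbs the binomial coefficients; the factorials in [hser] can afford it. *)
Lemma power_increment_le z w k : normc w <= 1 ->
  normc ((z + w) ^+ k - z ^+ k - k%:R * z ^+ k.-1 * w) <= (2 * (normc z + 1)) ^+ k * normc w ^+ 2.
Proof.
move=> w1; set r := normc z + 1.
have r1 : 1 <= r by rewrite lerDr normc_ge0.
have r0 : 0 <= r by exact: le_trans r1.
elim: k => [|k IH].
  by rewrite !expr0 subrr mul0r mul0r subr0 Normc.normc0 mul1r sqr_ge0.
have -> : (z + w) ^+ k.+1 - z ^+ k.+1 - k.+1%:R * z ^+ k.+1.-1 * w =
    (z + w) * ((z + w) ^+ k - z ^+ k - k%:R * z ^+ k.-1 * w) + k%:R * z ^+ k.-1 * w ^+ 2.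
  by case: k {IH} => [|k] /=; rewrite ?exprS ?expr0; ring.
apply: le_trans (normcD _ _) _; rewrite Normc.normcM.
have zw : normc (z + w) <= r by apply: le_trans (normcD _ _) _; rewrite lerD2l.
have E : k%:R * normc z ^+ k.-1 <= r * (2 * r) ^+ k.
  apply: (@le_trans _ _ (2 ^+ k * r ^+ k)).
    apply: ler_pM; rewrite ?exprn_ge0 ?normc_ge0//.
      by rewrite -natrX ler_nat ltnW// ltn_expl.
    case: k {IH} => [|k]/=; rewrite ?expr0//.
    apply: (@le_trans _ _ (r ^+ k)); first by rewrite lerXn2r// ?nnegrE ?normc_ge0// lerDl.
    by rewrite exprS ler_peMl// exprn_ge0.
  by rewrite -exprMn ler_peMl// exprn_ge0// mulr_ge0.
rewrite Normc.normcM Normc.normcM normcX normc_natr normcX [(2 * r) ^+ k.+1]exprS.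
have h1 : normc (z + w) * normc ((z + w) ^+ k - z ^+ k - k%:R * z ^+ k.-1 * w) <=
    r * ((2 * r) ^+ k * normc w ^+ 2).
  by apply: ler_pM; rewrite ?normc_ge0.
have h2 : k%:R * normc z ^+ k.-1 * normc w ^+ 2 <= r * (2 * r) ^+ k * normc w ^+ 2.
  by rewrite ler_wpM2r ?sqr_ge0.
apply: le_trans (lerD h1 h2) _; apply/eq_ler; ring.
Qed.

Lemma cdiff_hser {D t u} z : 0 <= t -> cgeo_bounded D t u ->
  cdiff (hser u) z (hser (cshift u) z).
Proof.
move=> t0 bu.
pose K := 2 * D * expR (t * (2 * (normc z + 1))).
have D0 := cgeo_bounded_ge0 bu.
have K0 : 0 <= K by rewrite !mulr_ge0 ?expR_ge0.
have main w : normc w <= 1 ->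
    normc (hser u (z + w) - hser u z - hser (cshift u) z * w) <= K * normc w ^+ 2.
  move=> w1.
  have d1 := hterm_dominated (z + w) t0 bu.
  have d2 := hterm_dominated z t0 bu.
  (* The derivative series re-indexed to match the terms of [hser u]. At [k = 0] the factor [k]
     annihilates the power with the truncated exponent [k.-1]. *)
  pose a3 k := u k * (k%:R * z ^+ k.-1) / k`!%:R.
  have a3S k : a3 k.+1 = hterm (cshift u) z k.
    rewrite /a3 /hterm /cshift factS natrM /=; field.
    by rewrite nat1r !pnatr_eq0 -lt0n fact_gt0.
  have d3' := hterm_dominated z t0 (cgeo_bounded_cshift bu).
  have d3 : cdominated a3 (fun k => if k is k'.+1 then D * t * exp_coeff (t * normc z) k' else 0).
    split.
      by case=> [|k]; [rewrite /a3 mul0r mulr0 mul0r Normc.normc0|rewrite a3S; exact: d3'.1].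
    apply/cvg_ex; exists (limn (series (fun k => D * t * exp_coeff (t * normc z) k))).
    rewrite -cvg_shiftS.
    rewrite [X in X @ _ --> _](_ : _ = series (fun k => D * t * exp_coeff (t * normc z) k)).
      exact: cvg_scaled_exp.
    by apply/funext => n /=; rewrite !series_ord big_ord_recl add0r.
  have -> : hser (cshift u) z = csum a3.
    rewrite (csum_recl d3) {1}/a3 mul0r mulr0 mul0r add0r.
    by rewrite hser_csum; congr csum; apply/funext => k; rewrite a3S.
  have d12 := cdominated_lin (-1) d2 d1.
  have dall := cdominated_lin (- w) d3 d12.
  have -> : hser u (z + w) - hser u z - csum a3 * w =
      csum (fun k => - w * a3 k + (-1 * hterm u z k + hterm u (z + w) k)).
    rewrite (csum_lin (- w) d3 d12) (csum_lin (-1) d2 d1) !hser_csum.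
    by move: (csum (hterm u (z + w))) (csum (hterm u z)) (csum a3) => p q r; ring.
  have db : cdominated (fun k => - w * a3 k + (-1 * hterm u z k + hterm u (z + w) k))
      (fun k => D * normc w ^+ 2 * exp_coeff (t * (2 * (normc z + 1))) k).
    split; last exact: cvg_scaled_exp.
    move=> k.
    have -> : - w * a3 k + (-1 * hterm u z k + hterm u (z + w) k) =
        u k * ((z + w) ^+ k - z ^+ k - k%:R * z ^+ k.-1 * w) / k`!%:R.
      by rewrite /a3 /hterm; ring.
    rewrite !Normc.normcM Normc.normcV normc_natr exp_coeffE exprMn.
    rewrite !mulrA ler_wpM2r ?invr_ge0//.
    apply: (@le_trans _ _ ((D * t ^+ k) * ((2 * (normc z + 1)) ^+ k * normc w ^+ 2))).
      by apply: ler_pM; rewrite ?normc_ge0//; exact: power_increment_le.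
    by apply/eq_ler; ring.
  apply: le_trans (csum_le db) _.
  rewrite lim_series_scale; last exact: is_cvg_series_exp_coeff.
  rewrite -/(expR _) /K; apply/eq_ler; ring.
move=> e e0; have K1 : 0 < K + 1 by rewrite ltr_wpDl.
exists (Num.min 1 (e / (K + 1))); first by rewrite lt_min ltr01 divr_gt0.
move=> w; rewrite lt_min => /andP[w1 we].
apply: le_trans (main w (ltW w1)) _; rewrite expr2 mulrA ler_wpM2r ?normc_ge0//.
apply: (@le_trans _ _ ((K + 1) * normc w)); first by rewrite ler_wpM2r ?normc_ge0// lerDl.
by rewrite mulrC -ler_pdivlMr// ltW.
Qed.

Lemma entire_hser {D t u} (A : set C) : 0 <= t -> cgeo_bounded D t u -> holomorphic_on A (hser u).
Proof. by move=> t0 bu z _; exact: cdiff_derivable (cdiff_hser z t0 bu). Qed.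

End ComplexSeries.

(** * Exponential type below [alpha] in terms of coefficients *)

Section ExponentialTypeClass.
Context {R : realType}.
Local Notation C := R[i].
Implicit Types (z w : C) (x y t : R) (u v : nat -> C) (alpha : R).

Lemma powR_le_linear (c e : R) : 0 < c < 1 -> 0 < e ->
  exists M : R, forall r, M <= r -> r `^ c <= e * r.
Proof.
move=> /andP[c0 c1] e0; exists (Num.max 1 ((e^-1) `^ ((1 - c)^-1))) => r.
rewrite ge_max => /andP[r1 rM].
have r0 : 0 < r by exact: lt_le_trans r1.
have c10 : 0 < 1 - c by rewrite subr_gt0.
have h : e^-1 <= r `^ (1 - c).
  have -> : e^-1 = (e^-1 `^ (1 - c)^-1) `^ (1 - c).
    by rewrite -powRrM mulVf ?gt_eqF// powRr1// invr_ge0 ltW.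
  by rewrite ge0_ler_powR ?nnegrE ?powR_ge0 ?(ltW r0)// ltW.
have E : r `^ c * r `^ (1 - c) = r.
  by rewrite -powRD ?(gt_eqF r0) ?implybT// addrC subrK powRr1// ltW.
rewrite -{2}E mulrCA ler_peMr ?powR_ge0//.
by rewrite mulrC -ler_pdivrMr// mul1r.
Qed.

Lemma linear_lt_powR (c t K : R) : 1 < c -> 0 <= t ->
  exists M : R, forall r, M <= r -> K * expR (t * r) < expR (r `^ c).
Proof.
move=> c1 t0.
have c10 : 0 < c - 1 by rewrite subr_gt0.
exists (Num.max (1 + `|K|) ((t + 1) `^ (c - 1)^-1)) => r; rewrite ge_max => /andP[rK rt].
have r0 : 0 < r by apply: lt_le_trans rK; rewrite ltr_pwDl.
have h : t + 1 <= r `^ (c - 1).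
  have -> : t + 1 = ((t + 1) `^ (c - 1)^-1) `^ (c - 1).
    by rewrite -powRrM mulVf ?gt_eqF// powRr1// addr_ge0.
  by rewrite ge0_ler_powR ?nnegrE ?powR_ge0 ?(ltW r0)// ltW.
have E : r `^ c = r * r `^ (c - 1).
  by rewrite -{2}(powRr1 (ltW r0)) -powRD ?(gt_eqF r0) ?implybT// addrC subrK.
apply: (@lt_le_trans _ _ (expR ((t + 1) * r))); last first.
  by rewrite ler_expR E mulrC ler_wpM2l// ltW.
rewrite mulrDl expRD mul1r mulrC ltr_pM2l ?expR_gt0//.
apply: le_lt_trans (ler_norm K) _; apply: lt_le_trans (expR_ge1Dx r); lra.
Qed.

Lemma linear_lt_linear (c t K : R) : t < c ->
  exists M : R, forall r, M <= r -> K * expR (t * r) < expR (c * r).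
Proof.
move=> tc; have ct : 0 < c - t by rewrite subr_gt0.
exists (`|K| / (c - t)) => r; rewrite ler_pdivrMr// => rK.
have -> : c * r = t * r + r * (c - t) by ring.
rewrite expRD mulrC ltr_pM2l ?expR_gt0//.
apply: le_lt_trans (ler_norm K) _; apply: lt_le_trans (expR_ge1Dx _); lra.
Qed.

Lemma Vexp_geo_bounded alpha h : 0 < alpha -> Vexp alpha h ->
  exists t D u, [/\ 0 < t, t < alpha, cgeo_bounded D t u &
    forall x, hser u (ofR x) = h (ofR x)].
Proof.
move=> al0 [eh exph].
have dh z : cdable h z by apply: derivable_cdiff; exact: eh.
suff [t [t' [M [t0 tt ta hM]]]] : exists t t' M, [/\ 0 < t, t < t', t' < alpha &
    forall z, M <= normc z -> normc (h z) <= 1 * expR (t * normc z)].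
  have [u [D [bu hu]]] := entire_exp_power h t t' 1 M dh t0 tt hM.
  by exists t', D, u; split => //; exact: lt_trans tt.
case: exph => [|[ord1]].
  (* Order below 1: the power [|z| ^ c] falls below any positive multiple of [|z|]. The function
     gets the rate [alpha / 3], its coefficients the larger rate [alpha / 2]. *)
  move=> /ereal_inf_lt[_ [c [c0 [M hM]] <-]]; rewrite lte_fin => c1.
  have c01 : 0 < c < 1 by rewrite c0.
  have a3 : 0 < alpha / 3 by rewrite divr_gt0.
  have [M' hM'] := powR_le_linear c (alpha / 3) c01 a3.
  exists (alpha / 3), (alpha / 2), (Num.max M M'); split => //; try lra.
  move=> z; rewrite ge_max mul1r => /andP[zM zM'].
  by apply: le_trans (ltW (hM z zM)) _; rewrite ler_expR; exact: hM'.
move=> /ereal_inf_lt[_ [c [c0 [M hM]] <-]]; rewrite lte_fin => ca.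
exists c, ((c + alpha) / 2), M; split => //; try lra.
move=> z /hM; rewrite ord1 /= powRr1 ?normc_ge0// mul1r; exact: ltW.
Qed.

(** The factor [2 * D] and the strict inequalities in [growth_order] and [growth_type] are paid for
    by a little more growth: exponent [1 + e] for the order, the midpoint of [t] and [alpha] for the
    type. *)
Lemma Vexp_hser alpha t D u : 0 <= t -> t < alpha -> cgeo_bounded D t u ->
  Vexp alpha (hser u).
Proof.
move=> t0 ta bu; split; first exact: entire_hser bu.
have hle z := hser_le z t0 bu.
have ord1 : (growth_order (hser u) <= 1)%E.
  apply/lee_addgt0Pr => e e0; apply: ereal_inf_lbound.
  exists (1 + e); last by rewrite EFinD.
  split; first by rewrite addr_gt0.
  have [|M hM] := linear_lt_powR (1 + e) t (2 * D) _ t0; first by rewrite ltrDl.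
  exists M => z zM; apply: le_lt_trans (hle z) _; exact: hM.
move: ord1; rewrite le_eqVlt => /orP[/eqP o1|]; last by left.
right; split => //.
pose c := (t + alpha) / 2.
have tc : t < c by rewrite /c; lra.
apply: (@le_lt_trans _ _ c%:E); last by rewrite lte_fin /c; lra.
apply: ereal_inf_lbound; exists c => //; split; first exact: le_lt_trans tc.
have [M hM] := linear_lt_linear c t (2 * D) tc.
exists M => z zM; rewrite o1 /= powRr1 ?normc_ge0//.
by apply: le_lt_trans (hle z) _; exact: hM.
Qed.

Lemma Vstar_geo_bounded (S : set R) alpha t D u : 0 <= t -> t < alpha ->
  cgeo_bounded D t u -> Vstar S (Vexp alpha) u.
Proof.
move=> t0 ta bu; split.
  exists 1, (hser u); split => //; first exact: entire_hser bu.
  by move=> z _; split=> //; exact: habs_cvg_geo bu.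
exists (hser u); first exact: Vexp_hser bu.
by move=> z; split=> //; exact: habs_cvg_geo bu.
Qed.

Lemma Sstar_geo_bounded (S : set R) t D u : 0 <= t -> cgeo_bounded D t u -> Sstar S u.
Proof.
move=> t0 bu; exists 1, (hser u); split => //; first exact: entire_hser bu.
by move=> z _; split=> //; exact: habs_cvg_geo bu.
Qed.

(** [c 0] is read off at 0, then the series is divided by [x]. The quotient is known to vanish only
    away from 0; at 0 its value is minus its tail at a small [x'], which is at most [x'] times the
    sum of the [|c k.+2|]. *)
Lemma power_series_unique (c : nat -> R) : (forall x, cvgn (series (fun k => `|c k * x ^+ k|))) ->
  (forall x, limn (series (fun k => c k * x ^+ k)) = 0) -> forall k, c k = 0.
Proof.
move=> cc c0 k; elim: k c cc c0 => [|k IH] c cc c0.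
  have := c0 0; rewrite (lim_series_fin 1).
    by rewrite big_ord1 expr0 mulr1.
  by move=> [//|n] _; rewrite expr0n mulr0.
have cx x : cvgn (series (fun k => c k * x ^+ k)) by apply: (dom_cvg _ (cc x)).
have h0 : c 0%N = 0.
  have := c0 0; rewrite (lim_series_fin 1).
    by rewrite big_ord1 expr0 mulr1.
  by move=> [//|n] _; rewrite expr0n mulr0.
have cc1 x : cvgn (series (fun k => `|c k.+1 * x ^+ k|)).
  have [->|x0] := eqVneq x 0.
    by apply: (@cvg_series_fin _ _ 1) => -[//|n] _; rewrite expr0n mulr0 normr0.
  have -> : (fun k => `|c k.+1 * x ^+ k|) = (fun k => `|x|^-1 * `|c (1 + k)%N * x ^+ (1 + k)|).
    apply/funext => n; rewrite add1n exprS !normrM; field.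
    by rewrite normr_eq0.
  by apply: cvg_series_scale; exact: (is_cvg_drop 1 (cc x)).
have c1x x : cvgn (series (fun k => c k.+1 * x ^+ k)) by apply: (dom_cvg _ (cc1 x)).
have nz x : x != 0 -> limn (series (fun k => c k.+1 * x ^+ k)) = 0.
  move=> x0; apply: (mulfI x0); rewrite mulr0 -lim_series_scale//.
  have := lim_drop 1 (cx x); rewrite c0 series_ord big_ord1 h0 mul0r subr0 => <-.
  by congr (limn (series _)); apply/funext => n; rewrite add1n exprS; ring.
apply: (IH (fun n => c n.+1)) => // x; have [->|] := eqVneq x 0; last exact: nz.
rewrite (lim_series_fin 1); last by move=> [//|n] _; rewrite expr0n mulr0.
rewrite big_ord1 expr0 mulr1.
apply/eqP; rewrite -normr_le0.
have cK : cvgn (series (fun k => `|c k.+2|)).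
  have -> : (fun k => `|c k.+2|) = (fun k => `|c (1 + k).+1 * 1 ^+ (1 + k)|).
    by apply/funext => n; rewrite add1n expr1n mulr1.
  exact: (is_cvg_drop 1 (cc1 1)).
apply: (@small_mul_le0 _ (limn (series (fun k => `|c k.+2|)))).
  by apply: le_trans (series_ge0_le_lim 0 _ cK) => //; rewrite series_ord big_ord0.
move=> e e0; pose x' := Num.min e 1.
have x'0 : 0 < x' by rewrite lt_min e0 ltr01.
have x'1 : x' <= 1 by rewrite ge_min lexx orbT.
have := nz x' (lt0r_neq0 x'0).
have := lim_drop 1 (c1x x'); rewrite series_ord big_ord1 expr0 mulr1 => /[swap] ->.
rewrite sub0r => E; rewrite -normrN -E.
have dm j : `|c (1 + j).+1 * x' ^+ (1 + j)| <= x' * `|c j.+2|.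
  rewrite add1n normrM normrX (ger0_norm (ltW x'0)) exprS mulrC -mulrA ler_wpM2l ?(ltW x'0)//.
  by rewrite ler_piMl// exprn_ile1// ltW.
apply: le_trans (dom_lim dm (cvg_series_scale _ cK)) _.
rewrite lim_series_scale// ler_wpM2r//.
  by apply: le_trans (series_ge0_le_lim 0 _ cK) => //; rewrite series_ord big_ord0.
by rewrite ge_min lexx.
Qed.

(** Cauchy's estimate bounds the coefficients [v] of [h]. As [hser u] and [hser v] agree on the real
    line, [u] equals [v] and inherits the bound. *)
Lemma geo_Vstar (S : set R) alpha u : 0 < alpha -> Vstar S (Vexp alpha) u ->
  exists t D, [/\ 0 < t, t < alpha & cgeo_bounded D t u].
Proof.
move=> al0 [_ [h Vh hu]].
have [t [D [v [t0 ta bv hv]]]] := Vexp_geo_bounded alpha h al0 Vh.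
exists t, D; split => //.
have hterm_real (w : nat -> C) x k : hterm w (ofR x) k = w k * ofR (x ^+ k / k`!%:R).
  rewrite /hterm -ofRX -mulrA; congr (_ * _).
  by rewrite -ofR_nat !ofRE -fmorphV -rmorphM.
suff E k : Re (u k) = Re (v k) /\ Im (u k) = Im (v k).
  by move=> k; have [E1 E2] := E k; rewrite (complexP _ _ E1 E2); exact: bv.
have su x : hser u (ofR x) = hser v (ofR x) by rewrite hv; case: (hu (ofR x)).
have du x : cdominated (hterm u (ofR x)) (fun k => normc (hterm u (ofR x) k)).
  by split => //; case: (hu (ofR x)).
have dv x : cdominated (hterm v (ofR x)) (fun k => D * exp_coeff (t * normc (ofR x)) k).
  by apply: hterm_dominated => //; exact: ltW.
have key (Q : C -> R) : (forall z, `|Q z| <= normc z) ->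
    (forall z w, Q (z - w) = Q z - Q w) -> (forall z x, Q (z * ofR x) = Q z * x) ->
    (forall x, limn (series (fun k => Q (hterm u (ofR x) k))) =
               limn (series (fun k => Q (hterm v (ofR x) k)))) ->
    forall k, Q (u k) = Q (v k).
  move=> Q1 Q2 Q3 Q4 j.
  have cu x : cvgn (series (fun k => `|Q (hterm u (ofR x) k)|)).
    by apply: (dom_cvg _ (du x).2) => i; rewrite normr_id; exact: Q1.
  have cv x : cvgn (series (fun k => `|Q (hterm v (ofR x) k)|)).
    apply: (dom_cvg _ (dv x).2) => i; rewrite normr_id; apply: le_trans (Q1 _) _; exact: (dv x).1.
  have TE x i : (Q (u i) - Q (v i)) / i`!%:R * x ^+ i = -1 * Q (hterm v (ofR x) i) + Q (hterm u (ofR x) i).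
    by rewrite !hterm_real !Q3; ring.
  have := @power_series_unique (fun k => (Q (u k) - Q (v k)) / k`!%:R).
  move=> /(_ _ _ j)/eqP; rewrite mulf_eq0 invr_eq0 pnatr_eq0 -[_ == 0%N]negbK -lt0n fact_gt0 orbF.
  rewrite subr_eq0 => H; apply/eqP/H => x.
  - apply: (dom_cvg _ (cvg_series_lin 1 (cv x) (cu x))) => i.
    by rewrite normr_id TE (le_trans (ler_normD _ _))// normrM normrN1 mul1r.
  - under eq_fun do rewrite TE.
    have cu' : cvgn (series (fun k => Q (hterm u (ofR x) k))) by apply: (dom_cvg _ (cu x)).
    have cv' : cvgn (series (fun k => Q (hterm v (ofR x) k))) by apply: (dom_cvg _ (cv x)).
    by rewrite lim_series_lin// mulN1r Q4 addNr.
split; apply: key.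
- exact: normc_Re.
- by move=> z w; rewrite cReD cReN.
- by move=> z x; rewrite cReMr.
- move=> x; have := su x; rewrite !hser_csum (csumE (du x)) (csumE (dv x)).
  by move=> -[].
- exact: normc_Im.
- by move=> z w; rewrite cImD cImN.
- by move=> z x; rewrite cImMr.
- move=> x; have := su x; rewrite !hser_csum (csumE (du x)) (csumE (dv x)).
  by move=> -[].
Qed.

End ExponentialTypeClass.

(** * The generator on power series *)

Section RealIntegral.
Context {d : measure_display} {T : measurableType d} {R : realType}.
Variables (mu : {measure set T -> \bar R}) (D : set T).
Hypothesis mD : measurable D.
Implicit Types (f g : T -> R).

Lemma dominated_integrable {f g} : measurable_fun D f ->
  (forall x, D x -> `|f x| <= g x) -> mu.-integrable D (EFin \o g) ->
  mu.-integrable D (EFin \o f).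
Proof.
move=> mf fg ig; apply: le_integrable ig => //; first exact/measurable_EFinP.
by move=> x Dx /=; exact: le_trans (fg x Dx) (ler_norm _).
Qed.

Lemma dominated_Rintegral_le {f g} : measurable_fun D f ->
  (forall x, D x -> `|f x| <= g x) -> mu.-integrable D (EFin \o g) ->
  `|(\int[mu]_(x in D) f x)%R| <= (\int[mu]_(x in D) g x)%R.
Proof.
move=> mf fg ig; have if_ := dominated_integrable mf fg ig.
apply: le_trans (le_normr_Rintegral mD if_) _; apply: le_Rintegral => //.
apply: dominated_integrable ig.
  by apply: measurableT_comp.
by move=> x Dx; rewrite normr_id; exact: fg.
Qed.

Lemma integrable_combination {f g} (k : R) : mu.-integrable D (EFin \o f) ->
  mu.-integrable D (EFin \o g) -> mu.-integrable D (EFin \o (fun x => k * f x + g x)).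
Proof.
move=> if_ ig.
have := integrableD mD (integrableZl mD k if_) ig.
by congr (integrable _ _ _); apply/funext.
Qed.

Lemma Rintegral_combination {f g} (k : R) : mu.-integrable D (EFin \o f) ->
  mu.-integrable D (EFin \o g) ->
  (\int[mu]_(x in D) (k * f x + g x) =
   k * \int[mu]_(x in D) f x + \int[mu]_(x in D) g x)%R.
Proof.
move=> if_ ig.
have ikf : mu.-integrable D (EFin \o (fun x => k * f x)).
  have := integrableZl mD k if_.
  by congr (integrable _ _ _); apply/funext.
by rewrite RintegralD// RintegralZl.
Qed.

Lemma integrable_zero : mu.-integrable D (EFin \o (fun=> 0 : R)).
Proof. exact: integrable0. Qed.

Lemma integrable_bigsum (F : nat -> T -> R) N :
  (forall n, mu.-integrable D (EFin \o F n)) ->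
  mu.-integrable D (EFin \o (fun x => \sum_(n < N) F n x)).
Proof.
move=> iF; elim: N => [|N IH].
  have := integrable_zero; congr (integrable _ _ _).
  by apply/funext => x /=; rewrite big_ord0.
have := integrable_combination 1 (iF N) IH; congr (integrable _ _ _).
by apply/funext => x /=; rewrite big_ord_recr/= mul1r addrC.
Qed.

Lemma Rintegral_bigsum (F : nat -> T -> R) N :
  (forall n, mu.-integrable D (EFin \o F n)) ->
  (\int[mu]_(x in D) (\sum_(n < N) F n x) = \sum_(n < N) \int[mu]_(x in D) F n x)%R.
Proof.
move=> iF; elim: N => [|N IH].
  under eq_Rintegral do rewrite big_ord0.
  by rewrite big_ord0 Rintegral_cst// mul0r.
rewrite big_ord_recr/= -IH addrC -[X in X + _]mul1r -Rintegral_combination//.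
  by apply: eq_Rintegral => x _; rewrite big_ord_recr/= mul1r addrC.
exact: integrable_bigsum.
Qed.

Lemma Rintegral_dominated_cvg (F : nat -> T -> R) f g :
  (forall n, measurable_fun D (F n)) ->
  (forall x, D x -> (fun n => F n x) @ \oo --> f x) ->
  mu.-integrable D (EFin \o g) -> (forall n x, D x -> `|F n x| <= g x) ->
  mu.-integrable D (EFin \o f) /\
  (fun n => \int[mu]_(x in D) F n x)%R @ \oo --> (\int[mu]_(x in D) f x)%R.
Proof.
move=> mF Ff ig Fg.
have mf : measurable_fun D f by apply: (measurable_fun_cvg mF).
have fg x : D x -> `|f x| <= g x.
  move=> Dx; have c : (fun n => `|F n x|) @ \oo --> `|f x| by apply: cvg_norm; exact: Ff.
  rewrite -(cvg_lim _ c)//; apply: limr_le; first by apply/cvg_ex; exists `|f x|.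
  by near=> n; exact: Fg.
have if_ := dominated_integrable mf fg ig.
split => //.
have := @dominated_cvg _ _ _ mu D mD (fun n => EFin \o F n) (EFin \o f) (EFin \o g).
move=> /(_ (fun n => (measurable_EFinP _ _).2 (mF n))) H.
have : (\int[mu]_(x in D) (F n x)%:E)%E @[n --> \oo] --> (\int[mu]_(x in D) (f x)%:E)%E.
  apply: H ig _.
  - by move=> x Dx; apply: cvg_comp; [exact: Ff|exact: cvg_id].
  - by [].
  - by move=> n x Dx /=; rewrite lee_fin; exact: Fg.
have iF n : mu.-integrable D (EFin \o F n).
  by apply: dominated_integrable (mF n) _ ig => x Dx; exact: Fg.
have -> : (\int[mu]_(x in D) (f x)%:E)%E = (\int[mu]_(x in D) f x)%R%:E.
  by rewrite fineK//; exact: integrable_fin_num.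
by move=> /fine_cvgP[_].
Unshelve. all: by end_near. Qed.

End RealIntegral.

(** * Termwise integration under an exponential majorant *)

Section ExponentialMoments.
Context {d : measure_display} {T : measurableType d} {R : realType}.
Variables (mu : {measure set T -> \bar R}) (Y : T -> R) (W : T -> R) (A : R) (n0 : nat).
Hypothesis A0 : 0 < A.
Hypothesis mY : measurable_fun setT Y.
Hypothesis iW : mu.-integrable setT (EFin \o W).

(* For the Levy measure [n0 = 2], as the generator compensates the terms of order
   0 and 1; for the law of an increment [n0 = 0]. *)
Definition taylor_term n (y : R) : R := if (n0 <= n)%N then y ^+ n / n`!%:R else 0.

Hypothesis domW : forall N w, \sum_(n < N) taylor_term n (A * `|Y w|) <= W w.

Definition moment n := (\int[mu]_w taylor_term n (Y w))%R.

Lemma taylor_term_ge0 n (y : R) : 0 <= y -> 0 <= taylor_term n y.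
Proof. by move=> y0; rewrite /taylor_term; case: ifP => // _; rewrite divr_ge0// exprn_ge0. Qed.

Lemma taylor_term_norm n (y : R) : `|taylor_term n y| = taylor_term n `|y|.
Proof.
rewrite /taylor_term; case: ifP => _; last by rewrite normr0.
by rewrite normrM normrX normfV [`|_%:R|]ger0_norm.
Qed.

Lemma taylor_term_scale n (c y : R) : taylor_term n (c * y) = c ^+ n * taylor_term n y.
Proof. by rewrite /taylor_term; case: ifP => _; rewrite ?mulr0// exprMn mulrA. Qed.

Lemma measurable_taylor_term n : measurable_fun setT (fun w => taylor_term n (Y w)).
Proof.
rewrite /taylor_term; case: (n0 <= n)%N; last exact: measurable_cst.
by apply: measurable_funM; [exact: measurable_funX|exact: measurable_cst].
Qed.

Lemma taylor_sum_le (F : nat -> R) (C : R) N w : geo_bounded C A F ->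
  `|\sum_(n < N) F n * taylor_term n (Y w)| <= C * W w.
Proof.
move=> bF; apply: le_trans (ler_norm_sum _ _ _) _.
apply: (@le_trans _ _ (C * \sum_(n < N) taylor_term n (A * `|Y w|))); last first.
  by rewrite ler_wpM2l ?(geo_bounded_ge0 bF).
rewrite mulr_sumr; apply: ler_sum => n _.
by rewrite normrM taylor_term_norm taylor_term_scale mulrA ler_wpM2r ?taylor_term_ge0.
Qed.

Lemma taylor_term_integrable n : mu.-integrable setT (EFin \o (fun w => taylor_term n (Y w))).
Proof.
have iAW : mu.-integrable setT (EFin \o (fun w => A ^- n * W w)).
  have := integrableZl measurableT (A ^- n) iW.
  by congr (integrable _ _ _); apply/funext.
apply: (dominated_integrable _ _ measurableT (measurable_taylor_term n) _ iAW) => w _.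
rewrite taylor_term_norm mulrC ler_pdivlMr ?exprn_gt0// mulrC -taylor_term_scale.
apply: le_trans (domW n.+1 w); rewrite big_ord_recr/= lerDr.
by apply: sumr_ge0 => i _; rewrite taylor_term_ge0// mulr_ge0// ltW.
Qed.

Lemma moment_norm N : \sum_(n < N) `|moment n| * A ^+ n <= (\int[mu]_w W w)%R.
Proof.
have iN n : mu.-integrable setT (EFin \o (fun w => taylor_term n (A * `|Y w|))).
  have := integrableZl measurableT (A ^+ n) (integrable_abse (taylor_term_integrable n)).
  congr (integrable _ _ _); apply/funext => w /=.
  by rewrite taylor_term_norm taylor_term_scale.
apply: (@le_trans _ _ (\sum_(n < N) \int[mu]_w taylor_term n (A * `|Y w|))%R); last first.
  rewrite -(@Rintegral_bigsum _ _ _ mu setT measurableT (fun n w => taylor_term n (A * `|Y w|)))//; apply: le_Rintegral => //.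
  exact: (@integrable_bigsum _ _ _ mu setT measurableT (fun n w => taylor_term n (A * `|Y w|))).
apply: ler_sum => n _.
have -> : (\int[mu]_w taylor_term n (A * `|Y w|) = \int[mu]_w `|taylor_term n (Y w)| * A ^+ n)%R.
  rewrite -RintegralZr//; last by have := integrable_abse (taylor_term_integrable n).
  by apply: eq_Rintegral => w _; rewrite taylor_term_norm taylor_term_scale mulrC.
by rewrite ler_wpM2r ?exprn_ge0 ?(ltW A0)// le_normr_Rintegral//; exact: taylor_term_integrable.
Qed.

(** Dominated convergence with majorant [C * W]: the weight [A ^ n] that bounds [F n] is exactly the
    scaling of the [n]-th term in [domW]. *)
Lemma moment_series (F : nat -> R) (C : R) (g : T -> R) : geo_bounded C A F ->
  (forall w, (fun N => \sum_(n < N) F n * taylor_term n (Y w)) @ \oo --> g w) ->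
  mu.-integrable setT (EFin \o g) /\
  (\int[mu]_w g w)%R = limn (series (fun n => moment n * F n)).
Proof.
move=> bF cg.
have iCW : mu.-integrable setT (EFin \o (fun w => C * W w)).
  have := integrableZl measurableT C iW.
  by congr (integrable _ _ _); apply/funext.
have iT n : mu.-integrable setT (EFin \o (fun w => F n * taylor_term n (Y w))).
  have := integrableZl measurableT (F n) (taylor_term_integrable n).
  by congr (integrable _ _ _); apply/funext.
have [| |ig cI] := @Rintegral_dominated_cvg _ _ _ mu setT measurableT
  (fun N w => \sum_(n < N) F n * taylor_term n (Y w)) g _ _ (fun w _ => cg w) iCW.
- move=> N; apply: measurable_sum => n.
  by apply: measurable_funM; [exact: measurable_cst|exact: measurable_taylor_term].
- by move=> N w _; exact: taylor_sum_le.
split => //; apply/esym/cvg_lim => //.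
have -> : series (fun n => moment n * F n) =
    (fun N => \int[mu]_w (\sum_(n < N) F n * taylor_term n (Y w)))%R.
  apply/funext => N; rewrite series_ord.
  rewrite (@Rintegral_bigsum _ _ _ mu setT measurableT (fun n w => F n * taylor_term n (Y w)))//.
  apply: eq_bigr => n _.
  by rewrite RintegralZl//; [rewrite mulrC|exact: taylor_term_integrable].
exact: cI.
Qed.

End ExponentialMoments.

(** * The Levy symbol and the generator on real series *)

Section LevyGenerator.
Context {R : realType}.
Variables (b a alpha : R) (nu : {measure set (measurableTypeR R) -> \bar R}).
Hypothesis alpha_gt0 : 0 < alpha.
Hypothesis nu_levy : levy_measure nu.
Hypothesis exp_moment :
  (\int[nu]_(y in [set y : R | (1 < `|y|)%R]) (expR (alpha * `|y|))%:E < +oo)%E.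
Implicit Types (u : nat -> R) (x y t D : R).

Let big : set (measurableTypeR R) := [set y : R | 1 < `|y|].

(** For [|y| <= 1] the terms of order at least 2 of [exp (alpha |y|)] sum to at most [exp alpha]
    times [y ^ 2]; for [|y| > 1] the exponential itself is taken. The minimum makes the first
    summand integrable at infinity as well. *)
Definition levy_majorant (y : measurableTypeR R) : R :=
  expR alpha * Num.min `|y| (`|y| ^+ 2) + expR (alpha * `|y|) * \1_big y.
Local Notation W := levy_majorant.

Let measurable_big : measurable big.
Proof.
rewrite /big; have -> : [set y : R | 1 < `|y|] = (fun y : R => `|y|) @^-1` `]1, +oo[%classic.
  by apply/seteqP; split => y /=; rewrite in_itv/= andbT.
rewrite -[X in measurable X]setTI; apply: (@normr_measurable R setT) => //.
Qed.

Lemma levy_majorant_integrable : nu.-integrable setT (EFin \o W).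
Proof.
have mmin : measurable_fun setT (fun y : measurableTypeR R => Num.min `|y| (`|y| ^+ 2)).
  by apply: measurable_minr; [|apply: measurable_funX]; exact: normr_measurable.
have mexp : measurable_fun setT (fun y : measurableTypeR R => expR (alpha * `|y|)).
  by apply: measurableT_comp => //; apply: measurable_funM => //; exact: normr_measurable.
have min0 (y : R) : 0 <= Num.min `|y| (`|y| ^+ 2) by rewrite le_min normr_ge0 sqr_ge0.
apply: (integrable_combination nu setT measurableT).
  apply/integrableP; split; first exact/measurable_EFinP.
  rewrite (eq_integral (fun y : measurableTypeR R => (Num.min `|y| (`|y| ^+ 2))%:E)); first by case: nu_levy.
  by move=> y _ /=; rewrite ger0_norm.
apply/integrableP; split.
  by apply/measurable_EFinP; apply: measurable_funM.
rewrite (eq_integral ((fun y : measurableTypeR R => (expR (alpha * `|y|))%:E) \_ big)); last first.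
  move=> y _; rewrite /patch /= indicE; case: ifP => _.
    by rewrite mulr1 ger0_norm// expR_ge0.
  by rewrite mulr0 normr0.
by rewrite -integral_mkcond.
Qed.

Lemma levy_majorantP N y : \sum_(n < N) taylor_term 2 n (alpha * `|y|) <= W y.
Proof.
have min0 : 0 <= Num.min `|y| (`|y| ^+ 2) by rewrite le_min normr_ge0 sqr_ge0.
have al0 := ltW alpha_gt0.
have sumexp (z : R) : 0 <= z -> \sum_(n < N) exp_coeff z n <= expR z.
  move=> z0; rewrite -(series_ord (exp_coeff z)); apply: series_ge0_le_lim.
    by move=> k; rewrite exp_coeff_ge0.
  exact: is_cvg_series_exp_coeff.
rewrite /W indicE; have [y1|y1] := leP `|y| 1; last first.
  rewrite mem_set//= mulr1; apply: (@le_trans _ _ (expR (alpha * `|y|))); last first.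
    by rewrite lerDr mulr_ge0 ?expR_ge0.
  apply: le_trans (sumexp _ _); last by rewrite mulr_ge0.
  apply: ler_sum => n _; rewrite /taylor_term; case: ifP => // _.
  by rewrite exp_coeff_ge0// mulr_ge0.
rewrite memNset/= ?mulr0 ?addr0; last by rewrite /big/= ltNge y1.
have -> : Num.min `|y| (`|y| ^+ 2) = `|y| ^+ 2.
  by apply/min_idPr; rewrite expr2 ler_piMl.
rewrite [expR _ * _]mulrC; apply: le_trans (ler_wpM2l (sqr_ge0 _) (sumexp _ al0)).
rewrite mulr_sumr; apply: ler_sum => n _; rewrite /taylor_term; case: ifP => n2; last first.
  by rewrite mulr_ge0 ?sqr_ge0 ?exp_coeff_ge0.
rewrite exp_coeffE exprMn mulrCA mulrA; rewrite ler_wpM2r ?invr_ge0//.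
rewrite ler_wpM2l ?exprn_ge0//.
by rewrite -(subnKC n2) exprD ler_piMr ?sqr_ge0 ?exprn_ile1.
Qed.

Definition levy_moment n : R := moment nu (idfun : measurableTypeR R -> R) 2 n.

(** The coefficients of [z ^ n] in [b z + a z ^ 2 / 2] plus the [nu]-integral of
    [exp (z y) - 1 - z y]. *)
Definition levy_symbol n : R :=
  (if n == 1%N then b else if n == 2 then a / 2 else 0) + levy_moment n.

Lemma levy_symbol0 : levy_symbol 0 = 0.
Proof.
rewrite /levy_symbol /= add0r /levy_moment /moment /taylor_term /=.
by rewrite Rintegral_cst// mul0r.
Qed.

Lemma levy_moment_norm N :
  \sum_(n < N) `|levy_moment n| * alpha ^+ n <= (\int[nu]_y W y)%R.
Proof.
exact: (@moment_norm _ _ _ nu idfun W alpha 2 alpha_gt0 (@measurable_id _ _ _)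
  levy_majorant_integrable levy_majorantP).
Qed.

Lemma levy_symbol_cvg : cvgn (series (fun n => `|levy_symbol n| * alpha ^+ n)).
Proof.
pose drift n : R := if n == 1%N then b else if n == 2 then a / 2 else 0.
have al0 := ltW alpha_gt0.
have c1 : cvgn (series (fun n => `|drift n| * alpha ^+ n)).
  by apply: (cvg_series_fin 3) => -[//|[//|[//|n]]] _; rewrite /drift /= normr0 mul0r.
have c2 : cvgn (series (fun n => `|levy_moment n| * alpha ^+ n)).
  by apply: (bounded_cvg_series _ _ levy_moment_norm) => k; rewrite mulr_ge0 ?exprn_ge0.
apply: (dom_cvg _ (cvg_series_lin 1 c1 c2)) => n.
rewrite ger0_norm ?mulr_ge0 ?exprn_ge0// mul1r -mulrDl ler_wpM2r ?exprn_ge0//.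
exact: ler_normD.
Qed.

Lemma rser_increment {C t : R} {F : nat -> R} (y : R) : 0 <= t -> geo_bounded C t F ->
  (fun N => \sum_(n < N) F n * taylor_term 2 n y) @ \oo --> rser F y - F 0%N - F 1%N * y.
Proof.
move=> t0 bF.
have := rser_cvg y t0 bF.
rewrite -[X in X -> _]/(cvgn _) => c.
rewrite -(cvg_shiftn 2).
have -> : (fun n => \sum_(i < n + 2) F i * taylor_term 2 i y) =
    (fun n => series (fun k => F k * y ^+ k / k`!%:R) (n + 2)%N - F 0%N - F 1%N * y).
  apply/funext => n; rewrite series_ord addn2 !big_ord_recl /=.
  rewrite /taylor_term /= !mulr0 !add0r expr0 expr1 !fact0 !divr1 mulr1.
  rewrite !addrA [F _ + _]addrC -!addrA; set s := \sum_(i < n) _.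
  set s' := \sum_(i < n) _.
  have -> : s = s' by apply: eq_bigr => i _; rewrite mulrA.
  rewrite addrC; ring.
apply: cvgB; last exact: cvg_cst.
apply: cvgB; last exact: cvg_cst.
by rewrite (cvg_shiftn 2).
Qed.

(** Around [x] the jump is a Taylor series starting at order 2, which [moment_series] integrates
    against [nu]; drift and diffusion add their share at orders 1 and 2. The result is the
    coefficient 0 of [opL] applied to the translated sequence. *)
Lemma real_generator {D t u} x : 0 <= t -> t <= alpha -> geo_bounded D t u ->
  let jump y := rser u (x + y) - rser u x - rser (shiftn 1 u) x * y in
  [/\ nu.-integrable setT (EFin \o (jump : measurableTypeR R -> R)),
      forall y, `|jump y| <= D * expR (t * `|x|) * W y &
      b * rser (shiftn 1 u) x + a / 2 * rser (shiftn 2 u) x + (\int[nu]_y jump y)%R =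
        rser (opL levy_symbol u) x].
Proof.
move=> t0 ta bu jump; set F := translate x u.
have bF := geo_bounded_translate x t0 bu.
have bFa := geo_bounded_le t0 ta bF.
have cj y : (fun N => \sum_(n < N) F n * taylor_term 2 n y) @ \oo --> jump y.
  have := rser_increment y t0 bF; rewrite /jump -/F (rserD x y t0 bu).
  by rewrite {2 3}/F /translate.
have [ij Ij] := @moment_series _ _ _ nu idfun W alpha 2 alpha_gt0 (@measurable_id _ _ _)
  levy_majorant_integrable levy_majorantP F _ jump bFa cj.
split => //.
  move=> y; have c : (fun N => `|\sum_(n < N) F n * taylor_term 2 n y|) @ \oo --> `|jump y|.
    exact: cvg_norm.
  have Hb N : `|\sum_(n < N) F n * taylor_term 2 n y| <= D * expR (t * `|x|) * W y.
    exact: (@taylor_sum_le _ (measurableTypeR R) R idfun W alpha 2 levy_majorantP F _ N y bFa).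
  rewrite -(cvg_lim _ c)//; apply: limr_le; first by apply/cvg_ex; exists `|jump y|.
  by near=> N.
rewrite (rser_opL _ _ alpha_gt0 levy_symbol_cvg x t0 ta bu) /opL -/F.
under [in RHS]eq_fun do rewrite addn0.
pose drift n : R := if n == 1%N then b else if n == 2 then a / 2 else 0.
have c1 : cvgn (series (fun n => drift n * F n)).
  by apply: (cvg_series_fin 3) => -[//|[//|[//|n]]] _; rewrite /drift /= mul0r.
have c2 : cvgn (series (fun n => levy_moment n * F n)).
  have al0 := ltW alpha_gt0.
  have cm : cvgn (series (fun n => `|levy_moment n| * alpha ^+ n)).
    by apply: (bounded_cvg_series _ _ levy_moment_norm) => k; rewrite mulr_ge0 ?exprn_ge0.
  apply: (dom_cvg _ (cvg_series_scale (D * expR (t * `|x|)) cm)) => n.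
  by rewrite normrM mulrCA ler_wpM2l//; exact: bFa.
have -> : (fun n => levy_symbol n * F n) = (fun n => 1 * (drift n * F n) + levy_moment n * F n).
  by apply/funext => n; rewrite /levy_symbol /drift mul1r mulrDl.
rewrite lim_series_lin// mul1r Ij; congr (_ + _).
rewrite (lim_series_fin 3); last by move=> -[//|[//|[//|n]]] _; rewrite /drift /= mul0r.
by rewrite !big_ord_recl big_ord0 /drift /= mul0r addr0 add0r.
Unshelve. all: by end_near. Qed.

End LevyGenerator.

(** * The generator on complex coefficient sequences *)

Section ComplexGenerator.
Context {R : realType}.
Local Notation C := R[i].
Implicit Types (u v : nat -> C) (x y s t D : R).

Definition Re_seq u : nat -> R := fun k => Re (u k).
Definition Im_seq u : nat -> R := fun k => Im (u k).

Definition pair_seq (p q : nat -> R) : nat -> C := fun k => Complex (p k) (q k).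

Lemma geo_bounded_pair {D E t} {p q : nat -> R} : geo_bounded D t p -> geo_bounded E t q ->
  cgeo_bounded (D + E) t (pair_seq p q).
Proof. by move=> bp bq; exact: (@cgeo_bounded_ReIm _ D E t (pair_seq p q) bp bq). Qed.

Lemma restrict_hser {D t u} : 0 <= t -> cgeo_bounded D t u ->
  restrictR (hser u) = fun x => Complex (rser (Re_seq u) x) (rser (Im_seq u) x).
Proof. by move=> t0 bu; apply/funext => x; exact: hser_ofR bu. Qed.

Lemma cderive1_pair (f g : R -> R) :
  cderive1 (fun x => Complex (f x) (g x)) = fun x => Complex (derive1 f x) (derive1 g x).
Proof. by []. Qed.

Lemma C2_real_rser {D t : R} {p : nat -> R} : 0 <= t -> geo_bounded D t p -> C2_real (rser p).
Proof.
move=> t0 bp; have bp1 := geo_bounded_shift 1 bp; have bp2 := geo_bounded_shift 1 bp1.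
split.
- by move=> x; case: (is_derive_rser x t0 bp).
- by move=> x; rewrite (derive1_rser t0 bp); case: (is_derive_rser x t0 bp1).
- by rewrite (derive1_rser t0 bp) (derive1_rser t0 bp1); exact: continuous_rser bp2.
Qed.

Lemma C2_hser {D t u} : 0 <= t -> cgeo_bounded D t u -> C2 (restrictR (hser u)).
Proof.
move=> t0 bu; rewrite (restrict_hser t0 bu); split => /=.
  exact: C2_real_rser t0 (cgeo_bounded_Re bu).
exact: C2_real_rser t0 (cgeo_bounded_Im bu).
Qed.

Variables (b a alpha : R) (nu : {measure set (measurableTypeR R) -> \bar R}).
Hypothesis alpha_gt0 : 0 < alpha.
Hypothesis nu_levy : levy_measure nu.
Hypothesis exp_moment :
  (\int[nu]_(y in [set y : R | (1 < `|y|)%R]) (expR (alpha * `|y|))%:E < +oo)%E.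
Local Notation lam := (levy_symbol b a nu).
Local Notation Lam := (symbol_norm lam alpha).
Let lam_cvg := levy_symbol_cvg b a alpha nu alpha_gt0 nu_levy exp_moment.

Definition levy_operator u : nat -> C := pair_seq (opL lam (Re_seq u)) (opL lam (Im_seq u)).

Definition levy_semigroup s u : nat -> C := pair_seq (semi lam s (Re_seq u)) (semi lam s (Im_seq u)).

Lemma jump_increment_hser {D t u} x y : 0 <= t -> cgeo_bounded D t u ->
  jump_increment (restrictR (hser u)) x y =
  Complex (rser (Re_seq u) (x + y) - rser (Re_seq u) x - rser (shiftn 1 (Re_seq u)) x * y)
          (rser (Im_seq u) (x + y) - rser (Im_seq u) x - rser (shiftn 1 (Im_seq u)) x * y).
Proof.
move=> t0 bu; rewrite /jump_increment (restrict_hser t0 bu) cderive1_pair.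
rewrite (derive1_rser t0 (cgeo_bounded_Re bu)) (derive1_rser t0 (cgeo_bounded_Im bu)).
by apply: complexP; rewrite ?cReD ?cImD ?cReN ?cImN ?cReMr ?cImMr.
Qed.

Lemma generator_hser {D t u} x : 0 <= t -> t <= alpha -> cgeo_bounded D t u ->
  generator b a nu (restrictR (hser u)) x =
  Complex (rser (opL lam (Re_seq u)) x) (rser (opL lam (Im_seq u)) x).
Proof.
move=> t0 ta bu; have bR := cgeo_bounded_Re bu; have bI := cgeo_bounded_Im bu.
rewrite /generator.
rewrite (funext (fun y => jump_increment_hser x y t0 bu)).
rewrite (restrict_hser t0 bu) !cderive1_pair.
rewrite (derive1_rser t0 bR) (derive1_rser t0 bI).
rewrite (derive1_rser t0 (geo_bounded_shift 1 bR)) (derive1_rser t0 (geo_bounded_shift 1 bI)).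
have [_ _ <-] := real_generator b a alpha nu alpha_gt0 nu_levy exp_moment x t0 ta bR.
have [_ _ <-] := real_generator b a alpha nu alpha_gt0 nu_levy exp_moment x t0 ta bI.
by apply: complexP; rewrite ?cReD ?cImD ?cReMl ?cImMl.
Qed.

Lemma levy_operator_bounded {D t u} : 0 <= t -> t <= alpha -> cgeo_bounded D t u ->
  cgeo_bounded (Lam * D + Lam * D) t (levy_operator u).
Proof.
move=> t0 ta bu; apply: geo_bounded_pair.
  exact: (geo_bounded_opL _ _ alpha_gt0 lam_cvg t0 ta (cgeo_bounded_Re bu)).
exact: (geo_bounded_opL _ _ alpha_gt0 lam_cvg t0 ta (cgeo_bounded_Im bu)).
Qed.

Lemma levy_semigroup_bounded {D t u} s : 0 <= t -> t <= alpha -> cgeo_bounded D t u ->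
  cgeo_bounded (D * expR (Lam * `|s|) + D * expR (Lam * `|s|)) t (levy_semigroup s u).
Proof.
move=> t0 ta bu; apply: geo_bounded_pair.
  exact: (geo_bounded_semi _ _ alpha_gt0 lam_cvg s t0 ta (cgeo_bounded_Re bu)).
exact: (geo_bounded_semi _ _ alpha_gt0 lam_cvg s t0 ta (cgeo_bounded_Im bu)).
Qed.

Lemma generator_levy_operator {D t u} x : 0 <= t -> t <= alpha -> cgeo_bounded D t u ->
  generator b a nu (restrictR (hser u)) x = hser (levy_operator u) (ofR x).
Proof.
move=> t0 ta bu; rewrite (generator_hser x t0 ta bu).
by rewrite (hser_ofR x t0 (levy_operator_bounded t0 ta bu)).
Qed.

Lemma levy_operator_lin {D E t u v} (k : C) : 0 <= t -> t <= alpha ->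
  cgeo_bounded D t u -> cgeo_bounded E t v ->
  levy_operator (fun n => k * u n + v n) = fun n => k * levy_operator u n + levy_operator v n.
Proof.
move=> t0 ta bu bv; apply/funext => n.
have [uR uI] := (cgeo_bounded_Re bu, cgeo_bounded_Im bu).
have [vR vI] := (cgeo_bounded_Re bv, cgeo_bounded_Im bv).
have lin := fun C D p q c => @opL_lin R lam alpha alpha_gt0 lam_cvg C D t p q c t0 ta.
have E1 : Re_seq (fun n => k * u n + v n) =
    (fun n => Re k * Re_seq u n + (- Im k * Im_seq u n + Re_seq v n)).
  by apply/funext => j; rewrite /Re_seq /Im_seq cReD cReM; ring.
have E2 : Im_seq (fun n => k * u n + v n) =
    (fun n => Re k * Im_seq u n + (Im k * Re_seq u n + Im_seq v n)).
  by apply/funext => j; rewrite /Re_seq /Im_seq cImD cImM; ring.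
rewrite /levy_operator /pair_seq E1 E2.
rewrite (lin _ _ _ _ _ uR (geo_bounded_lin _ uI vR)) (lin _ _ _ _ _ uI vR).
rewrite (lin _ _ _ _ _ uI (geo_bounded_lin _ uR vI)) (lin _ _ _ _ _ uR vI).
by apply: complexP; rewrite ?cReD ?cImD ?cReM ?cImM/=; ring.
Qed.

Lemma generator_domain_hser {D t u} (S : set R) : 0 <= t -> t <= alpha -> cgeo_bounded D t u ->
  generator_domain nu S (restrictR (hser u)).
Proof.
move=> t0 ta bu; split; first exact: C2_hser bu.
move=> x _.
have [iR _ _] := real_generator b a alpha nu alpha_gt0 nu_levy exp_moment x t0 ta (cgeo_bounded_Re bu).
have [iI _ _] := real_generator b a alpha nu alpha_gt0 nu_levy exp_moment x t0 ta (cgeo_bounded_Im bu).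
move: iR iI; set jR := (X in EFin \o X); move=> iR; set jI := (X in EFin \o X); move=> iI.
have iS := integrableD measurableT (integrable_abse iR) (integrable_abse iI).
apply: le_lt_trans (integrable_lty measurableT iS).
rewrite (funext (fun y => jump_increment_hser x y t0 bu)).
have mR : measurable_fun setT jR by case/integrableP : iR => /measurable_EFinP.
have mI : measurable_fun setT jI by case/integrableP : iI => /measurable_EFinP.
apply: ge0_le_integral => //.
- by move=> y _; rewrite lee_fin; exact: normc_ge0.
- apply/measurable_EFinP.
  have msqrt : measurable_fun setT (@Num.sqrt R) by apply: continuous_measurable_fun; exact: sqrt_continuous.
  apply: (@measurableT_comp _ _ _ _ _ _ (@Num.sqrt R) _ (fun y => jR y ^+ 2 + jI y ^+ 2)) => //.
  by apply: measurable_funD; apply: measurable_funX.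
- by apply: emeasurable_funD; apply: measurableT_comp => //; exact/measurable_EFinP.
- by move=> y _; rewrite -EFinD lee_fin; exact: normc_ReIm.
Qed.

Lemma levy_operator_dual (S : set R) : dual_operator b a nu S (Vexp alpha) levy_operator.
Proof.
split.
- move=> u /(geo_Vstar S alpha u alpha_gt0)[t [D [t0 ta bu]]].
  exact: (Sstar_geo_bounded S t _ _ (ltW t0) (levy_operator_bounded (ltW t0) (ltW ta) bu)).
- move=> k u v /(geo_Vstar S alpha u alpha_gt0)[t [D [t0 ta bu]]].
  move=> /(geo_Vstar S alpha v alpha_gt0)[t' [D' [t'0 ta' bv]]].
  (* The two sequences may have different rates; both are brought to the larger one, which is still
     below [alpha]. *)
  have le (w : nat -> C) (E r r' : R) : 0 < r -> r <= r' -> cgeo_bounded E r w -> cgeo_bounded E r' w.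
    move=> r0 rr bw n; apply: le_trans (bw n) _.
    rewrite ler_wpM2l ?(cgeo_bounded_ge0 bw)// lerXn2r// nnegrE ltW//.
    exact: lt_le_trans rr.
  have m0 : 0 <= Num.max t t' by rewrite le_max ltW.
  apply: (levy_operator_lin k m0 _ (le _ _ _ _ t0 _ bu) (le _ _ _ _ t'0 _ bv));
    by rewrite ?ge_max ?le_max ?lexx ?orbT ?(ltW ta) ?(ltW ta').
- move=> u /(geo_Vstar S alpha u alpha_gt0)[t [D [t0 ta bu]]] x _.
  exact: generator_levy_operator (ltW t0) (ltW ta) bu.
Qed.

End ComplexGenerator.

(** * Moments of the increments *)

Section ComplexIntegral.
Context {d : measure_display} {T : measurableType d} {R : realType}.
Variables (mu : {measure set T -> \bar R}) (D : set T).
Hypothesis mD : measurable D.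
Local Notation C := R[i].
Implicit Types (f g : T -> C).

Lemma cintegral_lin f g (k : C) : cintegrable mu D f -> cintegrable mu D g ->
  cintegrable mu D (fun x => k * f x + g x) /\
  cintegral mu D (fun x => k * f x + g x) = k * cintegral mu D f + cintegral mu D g.
Proof.
move=> [fR fI] [gR gI].
have E1 : (fun x => Re (k * f x + g x)) = (fun x => Re k * Re (f x) + (- Im k * Im (f x) + Re (g x))).
  by apply/funext => x; rewrite cReD cReM; ring.
have E2 : (fun x => Im (k * f x + g x)) = (fun x => Re k * Im (f x) + (Im k * Re (f x) + Im (g x))).
  by apply/funext => x; rewrite cImD cImM; ring.
have i1 := integrable_combination mu D mD (- Im k) fI gR.
have i2 := integrable_combination mu D mD (Im k) fR gI.
split; first split.
- have := integrable_combination mu D mD (Re k) fR i1.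
  by congr (integrable _ _ _); apply/funext => x /=; rewrite cReD cReM; congr EFin; ring.
- have := integrable_combination mu D mD (Re k) fI i2.
  by congr (integrable _ _ _); apply/funext => x /=; rewrite cImD cImM; congr EFin; ring.
rewrite /cintegral E1 E2.
rewrite (Rintegral_combination mu D mD (Re k) fR i1) (Rintegral_combination mu D mD (- Im k) fI gR).
rewrite (Rintegral_combination mu D mD (Re k) fI i2) (Rintegral_combination mu D mD (Im k) fR gI).
by apply: complexP; rewrite ?cReD ?cImD ?cReM ?cImM /=; ring.
Qed.

Lemma cintegrable0 : cintegrable mu D (fun=> 0 : C).
Proof. by split; exact: integrable0. Qed.

Lemma cintegral0 : cintegral mu D (fun=> 0 : C) = 0.
Proof. by apply: complexP => /=; rewrite Rintegral_cst// mul0r. Qed.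

Lemma cintegrable_ofR (h : T -> R) : mu.-integrable D (EFin \o h) ->
  cintegrable mu D (fun x => ofR (h x)) /\
  cintegral mu D (fun x => ofR (h x)) = ofR (\int[mu]_(x in D) h x)%R.
Proof.
move=> ih; split; first by split => //=; exact: integrable0.
by apply: complexP => //=; rewrite Rintegral_cst// mul0r.
Qed.

Lemma cintegral_sum (F : nat -> T -> C) N : (forall n, cintegrable mu D (F n)) ->
  cintegrable mu D (fun x => \sum_(n < N) F n x) /\
  cintegral mu D (fun x => \sum_(n < N) F n x) = \sum_(n < N) cintegral mu D (F n).
Proof.
move=> iF; elim: N => [|N [IH1 IH2]].
  rewrite (_ : (fun x => _) = (fun=> 0 : C)); last by apply/funext => x; rewrite big_ord0.
  by rewrite big_ord0; split; [exact: cintegrable0|exact: cintegral0].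
have [h1 h2] := cintegral_lin (F N) _ 1 (iF N) IH1.
rewrite (_ : (fun x => _) = (fun x => 1 * F N x + \sum_(n < N) F n x)); last first.
  by apply/funext => x; rewrite big_ord_recr/= mul1r addrC.
by split => //; rewrite h2 big_ord_recr/= mul1r IH2 addrC.
Qed.

Lemma cintegral_dominated f (g : T -> R) :
  measurable_fun D (fun x => Re (f x)) -> measurable_fun D (fun x => Im (f x)) ->
  (forall x, D x -> normc (f x) <= g x) -> mu.-integrable D (EFin \o g) ->
  cintegrable mu D f /\ normc (cintegral mu D f) <= 2 * (\int[mu]_(x in D) g x)%R.
Proof.
move=> mR mI fg ig.
have bR x : D x -> `|Re (f x)| <= g x by move=> Dx; apply: le_trans (fg x Dx); exact: normc_Re.
have bI x : D x -> `|Im (f x)| <= g x by move=> Dx; apply: le_trans (fg x Dx); exact: normc_Im.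
split.
  by split; [exact: dominated_integrable mR bR ig|exact: dominated_integrable mI bI ig].
apply: le_trans (normc_ReIm _) _ => /=.
rewrite (_ : 2 * _ = (\int[mu]_(x in D) g x)%R + (\int[mu]_(x in D) g x)%R); last by ring.
by apply: lerD; [exact: dominated_Rintegral_le mR bR ig|exact: dominated_Rintegral_le mI bI ig].
Qed.

End ComplexIntegral.

(** * Taylor expansions at 0 in powers of [i u] *)

Section TaylorApproximation.
Context {R : realType}.
Local Notation C := R[i].
Local Notation iu u := (Complex 0 u : R[i]).
Implicit Types (u : R) (f g : R -> C) (p q : nat -> R).

Definition imag_poly N p u : C := \sum_(n < N) ofR (p n) * iu u ^+ n.

(** An expansion with real coefficients and error [O(|u| ^ N)] on [[-1, 1]]. Being a bare estimate,
    it passes to products and exponentials without any derivative of [f]. *)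
Definition taylor_approx N f p := exists K, forall u, `|u| <= 1 ->
  normc (f u - imag_poly N p u) <= K * `|u| ^+ N.

Lemma normc_imag u : normc (iu u) = `|u|.
Proof. by rewrite /= expr0n add0r sqrtr_sqr. Qed.

Lemma normc_sum I (r : seq I) (Q : pred I) (G : I -> C) :
  normc (\sum_(i <- r | Q i) G i) <= \sum_(i <- r | Q i) normc (G i).
Proof.
apply: (big_ind2 (fun x y => normc x <= y)) => // [|x1 x2 y1 y2 h1 h2].
  by rewrite Normc.normc0.
by apply: le_trans (normcD _ _) _; exact: lerD.
Qed.

Lemma imag_poly_le N p u : `|u| <= 1 -> normc (imag_poly N p u) <= \sum_(n < N) `|p n|.
Proof.
move=> u1; elim: N => [|N IH]; first by rewrite /imag_poly !big_ord0 Normc.normc0.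
rewrite /imag_poly !big_ord_recr/=; apply: le_trans (normcD _ _) _; apply: lerD => //.
by rewrite Normc.normcM normcX normc_ofR normc_imag ler_piMr// exprn_ile1.
Qed.

Lemma taylor_approx_ge0 N f p : taylor_approx N f p ->
  exists2 K, 0 <= K & forall u, `|u| <= 1 -> normc (f u - imag_poly N p u) <= K * `|u| ^+ N.
Proof.
move=> [K HK]; exists `|K| => // u u1; apply: le_trans (HK u u1) _.
by rewrite ler_wpM2r ?exprn_ge0// ler_norm.
Qed.

Lemma taylor_approx_lin N f g p q (c : R) : taylor_approx N f p -> taylor_approx N g q ->
  taylor_approx N (fun u => ofR c * f u + g u) (fun n => c * p n + q n).
Proof.
move=> [K HK] [L HL]; exists (`|c| * K + L) => u u1.
have -> : ofR c * f u + g u - imag_poly N (fun n => c * p n + q n) u =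
    ofR c * (f u - imag_poly N p u) + (g u - imag_poly N q u).
  have -> : imag_poly N (fun n => c * p n + q n) u = ofR c * imag_poly N p u + imag_poly N q u.
    rewrite /imag_poly mulr_sumr -big_split/=; apply: eq_bigr => n _.
    by rewrite ofRD ofRM mulrDl mulrA.
  ring.
apply: le_trans (normcD _ _) _; rewrite Normc.normcM normc_ofR mulrDl -mulrA.
by apply: lerD; [rewrite ler_wpM2l//; exact: HK|exact: HL].
Qed.

Definition conv p q n : R := \sum_(k < n.+1) p k * q (n - k)%N.

Lemma imag_poly_conv N p q u : imag_poly N (conv p q) u =
  \sum_(k < N) \sum_(m < N) if (k + m < N)%N then ofR (p k * q m) * iu u ^+ (k + m) else 0.
Proof.
transitivity (\sum_(n < N) \sum_(k < N) if (k <= n)%N then ofR (p k * q (n - k)%N) * iu u ^+ n else 0).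
  apply: eq_bigr => n _; rewrite /conv.
  have -> : ofR (\sum_(k < n.+1) p k * q (n - k)%N) = \sum_(k < n.+1) ofR (p k * q (n - k)%N).
    by apply: (big_morph (@ofR R)) => [x y|//]; exact: ofRD.
  rewrite mulr_suml (big_ord_widen N (fun k => ofR (p k * q (n - k)%N) * iu u ^+ n))//.
  by rewrite big_mkcond/=; apply: eq_bigr => k _; rewrite ltnS.
rewrite exchange_big/=; apply: eq_bigr => k _.
rewrite -!big_mkcond/=.
rewrite -(big_mkord (fun n => (k <= n)%N) (fun n => ofR (p k * q (n - k)%N) * iu u ^+ n)).
rewrite -(@big_nat_widenl _ _ _ k 0 N xpredT)// -{1}[k : nat]add0n big_addn big_mkord.
rewrite (big_ord_widen_cond N xpredT (fun i => ofR (p k * q (i + k - k)%N) * iu u ^+ (i + k))) ?leq_subr//.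
apply: eq_big => [i|i _]; first by rewrite ltn_subRL.
by rewrite addnK addnC.
Qed.

(** The constant collects the error of [f], the error of [g], and the terms of degree at least [N]
    in the product of the polynomials, which are small since [|u| <= 1]. *)
Lemma taylor_approxM N f g p q : taylor_approx N f p -> taylor_approx N g q ->
  taylor_approx N (fun u => f u * g u) (conv p q).
Proof.
move=> /taylor_approx_ge0[K K0 HK] /taylor_approx_ge0[L L0 HL].
pose sp := \sum_(n < N) `|p n|; pose sq := \sum_(n < N) `|q n|.
exists (K * (L + sq) + sp * L + sp * sq) => u u1.
have uN : `|u| ^+ N <= 1 by rewrite exprn_ile1.
rewrite (mulrDl _ (sp * sq)) (mulrDl (K * (L + sq))).
have -> : f u * g u - imag_poly N (conv p q) u =
    (f u - imag_poly N p u) * g u + imag_poly N p u * (g u - imag_poly N q u) +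
    (imag_poly N p u * imag_poly N q u - imag_poly N (conv p q) u) by ring.
have gb : normc (g u) <= L + sq.
  have -> : g u = (g u - imag_poly N q u) + imag_poly N q u by rewrite subrK.
  apply: le_trans (normcD _ _) _; apply: lerD; last exact: imag_poly_le.
  by apply: le_trans (HL u u1) _; rewrite ler_piMr.
apply: le_trans (normcD _ _) _; apply: lerD.
  apply: le_trans (normcD _ _) _; apply: lerD; rewrite Normc.normcM.
    rewrite mulrAC; apply: ler_pM => //; rewrite ?normc_ge0//; exact: HK.
  rewrite -mulrA; apply: ler_pM; rewrite ?normc_ge0//; [exact: imag_poly_le|exact: HL].
rewrite imag_poly_conv.
have -> : imag_poly N p u * imag_poly N q u =
    \sum_(k < N) \sum_(m < N) ofR (p k * q m) * iu u ^+ (k + m).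
  rewrite /imag_poly mulr_suml; apply: eq_bigr => k _; rewrite mulr_sumr.
  by apply: eq_bigr => m _; rewrite ofRM exprD; ring.
rewrite -sumrB mulr_suml mulr_suml.
apply: le_trans (normc_sum _ _ _ _) _.
apply: ler_sum => k _; rewrite -sumrB mulr_sumr mulr_suml.
apply: le_trans (normc_sum _ _ _ _) _.
apply: ler_sum => m _; case: ltnP => km.
  by rewrite subrr Normc.normc0 !mulr_ge0 ?exprn_ge0.
rewrite subr0 Normc.normcM normcX normc_ofR normc_imag normrM.
by rewrite ler_wpM2l ?mulr_ge0// ler_wiXn2l.
Qed.

Lemma taylor_approx_one N : taylor_approx N.+1 (fun=> 1) (fun n => (n == 0%N)%:R).
Proof.
exists 0 => u _; have -> : imag_poly N.+1 (fun n => (n == 0%N)%:R) u = 1.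
  rewrite /imag_poly big_ord_recl big1 ?addr0; first by rewrite expr0 mulr1.
  by move=> i _; rewrite (_ : ofR _ = 0)// mul0r.
by rewrite subrr Normc.normc0 mul0r.
Qed.

Lemma taylor_approx_pow N f p j : taylor_approx N.+1 f p ->
  taylor_approx N.+1 (fun u => f u ^+ j) (conv_pow p j).
Proof.
move=> fp; elim: j => [|j IH]; first exact: taylor_approx_one.
have := taylor_approxM N.+1 _ _ _ _ fp IH.
by congr (taylor_approx _ _ _); apply/funext => u; rewrite exprS.
Qed.

(** Once the lower coefficients are known to vanish, dividing by [u ^ n] isolates [r n] up to
    [O(u)]. *)
Lemma imag_poly_small N r M : 0 <= M ->
  (forall u, `|u| <= 1 -> normc (imag_poly N r u) <= M * `|u| ^+ N) ->
  forall n, (n < N)%N -> r n = 0.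
Proof.
move=> M0 Hr.
elim/ltn_ind => n IH nN.
apply/eqP; rewrite -normr_le0.
pose tail := \sum_(k < N) `|r k|.
have tail0 : 0 <= tail by apply: sumr_ge0.
apply: (@small_mul_le0 _ (M + tail)); first by rewrite addr_ge0.
move=> e e0; pose u : R := Num.min e 1.
have u0 : 0 < u by rewrite lt_min e0 ltr01.
have u1 : u <= 1 by rewrite ge_min lexx orbT.
have nu1 : `|u| <= 1 by rewrite gtr0_norm.
rewrite -(ler_pM2r (exprn_gt0 n u0)).
have -> : `|r n| * u ^+ n = normc (ofR (r n) * iu u ^+ n).
  by rewrite Normc.normcM normcX normc_ofR normc_imag (gtr0_norm u0).
have E : imag_poly N r u = ofR (r n) * iu u ^+ n +
    \sum_(k < N | (n < k)%N) ofR (r k) * iu u ^+ k.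
  rewrite /imag_poly (bigID (fun k : 'I_N => (n < k)%N))/= addrC; congr (_ + _).
  rewrite (bigD1 (Ordinal nN))/= ?ltnn// big1 ?addr0// => k /andP[nk kn].
  have kn' : (k < n)%N.
    by rewrite ltn_neqAle leqNgt nk andbT; apply: contra kn => /eqP kn; apply/eqP/val_inj.
  have -> : ofR (r k) = 0 by rewrite (IH k kn' (ltn_ord k)).
  by rewrite mul0r.
have -> : ofR (r n) * iu u ^+ n = imag_poly N r u - \sum_(k < N | (n < k)%N) ofR (r k) * iu u ^+ k.
  by rewrite E addrK.
apply: le_trans (normcB _ _) _.
have tri : normc (\sum_(k < N | (n < k)%N) ofR (r k) * iu u ^+ k) <= tail * u ^+ n.+1.
  rewrite mulr_suml big_mkcond/=.
  apply: le_trans (normc_sum _ _ _ _) _.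
  apply: ler_sum => k _; case: ifP => nk; last first.
    by rewrite Normc.normc0 mulr_ge0 ?exprn_ge0 ?(ltW u0).
  rewrite Normc.normcM normcX normc_ofR normc_imag (gtr0_norm u0) ler_wpM2l//.
  by apply: ler_wiXn2l; rewrite ?(ltW u0).
apply: le_trans (lerD (Hr u nu1) tri) _.
rewrite (gtr0_norm u0); apply: (@le_trans _ _ ((M + tail) * u ^+ n.+1)).
  by rewrite mulrDl lerD2r ler_wpM2l// ler_wiXn2l ?(ltW u0).
rewrite exprS mulrA ler_wpM2r ?exprn_ge0 ?(ltW u0)// mulrC ler_wpM2r ?addr_ge0//.
by rewrite ge_min lexx.
Qed.

Lemma taylor_approx_unique N f p q : taylor_approx N f p -> taylor_approx N f q ->
  forall n, (n < N)%N -> p n = q n.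
Proof.
move=> /taylor_approx_ge0[K K0 HK] /taylor_approx_ge0[L L0 HL].
have Hd u : `|u| <= 1 -> normc (imag_poly N (fun n => p n - q n) u) <= (K + L) * `|u| ^+ N.
  move=> u1.
  have -> : imag_poly N (fun n => p n - q n) u = (f u - imag_poly N q u) - (f u - imag_poly N p u).
    have -> : imag_poly N (fun n => p n - q n) u = imag_poly N p u - imag_poly N q u.
      rewrite /imag_poly -sumrB; apply: eq_bigr => n _; rewrite -mulrBl; congr (_ * _).
      by apply: complexP; rewrite ?cReD ?cImD ?cReN ?cImN /= ?subr0.
    ring.
  apply: le_trans (normcB _ _) _; rewrite mulrDl addrC.
  by apply: lerD; [exact: HK|exact: HL].
move=> n nN; apply/eqP; rewrite -subr_eq0; apply/eqP.
exact: (imag_poly_small N (fun n => p n - q n) (K + L) (addr_ge0 K0 L0) Hd n nN).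
Qed.

End TaylorApproximation.

(** * Moments as Taylor coefficients *)

Section MomentExpansion.
Context {d : measure_display} {T : measurableType d} {R : realType}.
Variables (mu : {measure set T -> \bar R}) (Y : T -> R) (W : T -> R) (A : R) (n0 : nat).
Hypothesis A0 : 0 < A.
Hypothesis mY : measurable_fun setT Y.
Hypothesis iW : mu.-integrable setT (EFin \o W).
Hypothesis domW : forall N w, \sum_(n < N) taylor_term n0 n (A * `|Y w|) <= W w.
Local Notation C := R[i].
Local Notation iu u := (Complex 0 u : R[i]).

(** The expansion of [exp (i u Y)] from order [n0] on is integrated term by term. With [n0 = 2] it
    serves the jump part of the Levy exponent, with [n0 = 0] the characteristic function of an
    increment. *)
Lemma cexp_remainder_moment N : (n0 <= N)%N ->
  (forall u, cintegrable mu setT (fun w => cexp (iu (u * Y w)) - cexp_poly n0 (iu (u * Y w)))) /\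
  taylor_approx N (fun u => cintegral mu setT
    (fun w => cexp (iu (u * Y w)) - cexp_poly n0 (iu (u * Y w)))) (moment mu Y n0).
Proof.
move=> n0N.
pose F u n w : C := iu u ^+ n * ofR (taylor_term n0 n (Y w)) + 0.
have polyE u w : cexp_poly N (iu (u * Y w)) - cexp_poly n0 (iu (u * Y w)) = \sum_(n < N) F u n w.
  rewrite /cexp_poly [X in _ - X](big_ord_widen N (fun n => iu (u * Y w) ^+ n / n`!%:R))// [X in _ - X]big_mkcond -sumrB.
  apply: eq_bigr => n _; rewrite /F addr0 /taylor_term ltnNge; case: leqP => n0n /=.
    rewrite subr0 (_ : iu (u * Y w) = iu u * ofR (Y w)); last first.
      by apply: complexP; rewrite ?cReM ?cImM/=; ring.
    have nf : (n`!%:R : R) != 0 by rewrite pnatr_eq0 -lt0n fact_gt0.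
    rewrite exprMn -mulrA; congr (_ * _); rewrite -ofRX -ofR_nat.
    have nf' : ofR (n`!%:R : R) != 0 by rewrite ofR_nat pnatr_eq0 -lt0n fact_gt0.
    by apply: (mulIf nf'); rewrite divfK// -ofRM divfK.
  by rewrite subrr (_ : ofR 0 = 0)// mulr0.
have iT n := taylor_term_integrable mu Y W A n0 A0 mY iW domW n.
have iF u n : cintegrable mu setT (F u n).
  have [h1 _] := cintegrable_ofR mu setT measurableT _ (iT n).
  by have [] := cintegral_lin mu setT measurableT _ _ (iu u ^+ n) h1 (cintegrable0 mu setT).
have IF u n : cintegral mu setT (F u n) = ofR (moment mu Y n0 n) * iu u ^+ n.
  have [h1 h2] := cintegrable_ofR mu setT measurableT _ (iT n).
  have [_ ->] := cintegral_lin mu setT measurableT _ _ (iu u ^+ n) h1 (cintegrable0 mu setT).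
  by rewrite cintegral0// addr0 h2 mulrC.
pose E (u : R) w : C := cexp (iu (u * Y w)) - cexp_poly N (iu (u * Y w)).
(* The factor [N!] undoes the factorial inside [taylor_term], since [cexp_taylor_im] bounds by a
   bare power. *)
pose g (u : R) w : R := (2 * `|u|) ^+ N * N`!%:R * `|taylor_term n0 N (Y w)|.
have Eg u w : normc (E u w) <= g u w.
  apply: le_trans (cexp_taylor_im N _) _; rewrite /g taylor_term_norm /taylor_term n0N normrM.
  have nf : (N`!%:R : R) != 0 by rewrite pnatr_eq0 -lt0n fact_gt0.
  have -> : (2 * (`|u| * `|Y w|)) ^+ N = (2 * `|u|) ^+ N * `|Y w| ^+ N by rewrite mulrA exprMn.
  by rewrite -mulrA ler_wpM2l ?exprn_ge0 ?mulr_ge0// mulrCA mulfV// mulr1.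
have ig u : mu.-integrable setT (EFin \o g u).
  have := integrableZl measurableT ((2 * `|u|) ^+ N * N`!%:R) (integrable_abse (iT N)).
  by congr (integrable _ _ _); apply/funext.
have mpoly (u : R) (p : C -> R) : (p = @Re R \/ p = @Im R) -> measurable_fun setT (fun w => p (cexp_poly N (iu (u * Y w)))).
  move=> pRI.
  have -> : (fun w => p (cexp_poly N (iu (u * Y w)))) = (fun w => \sum_(n < N) p (iu u ^+ n / n`!%:R) * Y w ^+ n).
    apply/funext => w; rewrite /cexp_poly.
    have -> : \sum_(n < N) iu (u * Y w) ^+ n / n`!%:R = \sum_(n < N) (iu u ^+ n / n`!%:R) * ofR (Y w ^+ n).
      apply: eq_bigr => n _; rewrite (_ : iu (u * Y w) = iu u * ofR (Y w)); last first.
        by apply: complexP; rewrite ?cReM ?cImM/=; ring.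
      by rewrite exprMn ofRX mulrAC.
    case: pRI => ->.
      by rewrite (big_morph (@Re R) (@cReD R) (erefl _)); apply: eq_bigr => n _; rewrite cReMr.
    by rewrite (big_morph (@Im R) (@cImD R) (erefl _)); apply: eq_bigr => n _; rewrite cImMr.
  apply: measurable_sum => n.
  by apply: measurable_funM; [exact: measurable_cst|exact: measurable_funX].
have mE (u : R) : measurable_fun setT (fun w => Re (E u w)) /\ measurable_fun setT (fun w => Im (E u w)).
  have muY : measurable_fun setT (fun w => u * Y w) by exact: measurable_funM.
  split.
    rewrite (_ : (fun w => _) = (fun w => cos (u * Y w) - Re (cexp_poly N (iu (u * Y w))))); last first.
      by apply/funext => w; rewrite /E cReD cReN /cexp/= expR0 mul1r.
    apply: measurable_funB; last by apply: mpoly; left.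
    apply: measurableT_comp muY; apply: continuous_measurable_fun; exact: continuous_cos.
  rewrite (_ : (fun w => _) = (fun w => sin (u * Y w) - Im (cexp_poly N (iu (u * Y w))))); last first.
    by apply/funext => w; rewrite /E cImD cImN /cexp/= expR0 mul1r.
  apply: measurable_funB; last by apply: mpoly; right.
  apply: measurableT_comp muY; apply: continuous_measurable_fun; exact: continuous_sin.
have fE (u : R) : (fun w => cexp (iu (u * Y w)) - cexp_poly n0 (iu (u * Y w))) =
    (fun w => 1 * E u w + \sum_(n < N) F u n w).
  by apply/funext => w; rewrite -polyE /E mul1r addrA subrK.
have iE u := cintegral_dominated mu setT measurableT (E u) (g u) (mE u).1 (mE u).2 (fun w _ => Eg u w) (ig u).
have sF u := cintegral_sum mu setT measurableT (F u) N (iF u).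
split=> [u|].
  rewrite fE; have := cintegral_lin mu setT measurableT _ _ 1 (iE u).1 (sF u).1.
  by case.
exists (2 * (2 ^+ N * N`!%:R * (\int[mu]_w `|taylor_term n0 N (Y w)|)%R)) => u _.
rewrite fE; have [_ ->] := cintegral_lin mu setT measurableT _ _ 1 (iE u).1 (sF u).1.
rewrite mul1r (sF u).2.
have -> : \sum_(n < N) cintegral mu setT (F u n) = imag_poly N (moment mu Y n0) u.
  by apply: eq_bigr => n _.
rewrite addrK; apply: le_trans (iE u).2 _.
rewrite /g RintegralZl//; last exact: integrable_abse (iT N).
by rewrite exprMn; apply/eq_ler; ring.
Qed.

End MomentExpansion.

(** * Taylor expansion of an exponential *)

Section TaylorExponential.
Context {R : realType}.
Local Notation C := R[i].
Implicit Types (u t : R) (f : R -> C) (p q : nat -> R).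

Lemma taylor_approx_ext N f p q : (forall n, (n < N)%N -> p n = q n) ->
  taylor_approx N f p -> taylor_approx N f q.
Proof.
move=> pq [K HK]; exists K => u u1; rewrite (_ : imag_poly N q u = imag_poly N p u); first exact: HK.
by apply: eq_bigr => n _; rewrite pq.
Qed.

Lemma taylor_approx0 N : taylor_approx N (fun=> 0) (fun=> 0 : R).
Proof.
exists 0 => u _; rewrite /imag_poly big1 ?subrr ?Normc.normc0 ?mul0r// => n _.
by rewrite (_ : ofR 0 = 0)// mul0r.
Qed.

Lemma taylor_approx_sum N M (g : nat -> R -> C) (q : nat -> nat -> R) (c : nat -> R) :
  (forall j, taylor_approx N (g j) (q j)) ->
  taylor_approx N (fun u => \sum_(j < M) ofR (c j) * g j u) (fun n => \sum_(j < M) c j * q j n).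
Proof.
move=> gq; elim: M => [|M IH].
  have := taylor_approx0 N; congr (taylor_approx _ _ _); apply/funext => u.
    by rewrite big_ord0.
  by rewrite big_ord0.
have := taylor_approx_lin _ _ _ _ _ (c M) (gq M) IH.
by congr (taylor_approx _ _ _); apply/funext => u; rewrite big_ord_recr/= addrC.
Qed.

(** As [p 0 = 0], [f u] is [O(|u|)], so cutting the exponential series at [N.+1] costs
    [O(|u| ^ N.+1)]; the finitely many powers left are expanded by [taylor_approx_pow]. *)
Lemma taylor_approx_cexp N f p t : p 0%N = 0 -> taylor_approx N.+1 f p ->
  taylor_approx N.+1 (fun u => cexp (ofR t * f u))
    (fun n => \sum_(j < N.+1) conv_pow p j n * t ^+ j / j`!%:R).
Proof.
move=> p0 fp.
have [K K0 HK] := taylor_approx_ge0 _ _ _ fp.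
pose L := K + \sum_(n < N.+1) `|p n|.
have L0 : 0 <= L by rewrite addr_ge0// sumr_ge0.
have fL u : `|u| <= 1 -> normc (f u) <= L * `|u|.
  move=> u1; rewrite -[f u](subrK (imag_poly N.+1 p u)).
  apply: le_trans (normcD _ _) _; rewrite /L mulrDl; apply: lerD.
    apply: le_trans (HK u u1) _; rewrite ler_wpM2l// exprS ler_piMr// exprn_ile1//.
  apply: le_trans (normc_sum _ _ _ _) _; rewrite mulr_suml; apply: ler_sum => n _.
  rewrite Normc.normcM normcX normc_ofR normc_imag.
  case: n => -[|n] nN /=; first by rewrite p0 normr0 !mul0r.
  by rewrite ler_wpM2l// exprS ler_piMr// exprn_ile1.
have [M HM] := taylor_approx_sum N.+1 N.+1 _ _ (fun j => t ^+ j / j`!%:R)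
  (fun j => taylor_approx_pow N f p j fp).
exists (expR (`|t| * L) * (2 * (`|t| * L)) ^+ N.+1 + M) => u u1.
have -> : imag_poly N.+1 (fun n => \sum_(j < N.+1) conv_pow p j n * t ^+ j / j`!%:R) u =
    imag_poly N.+1 (fun n => \sum_(j < N.+1) (t ^+ j / j`!%:R) * conv_pow p j n) u.
  apply: eq_bigr => n _; congr (ofR _ * _); apply: eq_bigr => j _.
  by rewrite -mulrA mulrC.
have polyE : \sum_(j < N.+1) ofR (t ^+ j / j`!%:R) * f u ^+ j = cexp_poly N.+1 (ofR t * f u).
  apply: eq_bigr => j _; rewrite exprMn mulrAC; congr (_ * _).
  have nf : (j`!%:R : R) != 0 by rewrite pnatr_eq0 -lt0n fact_gt0.
  have nf' : ofR (j`!%:R : R) != 0 by rewrite ofR_nat pnatr_eq0 -lt0n fact_gt0.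
  by rewrite -ofRX -ofR_nat; apply: (mulIf nf'); rewrite divfK// -ofRM divfK.
set P := imag_poly _ _ _.
have -> : cexp (ofR t * f u) - P = (cexp (ofR t * f u) - cexp_poly N.+1 (ofR t * f u)) +
    (cexp_poly N.+1 (ofR t * f u) - P) by rewrite addrA subrK.
apply: le_trans (normcD _ _) _; rewrite mulrDl; apply: lerD; last first.
  by rewrite -polyE; exact: HM.
have nz : normc (ofR t * f u) <= `|t| * L * `|u|.
  by rewrite Normc.normcM normc_ofR -mulrA ler_wpM2l// fL.
apply: (@le_trans _ _ (expR (`|t| * L) * (2 * normc (ofR t * f u)) ^+ N.+1)).
  apply: cexp_taylor => s /andP[s0 s1]; rewrite normc_cexp ler_expR cReMl.
  apply: le_trans (ler_norm _) _; rewrite normrM (ger0_norm s0).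
  apply: le_trans (ler_piMl (normr_ge0 _) s1) _.
  apply: le_trans (normc_Re _) _; apply: le_trans nz _.
  by rewrite ler_piMr// mulr_ge0.
rewrite -mulrA ler_wpM2l ?expR_ge0// -exprMn lerXn2r ?nnegrE ?mulr_ge0 ?normc_ge0//.
by rewrite -mulrA ler_wpM2l.
Qed.

End TaylorExponential.

(** * Taylor expansion of the Levy-Khintchine formula *)

Section CharacteristicFunction.
Context {R : realType}.
Variables (b a alpha : R) (nu : {measure set (measurableTypeR R) -> \bar R}).
Hypothesis alpha_gt0 : 0 < alpha.
Hypothesis nu_levy : levy_measure nu.
Hypothesis exp_moment :
  (\int[nu]_(y in [set y : R | (1 < `|y|)%R]) (expR (alpha * `|y|))%:E < +oo)%E.
Local Notation C := R[i].
Local Notation iu u := (Complex 0 u : R[i]).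
Local Notation lam := (levy_symbol b a nu).

Lemma levy_exponent_taylor N : (3 <= N)%N -> taylor_approx N (levy_exponent b a nu) lam.
Proof.
move=> N3.
have [_ h1] := @cexp_remainder_moment _ (measurableTypeR R) R nu idfun (levy_majorant alpha) alpha 2
  alpha_gt0 (@measurable_id _ _ _) (levy_majorant_integrable alpha nu nu_levy exp_moment)
  (levy_majorantP alpha alpha_gt0) N (ltnW N3).
pose drift n : R := if n == 1%N then b else if n == 2 then a / 2 else 0.
pose g u : C := iu (u * b) - ofR (a * u ^+ 2 / 2).
have h2 : taylor_approx N g drift.
  (* Drift and Gaussian part form a polynomial of degree 2 in [i u], so the expansion is exact once
     [3 <= N]. *)
  exists 0 => u _; rewrite mul0r.
  have -> : imag_poly N drift u = g u.
    rewrite -(subnKC N3) addSn addSn addSn add0n /imag_poly !big_ord_recl big1; last first.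
      by move=> i _; rewrite (_ : ofR _ = 0)// mul0r.
    transitivity (ofR 0 * 1 + (ofR b * iu u + (ofR (a / 2) * iu u ^+ 2 + 0))); first by [].
    by apply: complexP; rewrite /g expr2 ?(cReD, cImD, cReM, cImM, cReN, cImN) /=; ring.
  by rewrite subrr Normc.normc0.
have := taylor_approx_lin _ _ _ _ _ 1 h2 h1.
congr (taylor_approx _ _ _); apply/funext => u; last by rewrite mul1r.
rewrite (_ : ofR 1 = 1)// mul1r; congr (_ + cintegral _ _ _); apply/funext => y.
by rewrite /cexp_poly !big_ord_recl big_ord0 /= expr0 expr1 !fact0 addr0 !divr1 opprD addrA.
Qed.

(** Here the two sides meet: the coefficients that [exp (t L)] produces on monomials are those of
    the characteristic function at time [t]. *)
Lemma levy_cf_taylor t N : (2 <= N)%N -> taylor_approx N.+1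
  (fun u => cexp (ofR t * levy_exponent b a nu u)) (semi_moment lam t).
Proof.
move=> N2; have := taylor_approx_cexp N _ lam t (levy_symbol0 b a nu) (levy_exponent_taylor N.+1 N2).
apply: taylor_approx_ext => n nN; rewrite (@semi_momentE _ lam (levy_symbol0 b a nu) t n N.+1)//.
Qed.

End CharacteristicFunction.

(** * Alternating remainders of cos and sin *)

Section TrigonometricRemainder.
Context {R : realType}.
Implicit Types (x y : R) (n : nat).

(* Up to the sign (-1)^n, the remainders of the n-th Taylor polynomials of cos
   and sin at 0. *)
Fixpoint cos_remainder n x : R :=
  if n is n'.+1 then x ^+ n'.*2 / n'.*2`!%:R - cos_remainder n' x else cos x.

Fixpoint sin_remainder n x : R :=
  if n is n'.+1 then x ^+ n'.*2.+1 / n'.*2.+1`!%:R - sin_remainder n' x else sin x.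

Lemma cos_remainderS n x :
  cos_remainder n.+1 x = x ^+ n.*2 / n.*2`!%:R - cos_remainder n x.
Proof. by []. Qed.

Lemma is_derive_exp_coeff n x :
  is_derive x (1 : R) (fun y => y ^+ n.+1 / n.+1`!%:R) (x ^+ n / n`!%:R).
Proof.
have := @is_deriveX _ _ (@id R) n.+1 x (1 : R) 1 (is_derive_id x (1 : R)).
move=> H; have := @is_deriveZ _ _ _ _ (n.+1`!%:R^-1) x (1 : R) _ H.
have -> : ((n.+1)`!%:R^-1 \*: @id R ^+ n.+1) = (fun y : R => y ^+ n.+1 / n.+1`!%:R).
  by apply/funext => y /=; rewrite /GRing.scale/= mulrC exprfctE.
move=> K; apply: is_derive_eq K _; rewrite /GRing.scale/= mulr1 factS natrM.
have n0 : (n.+1%:R : R) != 0 by rewrite pnatr_eq0.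
have nf : (n`!%:R : R) != 0 by rewrite pnatr_eq0 -lt0n fact_gt0.
by rewrite invfM mulrACA mulVf// mul1r mulrC.
Qed.

Lemma is_derive_cos_sin_remainder n x :
  is_derive x (1 : R) (sin_remainder n) (cos_remainder n x) /\
  is_derive x (1 : R) (cos_remainder n.+1) (sin_remainder n x).
Proof.
elim: n => [|n [IH1 IH2]]; split.
- exact: is_derive_sin.
- have := is_deriveB (is_derive_cst (1 : R) x (1 : R)) (is_derive_cos x).
  rewrite sub0r opprK; congr (is_derive _ _ _ _).
  by apply/funext => y; rewrite /= expr0 fact0 divr1.
- by have := is_deriveB (is_derive_exp_coeff n.*2 x) IH1.
- by have := is_deriveB (is_derive_exp_coeff n.*2.+1 x) IH2.
Qed.

Lemma cos_sin_remainder0 n : sin_remainder n 0 = 0 /\ cos_remainder n.+1 0 = 0.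
Proof.
elim: n => [|n [IH1 IH2]]; split.
- exact: sin0.
- by rewrite /= cos0 expr0 fact0 divr1 subrr.
- by rewrite /= IH1 expr0n mul0r subrr.
- by rewrite cos_remainderS IH2 expr0n mul0r subrr.
Qed.

Lemma is_derive_ge0 (f f' : R -> R) x : 0 <= x -> f 0 = 0 ->
  (forall y, is_derive y (1 : R) f (f' y)) -> (forall y, 0 <= y -> 0 <= f' y) ->
  0 <= f x.
Proof.
move=> x0 f0 df f'0; rewrite -f0.
apply: (@ger0_derive1_ndecr R f 0 x) => //.
- move=> y; rewrite in_itv/= => /andP[y0 _]; rewrite derive1E.
  by have [_ ->] := df y; apply: f'0; exact: ltW.
- apply: continuous_subspaceT => y; apply/differentiable_continuous/derivable1_diffP.
  by case: (df y).
Qed.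

Lemma cos_remainderN n x : cos_remainder n (- x) = cos_remainder n x.
Proof.
elim: n => [|n IH]; first exact: cosN.
by rewrite !cos_remainderS IH -mul2n !exprM sqrrN.
Qed.

(** Two integrations from 0 lead from the remainder of index [n.+1] to that of index [n.+2],
    starting from [cos <= 1]; negative arguments follow as the remainders of cos are even. *)
Lemma cos_remainder_ge0 n x : 0 <= cos_remainder n.+1 x.
Proof.
wlog x0 : x / 0 <= x.
  move=> H; have [/H//|xlt] := leP 0 x.
  by rewrite -cos_remainderN; apply: H; rewrite oppr_ge0 ltW.
elim: n x x0 => [|n IH] x x0.
  by rewrite /= expr0 fact0 divr1 subr_ge0 cos_le1.
apply: (is_derive_ge0 _ (sin_remainder n.+1)) => //; first exact: (cos_sin_remainder0 _).2.
  by move=> y; exact: (is_derive_cos_sin_remainder _ _).2.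
move=> y y0; apply: (is_derive_ge0 _ (cos_remainder n.+1)) => //; first exact: (cos_sin_remainder0 _).1.
by move=> z; exact: (is_derive_cos_sin_remainder _ _).1.
Qed.

Lemma cos_remainder_bounds n x : (0 < n)%N ->
  [/\ 0 <= cos_remainder n x, cos_remainder n x <= x ^+ n.*2 / n.*2`!%:R &
      x ^+ n.*2 / n.*2`!%:R - x ^+ n.+1.*2 / n.+1.*2`!%:R <= cos_remainder n x].
Proof.
case: n => // n _; split; first exact: cos_remainder_ge0.
  by rewrite -subr_ge0 -cos_remainderS cos_remainder_ge0.
by have := cos_remainder_ge0 n.+2 x; rewrite cos_remainderS cos_remainderS subr_ge0; lra.
Qed.

End TrigonometricRemainder.

Section Fatou.
Context {d : measure_display} {T : measurableType d} {R : realType}.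
Variables (mu : {measure set T -> \bar R}).

Lemma fatou_integrable (f : nat -> T -> R) (g : T -> R) (B : R) :
  (forall n, mu.-integrable setT (EFin \o f n)) -> (forall n w, 0 <= f n w) ->
  (forall w, (fun n => f n w) @ \oo --> g w) ->
  (forall n, (\int[mu]_w f n w)%R <= B) ->
  mu.-integrable setT (EFin \o g) /\ (\int[mu]_w g w)%R <= B.
Proof.
move=> if_ f0 fg fB.
have mf n : measurable_fun setT (f n) by apply/measurable_EFinP; case/integrableP: (if_ n).
have mg : measurable_fun setT g by apply: (measurable_fun_cvg mf) => w _; exact: fg.
have g0 w : 0 <= g w.
  by rewrite -(cvg_lim _ (fg w))//; apply: limr_ge; [apply/cvg_ex; exists (g w)|near=> n].
have H : (\int[mu]_w (g w)%:E <= B%:E)%E.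
  have := @fatou _ _ _ mu setT measurableT (fun n w => (f n w)%:E)
    (fun n => (measurable_EFinP _ _).2 (mf n)) (fun n w _ => f0 n w).
  rewrite (eq_integral (fun w => (g w)%:E)); last first.
    move=> w _; have : (fun n => (f n w)%:E) @ \oo --> (g w)%:E.
      by apply: cvg_comp; [exact: fg|exact: cvg_id].
    by move=> /cvg_limn_einf_sup[].
  move=> h; apply: le_trans h _; rewrite limn_einf_lim; apply: lime_le; first exact: is_cvg_einfs.
  near=> n; apply: (@le_trans _ _ (\int[mu]_w (f n w)%:E)%E).
    by apply: ereal_inf_lbound; exists n => /=.
  rewrite -[leLHS]fineK ?lee_fin; first exact: fB.
  by apply: integrable_fin_num => //; exact: if_.
have ig : mu.-integrable setT (EFin \o g).
  apply/integrableP; split; first exact/measurable_EFinP.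
  rewrite (eq_integral (fun w => (g w)%:E)); last by move=> w _ /=; rewrite ger0_norm.
  by apply: le_lt_trans H _; exact: ltry.
split => //; rewrite -lee_fin; apply: le_trans H.
by rewrite /Rintegral fineK//; exact: integrable_fin_num.
Unshelve. all: by end_near. Qed.

End Fatou.

(** * Even moments from the characteristic function *)

Section MomentsFromCharacteristicFunction.
Context {d : measure_display} {Omega : measurableType d} {R : realType}.
Variables (P : probability Omega R) (Y : Omega -> R) (q : nat -> R).
Hypothesis mY : measurable_fun setT Y.
Local Notation C := R[i].
Local Notation iu u := (Complex 0 u : R[i]).
Variable phi : R -> C.
Hypothesis Re_phi : forall u, Re (phi u) = (\int[P]_w cos (u * Y w))%R.
Hypothesis q0 : q 0%N = 1.
Hypothesis phi_taylor : forall N, (2 <= N)%N -> taylor_approx N.+1 phi q.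

Definition even_moment n := (\int[P]_w (Y w ^+ n.*2 / n.*2`!%:R))%R.

Definition has_even_moment n :=
  P.-integrable setT (EFin \o (fun w => Y w ^+ n.*2 / n.*2`!%:R)) /\
  even_moment n = q n.*2.

Lemma imag_even u m : iu u ^+ m.*2 = ofR ((-1) ^+ m * u ^+ m.*2).
Proof.
rewrite -mul2n !exprM.
have -> : iu u ^+ 2 = ofR (- u ^+ 2).
  by rewrite !expr2; apply: complexP; rewrite ?cReM ?cImM/=; ring.
by rewrite -ofRX [in LHS]exprNn.
Qed.

Lemma Re_imag_poly n u :
  Re (imag_poly n.*2.+1 q u) = \sum_(j < n.+1) (-1) ^+ j * q j.*2 * u ^+ j.*2.
Proof.
elim: n => [|n IH].
  by rewrite /imag_poly !big_ord1 !expr0 mul1r !mulr1.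
rewrite doubleS /imag_poly big_ord_recr big_ord_recr -/(imag_poly n.*2.+1 q u) !cReD IH.
rewrite [RHS]big_ord_recr/= -[n.*2.+2]doubleS imag_even -ofRM.
rewrite exprS imag_even -[X in _ + X]/(_ * _) /=; congr (_ + _); last by rewrite mulrCA mulrA.
ring.
Qed.

Lemma cos_integrable u : P.-integrable setT (EFin \o (fun w => cos (u * Y w))).
Proof.
have i1 : P.-integrable setT (EFin \o (fun=> 1 : R)).
  by apply: finite_measure_integrable_cst.
apply: (dominated_integrable _ _ measurableT _ _ i1).
  apply: measurableT_comp; last exact: measurable_funM.
  by apply: continuous_measurable_fun; exact: continuous_cos.
by move=> w _; rewrite ler_norml cos_geN1 cos_le1.
Qed.

Lemma cos_remainder_expectation n u : (forall k, (k < n)%N -> has_even_moment k) ->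
  P.-integrable setT (EFin \o (fun w => cos_remainder n (u * Y w))) /\
  (\int[P]_w cos_remainder n (u * Y w))%R =
  (-1) ^+ n * (Re (phi u) - \sum_(j < n) (-1) ^+ j * q j.*2 * u ^+ j.*2).
Proof.
elim: n => [|n IH] H.
  by rewrite big_ord0 subr0 expr0 mul1r Re_phi; split => //; exact: cos_integrable.
have [//|i1 e1] := IH; first by move=> k kn; apply: H; exact: ltnW.
have [i2 e2] := H n (ltnSn n).
have i2' : P.-integrable setT (EFin \o (fun w => u ^+ n.*2 * (Y w ^+ n.*2 / n.*2`!%:R))).
  have := integrableZl measurableT (u ^+ n.*2) i2.
  by congr (integrable _ _ _); apply/funext.
have E : (fun w => cos_remainder n.+1 (u * Y w)) =
    (fun w => -1 * cos_remainder n (u * Y w) + u ^+ n.*2 * (Y w ^+ n.*2 / n.*2`!%:R)).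
  by apply/funext => w; rewrite cos_remainderS exprMn mulN1r addrC mulrA.
rewrite E; split; first exact: integrable_combination.
rewrite Rintegral_combination// e1 RintegralZl// -/(even_moment n) e2 big_ord_recr/= exprS.
have s2 : (-1) ^+ n * (-1) ^+ n = 1 :> R by rewrite -exprMn mulrNN mulr1 expr1n.
move: s2; set s := (-1) ^+ n => s2.
set r := Re _; set a := \sum_(j < n) _.
transitivity (- (s * (r - a)) + (s * s) * q n.*2 * u ^+ n.*2); last by ring.
by rewrite s2; ring.
Qed.

(** Divided by [u ^ m.*2], the remainder of index [m] is nonnegative, lies below [Y ^ m.*2 / m.*2!]
    and tends to it as [u] tends to 0, while its expectation is within [K u] of [q m.*2]. Fatou's
    lemma makes the limit integrable; the limit is then itself the majorant for dominated
    convergence, which gives the exact value. *)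
Lemma phi_even_moments n : has_even_moment n.
Proof.
elim/ltn_ind: n => n IH.
case: n IH => [_|n IH].
  have E : (fun w => Y w ^+ 0.*2 / (0.*2)`!%:R) = (fun=> 1 : R).
    by apply/funext => w; rewrite expr0 fact0 divr1.
  rewrite /has_even_moment /even_moment E; split.
    by apply: finite_measure_integrable_cst.
  by rewrite Rintegral_cst//= probability_setT mulr1 q0.
set m := n.+1 in IH *.
have m2 : (2 <= m.*2)%N by rewrite /m doubleS.
have [K K0 HK] := taylor_approx_ge0 _ _ _ (phi_taylor m.*2 m2).
pose u k : R := harmonic k.
have u0 k : 0 < u k by exact: harmonic_gt0.
have u1 k : u k <= 1 by rewrite /u /harmonic/= invf_le1 ?ltr0n// ler1n.
have cu : u @ \oo --> (0 : R) by exact: cvg_harmonic.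
pose g k w := u k ^- m.*2 * cos_remainder m (u k * Y w).
have un k : u k ^+ m.*2 != 0 by rewrite expf_neq0// gt_eqF.
have ig k : P.-integrable setT (EFin \o g k).
  have := integrableZl measurableT (u k ^- m.*2) (cos_remainder_expectation m (u k) IH).1.
  by congr (integrable _ _ _); apply/funext.
have Eg k : `|(\int[P]_w g k w)%R - q m.*2| <= K * u k.
  have -> : (\int[P]_w g k w)%R = u k ^- m.*2 * (\int[P]_w cos_remainder m (u k * Y w))%R.
    by rewrite RintegralZl//; exact: (cos_remainder_expectation m (u k) IH).1.
  rewrite (cos_remainder_expectation m (u k) IH).2.
  have := normc_Re (phi (u k) - imag_poly m.*2.+1 q (u k)).
  rewrite cReD cReN Re_imag_poly big_ord_recr/=.
  set a := \sum_(i < m) _ => h.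
  have {}h := le_trans h (HK (u k) _).
  have {h} := h _; rewrite ger0_norm ?(ltW (u0 k))// => /(_ (u1 k)).
  have s2 : (-1) ^+ m * (-1) ^+ m = 1 :> R by rewrite -exprMn mulrNN mulr1 expr1n.
  have sn : `|(-1) ^+ m| = 1 :> R by rewrite normrX normrN1 expr1n.
  move: s2 sn; set s := (-1) ^+ m => s2 sn h.
  set r := Re _ in h *.
  have -> : u k ^- m.*2 * (s * (r - a)) - q m.*2 =
      u k ^- m.*2 * (s * (r - (a + s * q m.*2 * u k ^+ m.*2))).
    have -> : s * (r - (a + s * q m.*2 * u k ^+ m.*2)) = s * (r - a) - (s * s) * q m.*2 * u k ^+ m.*2 by ring.
    by rewrite s2 mul1r [RHS]mulrBr; congr (_ - _); rewrite [RHS]mulrCA mulVf ?mulr1.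
  rewrite !normrM sn mul1r normfV normrX (ger0_norm (ltW (u0 k))).
  by rewrite [leLHS]mulrC ler_pdivrMr ?exprn_gt0// -(mulrA K) -exprS.
have bnd k w := cos_remainder_bounds m (u k * Y w) (ltn0Sn n).
have gle k w : 0 <= g k w <= Y w ^+ m.*2 / m.*2`!%:R.
  have [h1 h2 _] := bnd k w; rewrite /g; apply/andP; split.
    by rewrite mulr_ge0// invr_ge0 exprn_ge0// (ltW (u0 k)).
  rewrite [leLHS]mulrC ler_pdivrMr ?exprn_gt0//; apply: le_trans h2 _.
  by apply/eq_ler; rewrite exprMn; ring.
have gcv w : (fun k => g k w) @ \oo --> Y w ^+ m.*2 / m.*2`!%:R.
  set y := Y w; pose c := y ^+ m.+1.*2 / m.+1.*2`!%:R.
  have low k : y ^+ m.*2 / m.*2`!%:R - u k * (u k * c) <= g k w.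
    have [_ _ h3] := bnd k w; rewrite /g [leRHS]mulrC ler_pdivlMr ?exprn_gt0//.
    apply: le_trans h3; apply/eq_ler; rewrite /c doubleS !exprMn -/y !exprS; ring.
  apply: (@squeeze_cvgr _ _ _ _ (fun k => y ^+ m.*2 / m.*2`!%:R - u k * (u k * c))
      (fun=> y ^+ m.*2 / m.*2`!%:R)).
  - by near=> k; rewrite low/=; case/andP: (gle k w).
  - rewrite -[X in _ --> X]subr0; apply: cvgB; first exact: cvg_cst.
    rewrite -(mul0r (0 * c)); apply: cvgM => //; apply: cvgM => //; exact: cvg_cst.
  - exact: cvg_cst.
have [|iY _] := fatou_integrable P g _ (q m.*2 + K) ig (fun k w => proj1 (andP (gle k w))) gcv.
  move=> k; rewrite -lerBlDl; apply: le_trans (ler_norm _) _; apply: le_trans (Eg k) _.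
  by rewrite ler_piMr.
split => //.
have [| |_ cI] := @Rintegral_dominated_cvg _ _ _ P setT measurableT g _ _ _ (fun w _ => gcv w) iY.
- by move=> k; apply/measurable_EFinP; case/integrableP: (ig k).
- by move=> k w _; case/andP: (gle k w) => ? ?; rewrite ger0_norm.
apply/eqP; rewrite -subr_eq0 -normr_le0.
have cd : (fun k => `|(\int[P]_w g k w)%R - q m.*2|) @ \oo --> `|even_moment m - q m.*2|.
  by apply: cvg_norm; apply: cvgB => //; exact: cvg_cst.
have cK : (fun k => K * u k) @ \oo --> K * 0 by apply: cvgM => //; exact: cvg_cst.
rewrite -(mulr0 K) -(cvg_lim _ cd)// -(cvg_lim _ cK)//.
apply: ler_lim; [by apply/cvg_ex; eexists; exact: cd|by apply/cvg_ex; eexists; exact: cK|].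
by near=> k.
Unshelve. all: by end_near. Qed.

End MomentsFromCharacteristicFunction.

(** * Exponential moments and expectations of power series *)

Section ExponentialMoment.
Context {d : measure_display} {Omega : measurableType d} {R : realType}.
Variables (P : probability Omega R) (Y : Omega -> R) (q : nat -> R) (A B : R).
Hypothesis mY : measurable_fun setT Y.
Hypothesis A0 : 0 < A.
Hypothesis even_moments : forall n, has_even_moment P Y q n.
Hypothesis q_bound : forall N, \sum_(n < N) `|q n| * A ^+ n <= B.

(** Twice the hyperbolic cosine: it dominates [exp (A |y|)], and its power series involves even
    powers only. *)
Definition exp_majorant (y : R) : R := expR (A * y) + expR (- (A * y)).

Lemma expR_abs_le (y : R) : expR (A * `|y|) <= exp_majorant y.
Proof.
rewrite /exp_majorant; have [y0|y0] := leP 0 y.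
  by rewrite ger0_norm// lerDl expR_ge0.
by rewrite ltr0_norm// mulrN lerDr expR_ge0.
Qed.

Lemma exp_sum_le (x : R) N : 0 <= x -> \sum_(n < N) exp_coeff x n <= expR x.
Proof.
move=> x0; rewrite -(series_ord (exp_coeff x)); apply: series_ge0_le_lim.
  by move=> k; rewrite exp_coeff_ge0.
exact: is_cvg_series_exp_coeff.
Qed.

Lemma exp_majorantP N w : \sum_(n < N) taylor_term 0 n (A * `|Y w|) <= exp_majorant (Y w).
Proof.
apply: le_trans (expR_abs_le _); apply: le_trans (exp_sum_le _ N _); last first.
  by rewrite mulr_ge0// ltW.
by apply: ler_sum => n _; rewrite /taylor_term /= exp_coeffE.
Qed.

Lemma exp_even_sum (x : R) N : \sum_(n < N) 2 * (x ^+ n.*2 / n.*2`!%:R) =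
  series (exp_coeff x) N.*2 + series (exp_coeff (- x)) N.*2.
Proof.
rewrite !series_ord; elim: N => [|N IH]; first by rewrite !big_ord0 addr0.
have e1 : (- x) ^+ N.*2 = x ^+ N.*2 by rewrite -mul2n !exprM sqrrN.
have e2 : (- x) ^+ N.*2.+1 = - x ^+ N.*2.+1 by rewrite !exprS e1 mulNr.
by rewrite doubleS !big_ord_recr/= IH !exp_coeffE e1 e2; ring.
Qed.

Lemma exp_even_cvg (x : R) :
  (fun N => \sum_(n < N) 2 * (x ^+ n.*2 / n.*2`!%:R)) @ \oo --> expR x + expR (- x).
Proof.
have dbl : (fun n => n.*2) @ \oo --> \oo.
  apply/cvgnyPge => M; near=> n; apply: (@leq_trans n); first by near: n; exact: nbhs_infty_ge.
  by rewrite -addnn leq_addr.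
under eq_fun do rewrite exp_even_sum.
by apply: cvgD; apply: (cvg_comp _ _ dbl); exact: is_cvg_series_exp_coeff.
Unshelve. all: by end_near. Qed.

(** The partial sums have expectations [2 q n.*2 A ^ n.*2] summed over [n], which is at most twice
    the sum bounded by [B]; Fatou's lemma passes to the limit. *)
Lemma exp_majorant_integrable :
  P.-integrable setT (EFin \o (fun w => exp_majorant (Y w))) /\
  (\int[P]_w exp_majorant (Y w))%R <= 2 * B.
Proof.
pose f N w := \sum_(n < N) (2 * A ^+ n.*2) * (Y w ^+ n.*2 / n.*2`!%:R).
have i1 n : P.-integrable setT (EFin \o (fun w => (2 * A ^+ n.*2) * (Y w ^+ n.*2 / n.*2`!%:R))).
  have := integrableZl measurableT (2 * A ^+ n.*2) (even_moments n).1.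
  by congr (integrable _ _ _); apply/funext.
have term_ge0 n w : 0 <= (2 * A ^+ n.*2) * (Y w ^+ n.*2 / n.*2`!%:R).
  apply: mulr_ge0; first by rewrite mulr_ge0// exprn_ge0// ltW.
  by rewrite divr_ge0// -mul2n exprM exprn_ge0// sqr_ge0.
apply: (fatou_integrable P f).
- by move=> N; exact: (@integrable_bigsum _ _ _ P setT measurableT
    (fun n w => (2 * A ^+ n.*2) * (Y w ^+ n.*2 / n.*2`!%:R))).
- by move=> N w; apply: sumr_ge0 => n _; exact: term_ge0.
- move=> w; have -> : f ^~ w = (fun N => \sum_(n < N) 2 * ((A * Y w) ^+ n.*2 / n.*2`!%:R)).
    by apply/funext => N; apply: eq_bigr => n _; rewrite exprMn !mulrA.
  exact: exp_even_cvg.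
- move=> N; rewrite (@Rintegral_bigsum _ _ _ P setT measurableT
    (fun n w => (2 * A ^+ n.*2) * (Y w ^+ n.*2 / n.*2`!%:R)))//.
  apply: le_trans (ler_wpM2l _ (q_bound N.*2)) => //.
  rewrite mulr_sumr; elim: N => [|N IH]; first by rewrite !big_ord0.
  rewrite doubleS !big_ord_recr/= -addrA; apply: lerD => //.
  rewrite RintegralZl//; last exact: (even_moments N).1.
  rewrite -/(even_moment P Y N) (even_moments N).2 -mulrA; apply: ler_wpDr.
    by rewrite !mulr_ge0 ?exprn_ge0 ?(ltW A0).
  by rewrite ler_wpM2l// mulrC ler_wpM2r ?exprn_ge0 ?(ltW A0)// ler_norm.
Qed.

Variable phi : R -> R[i].
Hypothesis phiE : forall u, phi u = cintegral P setT (fun w => cexp (Complex 0 (u * Y w))).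
Hypothesis phi_taylor : forall N, (2 <= N)%N -> taylor_approx N.+1 phi q.

(** Given the exponential moment, the true moments are Taylor coefficients of [phi]; uniqueness
    identifies them with [q], odd orders included. *)
Lemma all_moments n : moment P Y 0 n = q n.
Proof.
have [_ h] := cexp_remainder_moment P Y _ A 0 A0 mY exp_majorant_integrable.1 exp_majorantP
  n.+3 (leq0n _).
have h' : taylor_approx n.+3 phi (moment P Y 0).
  move: h; congr (taylor_approx _ _ _); apply/funext => u; rewrite phiE; congr (cintegral _ _ _).
  by apply/funext => w; rewrite /cexp_poly big_ord0 subr0.
exact: (taylor_approx_unique _ _ _ _ h' (phi_taylor n.+2 isT) n (leqW (leqW (leqnn _)))).
Qed.

Lemma exp_expectation {C t u} (x : R) : 0 <= t -> t <= A -> geo_bounded C t u ->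
  P.-integrable setT (EFin \o (fun w => rser u (x + Y w))) /\
  (\int[P]_w rser u (x + Y w))%R = limn (series (fun n => translate x u n * q n)).
Proof.
move=> t0 tA bu; have bF := geo_bounded_translate x t0 bu.
have [|ig ->] := moment_series P Y _ A 0 A0 mY exp_majorant_integrable.1 exp_majorantP
  (translate x u) _ (fun w => rser u (x + Y w)) (geo_bounded_le t0 tA bF) _.
  move=> w; rewrite (rserD x (Y w) t0 bu).
  have -> : (fun N => \sum_(n < N) translate x u n * taylor_term 0 n (Y w)) =
      series (fun k => translate x u k * Y w ^+ k / k`!%:R).
    by apply/funext => N; rewrite series_ord; apply: eq_bigr => n _; rewrite /taylor_term/= mulrA.
  exact: (rser_cvg (Y w) t0 bF).
split => //; congr (limn (series _)); apply/funext => n; by rewrite all_moments mulrC.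
Qed.

End ExponentialMoment.

(** * Expectations along a Levy increment *)

Section LevyIncrement.
Context {R : realType} {d : measure_display} {Omega : measurableType d}.
Variables (b a alpha : R) (nu : {measure set (measurableTypeR R) -> \bar R}).
Hypothesis alpha_gt0 : 0 < alpha.
Hypothesis nu_levy : levy_measure nu.
Hypothesis exp_moment :
  (\int[nu]_(y in [set y : R | (1 < `|y|)%R]) (expR (alpha * `|y|))%:E < +oo)%E.
Variables (P : probability Omega R) (Y : Omega -> R) (s : R).
Hypothesis mY : measurable_fun setT Y.
Hypothesis Y_law : forall u, cintegral P setT (fun w => cexp (Complex 0 (u * Y w))) =
  cexp (ofR s * levy_exponent b a nu u).
Local Notation lam := (levy_symbol b a nu).
Local Notation q := (semi_moment lam s).
Local Notation Lam := (symbol_norm lam alpha).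
Local Notation lam_cvg := (levy_symbol_cvg b a alpha nu alpha_gt0 nu_levy exp_moment).

Lemma levy_even_moment n : has_even_moment P Y q n.
Proof.
apply: (phi_even_moments P Y q mY (fun u => cexp (ofR s * levy_exponent b a nu u))) => [u||N N2].
- rewrite -Y_law /cintegral /=; apply: eq_Rintegral => w _.
  by rewrite expR0 mul1r.
- rewrite (@semi_momentE _ lam (levy_symbol0 b a nu) s 0 1)// big_ord1 expr0 fact0.
  by rewrite mulr1 divr1.
- exact: (levy_cf_taylor b a alpha nu alpha_gt0 nu_levy exp_moment s N N2).
Qed.

Lemma levy_exp_moment :
  P.-integrable setT (EFin \o (fun w => exp_majorant alpha (Y w))) /\
  (\int[P]_w exp_majorant alpha (Y w))%R <= 2 * expR (Lam * `|s|).
Proof.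
apply: (exp_majorant_integrable P Y q alpha _ alpha_gt0 levy_even_moment).
exact: (semi_moment_norm lam alpha alpha_gt0 lam_cvg (levy_symbol0 b a nu) s).
Qed.

Lemma levy_expectation {C t u} (x : R) : 0 <= t -> t < alpha -> geo_bounded C t u ->
  P.-integrable setT (EFin \o (fun w => rser u (x + Y w))) /\
  (\int[P]_w rser u (x + Y w))%R = rser (semi lam s u) x.
Proof.
move=> t0 ta bu; have [ig ->] := exp_expectation P Y q alpha _ mY alpha_gt0 levy_even_moment
  (semi_moment_norm lam alpha alpha_gt0 lam_cvg (levy_symbol0 b a nu) s)
  (fun u => cexp (ofR s * levy_exponent b a nu u)) (fun u => esym (Y_law u))
  (levy_cf_taylor b a alpha nu alpha_gt0 nu_levy exp_moment s) x t0 (ltW ta) bu.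
split => //; rewrite (rser_semi_translate lam alpha alpha_gt0 lam_cvg s x t0 (ltW ta) bu).
by rewrite (semi_deltas lam alpha alpha_gt0 lam_cvg s t0 ta (geo_bounded_translate x t0 bu)).
Qed.

End LevyIncrement.

(** * Independence, measurability and path integrals *)

Section Independence.
Context {d1 d2 : measure_display} {T1 : measurableType d1} {T2 : measurableType d2} {R : realType}.
Variables (P : probability T1 R) (U : T1 -> T2) (Y Y' : T1 -> R).
Hypotheses (mU : measurable_fun setT U) (mY : measurable_fun setT Y) (mY' : measurable_fun setT Y').
Hypothesis independent : forall (B1 : set T2) (B2 : set (measurableTypeR R)),
  measurable B1 -> measurable B2 ->
  (P (U @^-1` B1 `&` Y @^-1` B2) = P (U @^-1` B1) * P (Y' @^-1` B2))%E.

Lemma independent_expectation (h : T2 * R -> R) : measurable_fun setT h ->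
  P.-integrable setT (fun w => (h (U w, Y w))%:E) ->
  (forall x, P.-integrable setT (fun w => (h (x, Y' w))%:E)) ->
  P.-integrable setT (fun w => (\int[P]_v h (U w, Y' v))%R%:E) /\
  (\int[P]_w h (U w, Y w))%R = (\int[P]_w (\int[P]_v h (U w, Y' v)))%R.
Proof.
move=> mh ih ih'.
pose MU : {mfun T1 >-> T2} := HB.pack U (isMeasurableFun.Build _ _ _ _ U mU).
pose MY : {mfun T1 >-> measurableTypeR R} := HB.pack Y' (isMeasurableFun.Build _ _ T1 (measurableTypeR R) Y' mY').
have mUY : measurable_fun setT (fun w => (U w, Y w)) by exact: measurable_fun_pair.
pose MP : {mfun T1 >-> (T2 * measurableTypeR R)%type} := HB.pack (fun w => (U w, Y w))
  (isMeasurableFun.Build _ _ T1 (T2 * measurableTypeR R)%type (fun w => (U w, Y w)) mUY).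
pose m1 := distribution P MU; pose m2 := distribution P MY; pose m := distribution P MP.
have prodE (B : set (T2 * measurableTypeR R)) : measurable B -> (m1 \x m2)%E B = m B.
  apply: product_measure_unique => A1 A2 mA1 mA2.
  rewrite /m /m1 /m2 /distribution /pushforward -independent//; congr (P _).
have mhE : measurable_fun setT (fun p : T2 * measurableTypeR R => (h p)%:E) by exact/measurable_EFinP.
have im : m.-integrable setT (fun p => (h p)%:E).
  by apply: integrable_pushforward.
have im12 : (m1 \x m2)%E.-integrable setT (fun p => (h p)%:E).
  apply/integrableP; split => //.
  rewrite (eq_measure_integral m) => [|A mA _]; last exact: prodE.
  by case/integrableP: im.
have inner x : fubini_F m2 (fun p => (h p)%:E) x = (\int[P]_v h (x, Y' v))%R%:E.
  rewrite /fubini_F /m2 /distribution integral_pushforward//=; last exact: ih'.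
    by rewrite /Rintegral fineK//; exact: (integrable_fin_num _ (ih' x)).
  by apply: measurableT_comp mhE _; exact: measurable_pair1.
have im1 := integrable_fubini_F im12.
have E1 := integral12_prod_meas1 im12.
have FE : fubini_F m2 (fun p => (h p)%:E) = (fun x => (\int[P]_v h (x, Y' v))%R%:E).
  by apply/funext.
rewrite FE in im1 E1.
have mF := measurable_int _ im1.
have iU : P.-integrable setT (fun w => (\int[P]_v h (U w, Y' v))%R%:E).
  apply/integrableP; split; first exact: measurableT_comp mF mU.
  case/integrableP: im1 => _; rewrite /m1 /distribution ge0_integral_pushforward//.
  by apply: measurableT_comp.
split => //.
have E2 : (\int[m]_p (h p)%:E = \int[P]_w (h (U w, Y w))%:E)%E.
  by rewrite /m /distribution integral_pushforward.
rewrite {1}/Rintegral -E2.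
rewrite (eq_measure_integral (m1 \x m2)%E) => [|A mA _]; last exact/esym/prodE.
by rewrite -E1 /m1 /distribution integral_pushforward.
Qed.

End Independence.

(** * Exchanging expectation and time integral *)

Section TimeIntegral.
Context {d : measure_display} {Omega : measurableType d} {R : realType}.
Variables (P : probability Omega R) (Z : R -> Omega -> R) (s t K : R).
Hypothesis st : s <= t.
Hypothesis mZ : measurable_fun setT (fun p : measurableTypeR R * Omega => Z p.1 p.2).
Hypothesis Z_bound : forall r, s <= r <= t -> (\int[P]_w (`|Z r w|)%:E <= K%:E)%E.

Lemma time_integral_Fubini (A : set Omega) : measurable A ->
  P.-integrable A (fun w => \int[lebesgue_measure]_(r in `[s, t]) (Z r w)%:E)%E /\
  (\int[P]_(w in A) (\int[lebesgue_measure]_(r in `[s, t]) (Z r w)%:E) =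
   \int[lebesgue_measure]_(r in `[s, t]) \int[P]_(w in A) (Z r w)%:E)%E.
Proof.
move=> mA; set B : set (measurableTypeR R) := `[s, t]%classic.
have mB : measurable B by exact: measurable_itv.
have lB : (lebesgue_measure B < +oo)%E.
  by rewrite (_ : lebesgue_measure B = lebesgue_measure `[s, t])// lebesgue_measure_itv/=;
    case: ifP => _; rewrite ?ltry// -EFinB ltry.
(* Extension by zero from the rectangle turns both restricted integrals into integrals over the full
   product space. *)
pose H (p : measurableTypeR R * Omega) : \bar R := ((fun p => (Z p.1 p.2)%:E) \_ (B `*` A)) p.
have mH : measurable_fun setT H.
  apply/(measurable_restrictT _ _).1; first exact: measurableX.
  by apply: (measurable_funS measurableT) => //; exact/measurable_EFinP.
have HE r w : H (r, w) = if r \in B then ((fun w => (Z r w)%:E) \_ A) w else 0%E.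
  rewrite /H /patch in_setX /=; by case: (r \in B).
have FE : fubini_F P H = ((fun r => \int[P]_(w in A) (Z r w)%:E) \_ B)%E.
  apply/funext => r; rewrite /fubini_F /patch; case: ifPn => rB.
    by rewrite [RHS]integral_mkcond; apply: eq_integral => w _; rewrite HE rB.
  by apply: integral0_eq => w _; rewrite HE (negbTE rB).
have GE : fubini_G lebesgue_measure H = ((fun w => \int[lebesgue_measure]_(r in B) (Z r w)%:E) \_ A)%E.
  apply/funext => w; rewrite /fubini_G /patch; case: ifPn => wA.
    rewrite [RHS]integral_mkcond; apply: eq_integral => r _; rewrite HE /patch.
    by case: ifP => // _; rewrite wA.
  by apply: integral0_eq => r _; rewrite HE /patch (negbTE wA); case: ifP.
have K0 : 0 <= K.
  by rewrite -lee_fin; apply: le_trans (Z_bound s _); rewrite ?lexx ?st// integral_ge0.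
have iH : (lebesgue_measure \x P)%E.-integrable setT H.
  apply/integrable12ltyP => //.
  apply: (@le_lt_trans _ _ (\int[lebesgue_measure]_r (cst K%:E \_ B) r)%E); last first.
    by rewrite -integral_mkcond integral_cst//; apply: lte_mul_pinfty.
  apply: ge0_le_integral => //.
  - by move=> r _; exact: integral_ge0.
  - have := @measurable_fun_fubini_tonelli_F _ _ _ _ R P (fun p => `|H p|)%E.
    by apply => //; exact: measurableT_comp.
  - by apply/(measurable_restrictT _ _).1 => //; exact: measurable_cst.
  move=> r _; rewrite /patch; case: ifPn => rB; last first.
    by rewrite integral0_eq// => w _; rewrite HE (negbTE rB) abse0.
  have rB' : s <= r <= t by move: rB; rewrite inE /B /= in_itv.
  apply: le_trans (Z_bound r rB'); apply: ge0_le_integral => //.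
  - apply: measurableT_comp => //; apply: measurableT_comp mH _; exact: measurable_pair1.
  - apply/measurable_EFinP; apply: measurableT_comp => //.
    exact: (measurableT_comp mZ (@measurable_pair1 _ _ _ _ r)).
  by move=> w _; rewrite HE rB /patch; case: ifP => _ //; rewrite abse0 lee_fin.
split.
  rewrite integrable_mkcond// -GE; apply/integrableP; split; first exact: (measurable_fubini_G iH).
  apply: (@le_lt_trans _ _ (\int[P]_w \int[lebesgue_measure]_r `|H (r, w)|)%E).
    apply: ge0_le_integral => //.
    - by apply: measurableT_comp => //; exact: (measurable_fubini_G iH).
    - have := @measurable_fun_fubini_tonelli_G _ _ _ _ R lebesgue_measure (fun p => `|H p|)%E.
      by apply => //; exact: measurableT_comp.
    move=> w _; apply: le_abse_integral => //.
    by apply: measurableT_comp mH _; exact: measurable_pair2.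
  have := (integrable12ltyP lebesgue_measure P mH).1 iH.
  by rewrite (fubini_tonelli (fun p => `|H p|)%E)//; exact: measurableT_comp.
have := Fubini iH.
rewrite -[X in X = _ -> _]/(\int[lebesgue_measure]_r fubini_F P H r)%E.
rewrite -[X in _ = X -> _]/(\int[P]_w fubini_G lebesgue_measure H w)%E.
by rewrite FE GE -!integral_mkcond.
Qed.

End TimeIntegral.

(** * Joint measurability of right-continuous processes *)

Section RightContinuous.
Context {d : measure_display} {Omega : measurableType d} {R : realType}.
Variable Z : R -> Omega -> R.
Hypothesis mZ : forall r, measurable_fun setT (Z r).
Hypothesis rcZ : forall w r, Z s w @[s --> r^'+] --> Z r w.

(** The least multiple of [1 / n.+1] strictly above [r]; a right limit at [r] is taken along points
    strictly above. *)
Definition grid n (r : R) : R := (Num.floor (n.+1%:R * r) + 1)%:~R / n.+1%:R.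

Lemma grid_bounds n r : r < grid n r <= r + n.+1%:R^-1.
Proof.
have n0 : 0 < n.+1%:R :> R by [].
rewrite /grid ltr_pdivlMr// [r * _]mulrC floorD1_gt/= ler_pdivrMr// mulrDl mulVf ?gt_eqF//.
by rewrite intrD lerD2r [r * _]mulrC floor_le.
Qed.

(** Sampled at the grid, the process has preimages that are countable unions of measurable
    rectangles; right continuity makes it the pointwise limit. *)
Lemma measurable_right_continuous :
  measurable_fun setT (fun p : measurableTypeR R * Omega => Z p.1 p.2).
Proof.
pose Zn n (p : measurableTypeR R * Omega) := Z (grid n p.1) p.2.
have mZn n : measurable_fun setT (Zn n).
  move=> _ B mB; rewrite setTI.
  pose I (k : int) : set (measurableTypeR R) := [set r | Num.floor (n.+1%:R * r) = k].
  have -> : Zn n @^-1` B = \bigcup_k (I k `*` (Z ((k + 1)%:~R / n.+1%:R) @^-1` B)).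
    apply/seteqP; split => [[r w] /= h|[r w] /= [k _ [/= Ik h]]].
      by exists (Num.floor (n.+1%:R * r)).
    by rewrite /Zn/= /grid Ik.
  apply: countable_bigcupT_measurable => // k; apply: measurableX.
    have -> : I k = `[k%:~R / n.+1%:R, (k + 1)%:~R / n.+1%:R[%classic.
      apply/seteqP; split => r; rewrite /I /= in_itv/= ler_pdivrMr// ltr_pdivlMr// [r * _]mulrC.
        by move=> <-; rewrite floor_le floorD1_gt.
      by rewrite -floor_eq => /eqP.
    exact: measurable_itv.
  by rewrite -[X in measurable X]setTI; exact: mZ.
apply: (measurable_fun_cvg mZn) => -[r w] _ /=.
apply: (cvg_comp (fun n => grid n r) (fun s => Z s w)) (rcZ w r).
move=> S [e e0 Se].
have [N _ HN] : \forall n \near \oo, n.+1%:R^-1 < e by exact: near_infty_natSinv_lt (PosNum e0).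
exists N => // n /= Nn; have /andP[g1 g2] := grid_bounds n r.
apply: Se => //=; rewrite ltr0_norm ?subr_lt0// opprB ltrBlDl.
by apply: le_lt_trans g2 _; rewrite ltrD2l; exact: HN.
Qed.

End RightContinuous.

(** * Cadlag paths: boundedness and integrals *)

Section CadlagPath.
Context {R : realType}.
Implicit Types (x g q : R -> R) (r s t T K M e : R).

Definition cadlag_path T x :=
  (forall t, 0 <= t < T -> x s @[s --> t^'+] --> x t) /\
  (forall t, 0 < t <= T -> cvg (x s @[s --> t^'-])).

Lemma cadlag_path_cvg_bounded (Fl : set_system R) x l : Filter Fl ->
  x s @[s --> Fl] --> l -> \forall s \near Fl, `|x s| <= `|l| + 1.
Proof.
move=> FF /cvgrPdist_le/(_ 1 ltr01); apply: filterS => s h.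
rewrite -lerBlDl; apply: le_trans (lerB_dist _ _) _.
by rewrite distrC.
Qed.

Lemma cadlag_path_locally_bounded T x t : cadlag_path T x -> 0 <= t <= T ->
  exists M e, 0 < e /\ forall s, `|t - s| < e -> 0 <= s <= T -> `|x s| <= M.
Proof.
move=> [xr xl] /andP[t0 tT].
have [M1 [e1 [e10 H1]]] : exists M e, 0 < e /\ forall s, t < s -> `|t - s| < e -> 0 <= s <= T -> `|x s| <= M.
  have [tT'|tT'] := ltP t T; last first.
    exists 0, 1; split => // s ts _ /andP[_ sT].
    by have := lt_le_trans (le_lt_trans tT' ts) sT; rewrite ltxx.
  have [|e e0 He] := cadlag_path_cvg_bounded _ _ _ _ (xr t _); first by rewrite t0.
  by exists (`|x t| + 1), e; split => // s ts ets _; apply: He.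
have [M2 [e2 [e20 H2]]] : exists M e, 0 < e /\ forall s, s < t -> `|t - s| < e -> 0 <= s <= T -> `|x s| <= M.
  have [t0'|t0'] := ltP 0 t; last first.
    exists 0, 1; split => // s ts _ /andP[s0 _].
    by have := lt_le_trans (le_lt_trans s0 ts) t0'; rewrite ltxx.
  have /cvg_ex[l xtl] := xl t (introT andP (conj t0' tT)).
  have [e e0 He] := cadlag_path_cvg_bounded _ _ _ _ xtl.
  by exists (`|l| + 1), e; split => // s ts ets _; apply: He.
exists (Num.max (Num.max M1 M2) `|x t|), (Num.min e1 e2); rewrite lt_min e10 e20; split => // s.
rewrite lt_min !le_max => /andP[s1 s2] sT; have [st|st|<-] := ltgtP s t.
- by rewrite H2 ?orbT.
- by rewrite H1.
- by rewrite lexx !orbT.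
Qed.

(** One-sided limits bound the path near each time. Compactness of [[0, T]], in the form of near
    coverings with the bound tending to infinity, makes the bound uniform. *)
Lemma cadlag_path_bounded T x : cadlag_path T x ->
  exists M, forall s, 0 <= s <= T -> `|x s| <= M.
Proof.
move=> cx; have [T0|T0] := leP 0 T; last first.
  exists 0 => s /andP[s0 sT].
  by have := lt_le_trans (le_lt_trans (le_trans s0 sT) T0) (lexx 0); rewrite ltxx.
have /compact_near_coveringP cov := @segment_compact R 0 T.
have [|M [_ HM]] := cov R (pinfty_nbhs R) (fun M s => 0 <= s <= T -> `|x s| <= M) _ _.
  move=> t; rewrite /= in_itv/= => t0T.
  have [M [e [e0 HM]]] := cadlag_path_locally_bounded _ _ _ cx t0T.
  exists (ball t e, [set M' | M < M']); first by split => /=; [exact: nbhsx_ballx|apply: nbhs_pinfty_gt; exact: num_real].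
  by move=> [s M'] [/= ts MM'] s0T; apply: le_trans (HM _ ts s0T) (ltW MM').
exists (M + 1) => s s0T; apply: (HM (M + 1)); first by rewrite ltrDl.
  by rewrite /= in_itv.
by [].
Qed.

Lemma integral_lipschitz T q K : 0 <= K ->
  lebesgue_measure.-integrable `[0, T] (EFin \o q) ->
  (forall s, 0 <= s <= T -> `|q s| <= K) ->
  forall s t, 0 <= s -> s <= t -> t <= T ->
    (\int[lebesgue_measure]_(r in `[0, t]) q r -
     \int[lebesgue_measure]_(r in `[0, s]) q r = \int[lebesgue_measure]_(r in `[s, t]) q r)%R /\
    `|(\int[lebesgue_measure]_(r in `[s, t]) q r)%R| <= K * (t - s).
Proof.
move=> K0 iq qK s t s0 st tT.
have sub a b : 0 <= a -> b <= T -> lebesgue_measure.-integrable `[a, b] (EFin \o q).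
  move=> a0 bT; apply: (integrableS _ _ _ iq) => //.
  by move=> r /=; rewrite !in_itv/= => /andP[ar rb]; rewrite (le_trans a0 ar) (le_trans rb bT).
split.
  rewrite (@Rintegral_itvB R q (BLeft 0) (BRight t) s).
  - rewrite Rintegral_itv_obnd_cbnd//; apply: (integrableS _ _ _ (sub s t s0 tT)) => //.
    by apply: subset_itvr; rewrite bnd_simp.
  - exact: sub.
  - by rewrite bnd_simp.
  - by rewrite bnd_simp.
have iK : lebesgue_measure.-integrable `[s, t] (EFin \o (fun=> K)).
  apply: continuous_integrable_itv; exact: cst_continuous.
apply: le_trans (le_normr_Rintegral _ (sub s t s0 tT)) _ => //.
apply: (@le_trans _ _ (\int[lebesgue_measure]_(r in `[s, t]) K)%R).
  apply: le_Rintegral => //; first exact: (integrable_abse (sub s t s0 tT)).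
  by move=> r /=; rewrite in_itv/= => /andP[sr rt]; apply: qK; rewrite (le_trans s0 sr) (le_trans rt tT).
rewrite Rintegral_cst//= lebesgue_measure_itv/= lte_fin.
case: ltP => [|ts]; first by rewrite -EFinB.
by rewrite mulr0 mulr_ge0// subr_ge0.
Qed.

Lemma cadlag_path_integral T q K : 0 <= K ->
  lebesgue_measure.-integrable `[0, T] (EFin \o q) ->
  (forall s, 0 <= s <= T -> `|q s| <= K) ->
  cadlag_path T (fun t => \int[lebesgue_measure]_(r in `[0, t]) q r)%R.
Proof.
move=> K0 iq qK; set I := (fun t => _).
have lip s t : 0 <= s -> s <= t -> t <= T -> `|I t - I s| <= K * (t - s).
  by move=> s0 st tT; have [-> ] := integral_lipschitz T q K K0 iq qK s t s0 st tT.
have K1 : 0 < K + 1 by rewrite ltr_wpDl.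
have aux (r e : R) : 0 < e -> 0 <= r -> r < e / (K + 1) -> K * r <= e.
  move=> e0 r0 re; apply: (@le_trans _ _ ((K + 1) * r)).
    by rewrite ler_wpM2r// lerDl.
  by rewrite mulrC -ler_pdivlMr// ltW.
split => t /andP[t0 tT].
  apply/cvgrPdist_le => e e0; near=> s.
  have ts : t < s by near: s; exact: nbhs_right_gt.
  have sT : s <= T by near: s; exact: nbhs_right_le.
  rewrite distrC; apply: le_trans (lip t s t0 (ltW ts) sT) _.
  apply: aux => //; first by rewrite subr_ge0 ltW.
  rewrite ltrBlDl; near: s; apply: nbhs_right_lt.
  by rewrite ltrDl divr_gt0.
apply/cvg_ex; exists (I t); apply/cvgrPdist_le => e e0; near=> s.
have ts : s < t by near: s; exact: nbhs_left_lt.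
have s0 : 0 <= s by near: s; exact: nbhs_left_ge.
apply: le_trans (lip s t s0 (ltW ts) tT) _.
apply: aux => //; first by rewrite subr_ge0 ltW.
rewrite ltrBlDr -ltrBlDl; near: s; apply: nbhs_left_gt.
by rewrite ltrBlDr ltrDl divr_gt0.
Unshelve. all: by end_near. Qed.

Lemma cadlag_path_comp T x g : continuous g -> cadlag_path T x -> cadlag_path T (g \o x).
Proof.
move=> cg [xr xl]; split => t tT.
  by apply: (cvg_comp _ _ (xr t tT)); exact: cg.
have /cvg_ex[l xtl] := xl t tT; apply/cvg_ex; exists (g l).
by apply: (cvg_comp _ _ xtl); exact: cg.
Qed.

Lemma cadlag_path_add T x g (c : R) : cadlag_path T x -> cadlag_path T g ->
  cadlag_path T (fun t => x t - c - g t).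
Proof.
move=> [xr xl] [gr gl]; split => t tT.
  by apply: cvgB; [apply: cvgB; [exact: xr|exact: cvg_cst]|exact: gr].
have /cvg_ex[l xtl] := xl t tT; have /cvg_ex[m gtm] := gl t tT.
apply/cvg_ex; exists (l - c - m).
by apply: cvgB => //; apply: cvgB => //; exact: cvg_cst.
Qed.

End CadlagPath.

(** * Measurability of processes frozen outside an interval *)

Section ClippedProcess.
Context {d : measure_display} {Omega : measurableType d} {R : realType}.
Implicit Types (Z : R -> Omega -> R) (t T : R).

(* Freezing the time outside [[0, t]] makes the paths right-continuous on the
   whole line, and involves the process up to time [t] only. *)
Definition clip t (r : R) : R := Num.max 0 (Num.min r t).

Lemma clip_id t r : 0 <= r <= t -> clip t r = r.
Proof. by move=> /andP[r0 rt]; rewrite /clip (min_idPl rt) (max_idPr r0). Qed.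

Lemma clip_itv t r : 0 <= t -> 0 <= clip t r <= t.
Proof. by move=> t0; rewrite /clip le_max lexx /= ge_max t0 ge_min lexx orbT. Qed.

Lemma measurable_clipped Z t T : 0 <= t -> t <= T ->
  (forall r, 0 <= r <= t -> measurable_fun setT (Z r)) ->
  (forall w, cadlag_path T (fun r => Z r w)) ->
  measurable_fun setT (fun p : measurableTypeR R * Omega => Z (clip t p.1) p.2).
Proof.
move=> t0 tT mZ cZ; apply: (measurable_right_continuous (fun r w => Z (clip t r) w)).
  by move=> r; apply: mZ; exact: clip_itv.
move=> w r; have [r0|r0] := ltP r 0.
  have -> : clip t r = 0 by apply/max_idPl; rewrite ge_min (ltW r0).
  apply: (cvg_trans _ (@cvg_cst _ (Z 0 w) _ (r^'+) _)); apply: near_eq_cvg; near=> s.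
  congr (Z _ w); apply/esym/max_idPl; rewrite ge_min; apply/orP; left.
  by near: s; apply: nbhs_right_le.
have [tr|rt] := leP t r.
  have -> : clip t r = t by rewrite /clip (min_idPr tr); exact/max_idPr.
  apply: (cvg_trans _ (@cvg_cst _ (Z t w) _ (r^'+) _)); apply: near_eq_cvg; near=> s.
  congr (Z _ w); apply/esym; rewrite /clip (_ : Num.min s t = t); first exact/max_idPr.
  apply/min_idPr; apply: le_trans tr _; near: s; exact: nbhs_right_ge.
rewrite (clip_id t r); last by rewrite r0 ltW.
have [/(_ r _) xr _] := cZ w.
apply: (cvg_trans _ (xr _)); last by rewrite r0 (lt_le_trans rt).
apply: near_eq_cvg; near=> s; rewrite clip_id//; apply/andP; split.
  by apply: le_trans r0 _; near: s; exact: nbhs_right_ge.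
by near: s; exact: nbhs_right_le.
Unshelve. all: by end_near. Qed.

(** Tonelli's theorem is applied to the positive and the negative part; the integral is by
    definition their difference, whether or not the path is integrable. *)
Lemma measurable_time_integral Z t :
  measurable_fun setT (fun p : measurableTypeR R * Omega => Z p.1 p.2) ->
  measurable_fun setT (fun w => \int[lebesgue_measure]_(r in `[0, t]) Z r w)%R.
Proof.
move=> mZ; set B : set (measurableTypeR R) := `[0, t]%classic.
have mB : measurable B by exact: measurable_itv.
apply: (@measurableT_comp _ _ _ _ _ _ fine _
  (fun w => \int[lebesgue_measure]_(r in B) (Z r w)%:E)%E); first exact: fine_measurable.
have mBT : measurable (B `*` [set: Omega]) by exact: measurableX.
have mZE : measurable_fun setT (fun p : measurableTypeR R * Omega => (Z p.1 p.2)%:E).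
  exact/measurable_EFinP.
have part (h : \bar R -> \bar R) : measurable_fun setT h -> (forall y, 0 <= h y)%E ->
    measurable_fun setT (fun w => \int[lebesgue_measure]_(r in B) h (Z r w)%:E)%E.
  move=> mh h0.
  have mhZ : measurable_fun setT ((fun p : measurableTypeR R * Omega => h (Z p.1 p.2)%:E) \_ (B `*` setT)).
    apply/(measurable_restrictT _ _).1 => //.
    by apply: (measurable_funS measurableT) => //; exact: measurableT_comp mh mZE.
  have := @measurable_fun_fubini_tonelli_G _ _ _ _ R lebesgue_measure _ mhZ.
  rewrite (_ : fubini_G _ _ = (fun w => \int[lebesgue_measure]_(r in B) h (Z r w)%:E)%E).
    by apply=> p; rewrite /patch; case: ifP.
  apply/funext => w; rewrite /fubini_G [RHS]integral_mkcond; apply: eq_integral => r _.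
  by rewrite /patch in_setX in_setT andbT.
rewrite (_ : (fun w => _) = (fun w => \int[lebesgue_measure]_(r in B) (maxe (Z r w)%:E 0) -
    \int[lebesgue_measure]_(r in B) (maxe (- (Z r w)%:E) 0))%E); last first.
  apply/funext => w; rewrite integralE; congr (_ - _)%E; apply: eq_integral => r _.
    by rewrite funeposE.
  by rewrite funenegE.
apply: emeasurable_funB.
  apply: (part (fun y => maxe y 0)) => [|y].
    by apply: measurable_maxe => //; exact: measurable_cst.
  by rewrite le_max lexx orbT.
apply: (part (fun y => maxe (- y) 0)%E) => [|y].
  by apply: measurable_maxe; [exact: oppe_measurable|exact: measurable_cst].
by rewrite le_max lexx orbT.
Qed.

Lemma integrable_clipped Z (g : R -> R) t T w : 0 <= t -> t <= T -> continuous g ->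
  (forall r, 0 <= r <= T -> measurable_fun setT (Z r)) ->
  (forall w, cadlag_path T (fun r => Z r w)) ->
  lebesgue_measure.-integrable `[0, t] (EFin \o (fun r => g (Z r w))).
Proof.
move=> t0 tT cg mZ cZ.
have T0 := le_trans t0 tT.
have mc := measurable_clipped Z T T T0 (lexx T) mZ cZ.
have [K HK] := cadlag_path_bounded _ _ (cadlag_path_comp _ _ _ cg (cZ w)).
have iK : lebesgue_measure.-integrable `[0, t] (EFin \o (fun=> K)).
  apply: continuous_integrable_itv; exact: cst_continuous.
have itvT r : `[0, t]%classic r -> 0 <= r <= T.
  by rewrite /= in_itv/= => /andP[-> rt]; exact: le_trans tT.
apply: (dominated_integrable _ _ _ _ _ iK) => //; last by move=> r rt; apply: HK; exact: itvT.
have mg : measurable_fun setT g by exact: continuous_measurable_fun.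
have m1 : measurable_fun setT (fun r : measurableTypeR R => g (Z (clip T r) w)).
  by apply: (measurableT_comp mg); exact: (measurableT_comp mc (@measurable_pair2 _ _ _ _ w)).
apply: (eq_measurable_fun (fun r : measurableTypeR R => g (Z (clip T r) w))).
  by move=> r; rewrite inE => rt; rewrite clip_id// itvT.
exact: (measurable_funS measurableT).
Qed.

End ClippedProcess.

(** * The martingale property *)

Section LevyMartingale.
Context {R : realType} {d : measure_display} {Omega : measurableType d}.
Variables (P : probability Omega R) (T : R) (F : R -> set (set Omega)).
Variables (b a alpha : R) (nu : {measure set (measurableTypeR R) -> \bar R}).
Variables (X : R -> Omega -> R) (x0 : R).
Hypothesis T_gt0 : 0 < T.
Hypothesis F_filtration : filtration T F.
Hypothesis X_levy : levy_process P T F b a nu X.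
Hypothesis X_0 : forall w, X 0 w = x0.
Hypothesis alpha_gt0 : 0 < alpha.
Hypothesis nu_levy : levy_measure nu.
Hypothesis exp_moment :
  (\int[nu]_(y in [set y : R | (1 < `|y|)%R]) (expR (alpha * `|y|))%:E < +oo)%E.
Implicit Types (C s t r tau x : R) (u v : nat -> R) (A : set Omega).
Local Notation lam := (levy_symbol b a nu).
Local Notation Lam := (symbol_norm lam alpha).
Local Notation lam_cvg := (levy_symbol_cvg b a alpha nu alpha_gt0 nu_levy exp_moment).

Lemma F_measurable {t A} : 0 <= t <= T -> F t A -> measurable A.
Proof. by move=> t0T; case: F_filtration => _ + _; apply. Qed.

Lemma X_measurable {t} : 0 <= t <= T -> measurable_fun setT (X t).
Proof.
move=> t0T _ B mB; rewrite setTI; apply: (F_measurable t0T).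
by case: X_levy => + _ _ _ _; apply.
Qed.

(** [F t] is a bare family of sets. [g_sigma_algebraType (F t)] makes it the measurable structure of
    a copy of [Omega], and generation adds nothing to a sigma-algebra. *)
Lemma measurable_F {t A} : 0 <= t <= T ->
  measurable (A : set (g_sigma_algebraType (F t))) = F t A.
Proof.
move=> t0T; have [FA _ _] := F_filtration.
exact: (congr1 (fun G : set (set Omega) => G A) (measurable_g_measurableTypeE (FA t t0T))).
Qed.

Lemma X_measurable_F {s t} : 0 <= s <= t -> t <= T ->
  measurable_fun (setT : set (g_sigma_algebraType (F t))) (X s).
Proof.
move=> /andP[s0 st] tT _ B mB; rewrite setTI.
have [_ _ FS] := F_filtration.
rewrite measurable_F ?(le_trans s0 st)//.
apply: (FS s t s0 st tT); case: X_levy => + _ _ _ _; apply => //.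
by rewrite s0 (le_trans st).
Qed.

Lemma X_cadlag w : cadlag_path T (fun r => X r w).
Proof. by case: X_levy => _ cX _ _ _; exact: cX. Qed.

Lemma increment_measurable {t} : 0 <= t <= T -> measurable_fun setT (increment X 0 t).
Proof.
by move=> t0T; apply: measurable_funB; apply: X_measurable => //; rewrite lexx ltW.
Qed.

Lemma increment_law {t} : 0 <= t <= T -> forall u : R,
  cintegral P setT (fun w => cexp (Complex 0 (u * increment X 0 t w))) =
  cexp (ofR t * levy_exponent b a nu u).
Proof. by move=> t0T u; case: X_levy => _ _ _ _; apply. Qed.

Lemma X_incrementE t w : X t w = x0 + increment X 0 t w.
Proof. by rewrite /increment X_0 addrC subrK. Qed.

Lemma X_expectation {C tau u t} : 0 <= tau -> tau < alpha -> geo_bounded C tau u -> 0 <= t <= T ->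
  P.-integrable setT (EFin \o (fun w => rser u (X t w))) /\
  (\int[P]_w rser u (X t w))%R = rser (semi lam t u) x0.
Proof.
move=> tau0 taua bu t0T.
have := levy_expectation b a alpha nu alpha_gt0 nu_levy exp_moment P (increment X 0 t) t
  (increment_measurable t0T) (increment_law t0T) x0 tau0 taua bu.
rewrite (_ : (fun w => rser u (x0 + increment X 0 t w)) = (fun w => rser u (X t w)))//.
by apply/funext => w; rewrite -X_incrementE.
Qed.

(** Bounds [E exp (alpha |X_t|)] for all [t <= T]: the starting point enters by the triangle
    inequality, the rest is [levy_exp_moment] at the horizon. *)
Definition exp_bound : R := expR (alpha * `|x0|) * (2 * expR (Lam * T)).

Lemma exp_bound_ge0 : 0 <= exp_bound.
Proof. by rewrite mulr_ge0 ?expR_ge0// mulr_ge0 ?expR_ge0. Qed.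

Lemma symbol_norm_levy_ge0 : 0 <= Lam.
Proof. exact: symbol_norm_ge0 alpha_gt0 lam_cvg. Qed.

Lemma X_exp_moment {t} : 0 <= t <= T ->
  P.-integrable setT (EFin \o (fun w => expR (alpha * `|X t w|))) /\
  (\int[P]_w expR (alpha * `|X t w|))%R <= exp_bound.
Proof.
move=> t0T; have [i1 b1] := levy_exp_moment b a alpha nu alpha_gt0 nu_levy exp_moment P
  (increment X 0 t) t (increment_measurable t0T) (increment_law t0T).
pose g w := expR (alpha * `|x0|) * exp_majorant alpha (increment X 0 t w).
have ig : P.-integrable setT (EFin \o g).
  have := integrableZl measurableT (expR (alpha * `|x0|)) i1.
  by congr (integrable _ _ _); apply/funext.
have le w : `|expR (alpha * `|X t w|)| <= g w.
  rewrite ger0_norm ?expR_ge0// /g.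
  apply: (@le_trans _ _ (expR (alpha * `|x0|) * expR (alpha * `|increment X 0 t w|))).
    by rewrite -expRD ler_expR -mulrDr ler_wpM2l ?(ltW alpha_gt0)// X_incrementE ler_normD.
  by rewrite ler_wpM2l ?expR_ge0//; exact: expR_abs_le.
have mX : measurable_fun setT (fun w => expR (alpha * `|X t w|)).
  apply: measurableT_comp => //; apply: measurable_funM => //.
  by apply: measurableT_comp => //; exact: X_measurable.
split; first exact: dominated_integrable mX (fun w _ => le w) ig.
apply: le_trans (ler_norm _) _.
apply: le_trans (dominated_Rintegral_le _ _ measurableT mX (fun w _ => le w) ig) _.
rewrite RintegralZl// ler_wpM2l ?expR_ge0//; apply: le_trans b1 _.
have /andP[t0 tT] := t0T.
by rewrite ler_wpM2l// ler_expR ger0_norm// ler_wpM2l// symbol_norm_levy_ge0.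
Qed.

Lemma X_rser_abs {C tau u t} : 0 <= tau -> tau <= alpha -> geo_bounded C tau u -> 0 <= t <= T ->
  P.-integrable setT (EFin \o (fun w => rser u (X t w))) /\
  (\int[P]_w `|rser u (X t w)|)%R <= C * exp_bound.
Proof.
move=> tau0 taua bu t0T; have [i1 b1] := X_exp_moment t0T.
have C0 := geo_bounded_ge0 bu.
have ig : P.-integrable setT (EFin \o (fun w => C * expR (alpha * `|X t w|))).
  have := integrableZl measurableT C i1.
  by congr (integrable _ _ _); apply/funext.
have le w : `|rser u (X t w)| <= C * expR (alpha * `|X t w|).
  apply: le_trans (rser_le _ tau0 bu) _.
  by rewrite ler_wpM2l// ler_expR ler_wpM2r.
have mu : measurable_fun setT (fun w => rser u (X t w)).
  apply: measurableT_comp (X_measurable t0T).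
  by apply: continuous_measurable_fun; exact: continuous_rser bu.
split; first exact: dominated_integrable mu (fun w _ => le w) ig.
have le' w : `| (`|rser u (X t w)|) | <= C * expR (alpha * `|X t w|) by rewrite normr_id.
apply: le_trans (ler_norm _) _.
apply: le_trans (dominated_Rintegral_le _ _ measurableT _ (fun w _ => le' w) ig) _.
  by apply: measurableT_comp.
by rewrite RintegralZl// ler_wpM2l.
Qed.

Lemma Rintegral_indic A (f : Omega -> R) :
  (\int[P]_(w in A) f w)%R = (\int[P]_w (\1_A w * f w))%R.
Proof.
rewrite /Rintegral integral_mkcond; congr fine; apply: eq_integral => w _.
by rewrite /patch indicE; case: ifPn => _; rewrite ?mul1r ?mul0r.
Qed.

(** The Markov property tested on [A]: [X s] is frozen, the increment is replaced by one from time 0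
    and integrated out by [levy_expectation]. The indicator of [A] can join the integrand [h]
    because [A] is measurable in its first variable. *)
Lemma conditional_expectation {C tau v s r A} : 0 <= tau -> tau < alpha -> geo_bounded C tau v ->
  0 <= s -> s <= r -> r <= T -> F s A ->
  (\int[P]_(w in A) rser v (X r w))%R = (\int[P]_(w in A) rser (semi lam (r - s) v) (X s w))%R.
Proof.
move=> tau0 taua bv s0 sr rT FA.
have s0T : 0 <= s <= T by rewrite s0 (le_trans sr).
have r0T : 0 <= r <= T by rewrite rT (le_trans s0 sr).
have rs0T : 0 <= r - s <= T by rewrite subr_ge0 sr/= lerBlDr ler_wpDr.
have mA := F_measurable s0T FA.
pose O2 := g_sigma_algebraType (F s).
have mid : measurable_fun setT (fun w : Omega => w : O2).
  move=> _ B mB; rewrite setTI preimage_id; apply: (F_measurable s0T).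
  by rewrite -measurable_F.
have mrv : measurable_fun setT (rser v).
  by apply: continuous_measurable_fun; exact: continuous_rser bv.
have mXs : measurable_fun (setT : set O2) (X s) by apply: X_measurable_F; rewrite ?s0 ?lexx// (le_trans sr).
have mAs : measurable (A : set O2) by rewrite measurable_F.
pose h (p : O2 * R) : R := \1_A p.1 * rser v (X s p.1 + p.2).
have mh : measurable_fun setT h.
  apply: measurable_funM.
    have mI : measurable_fun (setT : set O2) (\1_(A : set O2) : O2 -> R) by exact: measurable_indic.
    exact: (measurableT_comp mI measurable_fst).
  apply: measurableT_comp => //; apply: measurable_funD; last exact: measurable_snd.
  by apply: measurableT_comp mXs _; exact: measurable_fst.
have mY : measurable_fun setT (increment X s r).
  by apply: measurable_funB; exact: X_measurable.
have indep (B1 : set O2) (B2 : set (measurableTypeR R)) : measurable B1 -> measurable B2 ->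
    (P ((fun w : Omega => w : O2) @^-1` B1 `&` increment X s r @^-1` B2) =
     P ((fun w : Omega => w : O2) @^-1` B1) * P (increment X 0 (r - s) @^-1` B2))%E.
  move=> mB1 mB2; case: X_levy => _ _ ind sta _; rewrite preimage_id.
  by rewrite -(sta s r)//; apply: ind => //; rewrite -measurable_F.
have XE w : X s w + increment X s r w = X r w by rewrite /increment addrC subrK.
have iXr := (X_rser_abs tau0 (ltW taua) bv r0T).1.
have indic_le w x : `|\1_A w * x| <= `|x| :> R.
  by rewrite indicE; case: (w \in A); rewrite ?mul1r// mul0r normr0.
have i1 : P.-integrable setT (fun w => (h (w, increment X s r w))%:E).
  have mi : measurable_fun setT (fun w => \1_A w * rser v (X r w)).
    apply: measurable_funM; first exact: measurable_indic.
    by apply: (measurableT_comp mrv); exact: X_measurable.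
  have := dominated_integrable _ _ measurableT mi (fun w _ => indic_le w _) (integrable_abse iXr).
  by congr (integrable _ _ _); apply/funext => w; rewrite /h /= XE.
have ex x := levy_expectation b a alpha nu alpha_gt0 nu_levy exp_moment P (increment X 0 (r - s))
  (r - s) (increment_measurable rs0T) (increment_law rs0T) x tau0 taua bv.
have i2 (z : O2) : P.-integrable setT (fun w => (h (z, increment X 0 (r - s) w))%:E).
  have := integrableZl measurableT (\1_A z) (ex (X s z)).1.
  by congr (integrable _ _ _); apply/funext.
(* [Omega] with the sigma-algebra [F s] plays the role of the state space of
   the first variable. *)
have [_ E] := independent_expectation P (fun w : Omega => w : O2) (increment X s r)
  (increment X 0 (r - s)) mid mY (increment_measurable rs0T) indep h mh i1 i2.
rewrite [LHS]Rintegral_indic [RHS]Rintegral_indic.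
transitivity (\int[P]_w h (w, increment X s r w))%R.
  by apply: eq_Rintegral => w _; rewrite /h /= XE.
rewrite E; apply: eq_Rintegral => w _; rewrite /h /= RintegralZl//; last exact: (ex (X s w)).1.
by rewrite (ex (X s w)).2.
Qed.

Definition expectation_on s A u : R := (\int[P]_(w in A) rser u (X s w))%R.

(** This lets expectations over [A] pass through the exponential series of [semi]. *)
Lemma geo_functional_expectation s A tau : 0 <= tau -> tau < alpha -> 0 <= s <= T -> measurable A ->
  geo_functional exp_bound tau (expectation_on s A).
Proof.
move=> tau0 taua s0T mA; split=> [C u bu|C D c u v bu bv].
  have [i1 b1] := X_rser_abs tau0 (ltW taua) bu s0T.
  have i1A := integrableS measurableT mA (@subsetT _ A) i1.
  apply: le_trans (le_normr_Rintegral mA i1A) _; rewrite mulrC; apply: le_trans b1.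
  have i2 := integrable_abse i1.
  rewrite /Rintegral fine_le//.
  - by apply: (integrable_fin_num mA); exact: (integrableS measurableT mA (@subsetT _ A) i2).
  - by apply: integrable_fin_num.
  - apply: ge0_subset_integral => //; first exact: measurable_int i2.
have [iu _] := X_rser_abs tau0 (ltW taua) bu s0T.
have [iv _] := X_rser_abs tau0 (ltW taua) bv s0T.
rewrite /expectation_on -Rintegral_combination//; try exact: (integrableS measurableT mA (@subsetT _ A)).
by apply: eq_Rintegral => w _; rewrite (rser_lin _ _ tau0 bu bv).
Qed.

Section TimeIntegrals.
Variables (C tau : R) (g : nat -> R).
Hypotheses (tau0 : 0 <= tau) (taua : tau <= alpha) (bg : geo_bounded C tau g).

Let cg : continuous (rser g).
Proof. exact: continuous_rser bg. Qed.

Lemma path_integrable t w : 0 <= t -> t <= T ->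
  lebesgue_measure.-integrable `[0, t] (EFin \o (fun r => rser g (X r w))).
Proof.
by move=> t0 tT; apply: (integrable_clipped X (rser g) t T w) => //; [move=> r; exact: X_measurable|exact: X_cadlag].
Qed.

Lemma path_bounded w : exists2 M, 0 <= M & forall r, 0 <= r <= T -> `|rser g (X r w)| <= M.
Proof.
have [M HM] := cadlag_path_bounded _ _ (cadlag_path_comp _ _ _ cg (X_cadlag w)).
by exists M => //; apply: le_trans (HM 0 _); rewrite // lexx ltW.
Qed.

(** Adaptedness: the joint measurability argument is carried out on [Omega] equipped with [F t],
    which is possible because clipping at [t] involves the path up to time [t] only. *)
Lemma time_integral_measurable t : 0 <= t -> t <= T ->
  measurable_fun (setT : set (g_sigma_algebraType (F t)))
    (fun w => \int[lebesgue_measure]_(r in `[0, t]) rser g (X r w))%R.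
Proof.
move=> t0 tT; pose O2 := g_sigma_algebraType (F t).
have mZ : measurable_fun setT (fun p : measurableTypeR R * O2 => X (clip t p.1) p.2).
  apply: (@measurable_clipped _ O2 R X t T t0 tT) => [r r0t|]; last exact: X_cadlag.
  exact: X_measurable_F r0t tT.
have mgZ : measurable_fun setT (fun p : measurableTypeR R * O2 => rser g (X (clip t p.1) p.2)).
  by apply: measurableT_comp mZ; exact: continuous_measurable_fun.
have := @measurable_time_integral _ O2 R (fun r w => rser g (X (clip t r) w)) t mgZ.
congr (measurable_fun _ _); apply/funext => w; apply: eq_Rintegral => r.
by rewrite inE /= in_itv/= => rt; rewrite clip_id.
Qed.

Lemma time_integral_on A s t : 0 <= s -> s <= t -> t <= T -> measurable A ->
  P.-integrable A (EFin \o (fun w => \int[lebesgue_measure]_(r in `[s, t]) rser g (X r w))%R) /\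
  (\int[P]_(w in A) (\int[lebesgue_measure]_(r in `[s, t]) rser g (X r w)) =
   \int[lebesgue_measure]_(r in `[s, t]) \int[P]_(w in A) rser g (X r w))%R.
Proof.
move=> s0 st tT mA; have T0 := ltW T_gt0.
have itvT r : s <= r <= t -> 0 <= r <= T.
  by move=> /andP[sr rt]; rewrite (le_trans s0 sr) (le_trans rt tT).
(* Joint measurability holds for the process frozen outside [[0, T]], which coincides with [X] at
   the times integrated over. *)
have mZ : measurable_fun setT (fun p : measurableTypeR R * Omega => rser g (X (clip T p.1) p.2)).
  have := @measurable_clipped _ Omega R X T T T0 (lexx T) (fun r => @X_measurable r) X_cadlag.
  by move=> m; apply: measurableT_comp m; exact: continuous_measurable_fun.
have Zb r : s <= r <= t -> (\int[P]_w (`|rser g (X (clip T r) w)|)%:E <= (C * exp_bound)%:E)%E.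
  move=> /itvT rT; rewrite clip_id//.
  have [i1 b1] := X_rser_abs tau0 taua bg rT.
  rewrite -[leLHS]fineK ?lee_fin; first exact: b1.
  by apply: integrable_fin_num => //; exact: integrable_abse i1.
have [iI EI] := time_integral_Fubini P (fun r w => rser g (X (clip T r) w)) s t _ st mZ Zb A mA.
have clipE w : (\int[lebesgue_measure]_(r in `[s, t]) (rser g (X (clip T r) w))%:E)%E =
    (\int[lebesgue_measure]_(r in `[s, t]) rser g (X r w))%R%:E.
  have -> : (\int[lebesgue_measure]_(r in `[s, t]) (rser g (X (clip T r) w))%:E =
      \int[lebesgue_measure]_(r in `[s, t]) (rser g (X r w))%:E)%E.
    by apply: eq_integral => r; rewrite inE /= in_itv/= => /itvT rT; rewrite clip_id.
  rewrite /Rintegral fineK//; apply: integrable_fin_num => //.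
  apply: (integrableS _ _ _ (path_integrable t w (le_trans s0 st) tT)) => //.
  by apply: subset_itvr; rewrite bnd_simp.
have iI' : P.-integrable A (EFin \o (fun w => \int[lebesgue_measure]_(r in `[s, t]) rser g (X r w))%R).
  by move: iI; congr (integrable _ _ _); apply/funext => w; rewrite clipE.
split => //; rewrite /Rintegral; congr fine.
transitivity (\int[P]_(w in A) \int[lebesgue_measure]_(r in `[s, t]) (rser g (X (clip T r) w))%:E)%E.
  by apply: eq_integral => w _; rewrite clipE.
rewrite EI; apply: eq_integral => r; rewrite inE /= in_itv/= => /itvT rT; rewrite clip_id//.
rewrite fineK//; apply: (integrable_fin_num mA); apply: (integrableS measurableT) => //.
by have [] := X_rser_abs tau0 taua bg rT.
Qed.

End TimeIntegrals.

Section Compensated.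
Variables (C tau : R) (v : nat -> R).
Hypotheses (tau0 : 0 <= tau) (taua : tau < alpha) (bv : geo_bounded C tau v).

Let g := opL lam v.
Let bg : geo_bounded (Lam * C) tau g.
Proof. exact: (geo_bounded_opL lam alpha alpha_gt0 lam_cvg tau0 (ltW taua) bv). Qed.

(** The real counterpart of [Nproc], with the generator already in the form [opL lam]. *)
Definition compensated t w : R := rser v (X t w) - rser v (X 0 w) -
  (\int[lebesgue_measure]_(r in `[0, t]) rser g (X r w))%R.

Lemma compensated_increment s t w : 0 <= s -> s <= t -> t <= T ->
  compensated t w - compensated s w = rser v (X t w) - rser v (X s w) -
    (\int[lebesgue_measure]_(r in `[s, t]) rser g (X r w))%R.
Proof.
move=> s0 st tT; have [M M0 HM] := path_bounded _ _ g tau0 bg w.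
have [<- _] := integral_lipschitz T _ M M0
  (path_integrable _ _ g tau0 bg T w (ltW T_gt0) (lexx T)) HM s t s0 st tT.
by rewrite /compensated; ring.
Qed.

Let iX t : 0 <= t <= T -> P.-integrable setT (EFin \o (fun w => rser v (X t w))).
Proof.
move=> t0T; by have [] := X_rser_abs tau0 (ltW taua) bv t0T.
Qed.

Lemma integrableB_EFin A (f h : Omega -> R) : measurable A -> P.-integrable A (EFin \o f) ->
  P.-integrable A (EFin \o h) -> P.-integrable A (EFin \o (fun w => f w - h w)).
Proof.
move=> mA if_ ih; have := integrable_combination P A mA (-1) ih if_.
by congr (integrable _ _ _); apply/funext => w /=; rewrite mulN1r addrC.
Qed.

Lemma compensated_integrable t : 0 <= t -> t <= T ->
  P.-integrable setT (EFin \o compensated t).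
Proof.
move=> t0 tT.
apply: integrableB_EFin => //; last first.
  by have [] := time_integral_on _ _ g tau0 (ltW taua) bg setT 0 t (lexx 0) t0 tT measurableT.
by apply: integrableB_EFin => //; apply: iX; rewrite ?t0// lexx ltW.
Qed.

Lemma expectation_on_series A s r : F s A -> 0 <= s -> s <= r -> r <= T ->
  forall u D, geo_bounded D tau u ->
  (\int[P]_(w in A) rser u (X r w))%R =
  rser (fun j => expectation_on s A (iter j (opL lam) u)) (r - s).
Proof.
move=> FA s0 sr rT u D bu; have s0T : 0 <= s <= T by rewrite s0 (le_trans sr).
rewrite (conditional_expectation tau0 taua bu s0 sr rT FA).
have mA := F_measurable s0T FA.
have fE := geo_functional_expectation s A tau tau0 taua s0T mA.
exact: (functional_semi lam alpha alpha_gt0 lam_cvg (expectation_on s A) (r - s) tau0 (ltW taua)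
  exp_bound_ge0 fE bu).
Qed.

Lemma compensated_martingale A s t : F s A -> 0 <= s -> s <= t -> t <= T ->
  (\int[P]_(w in A) (compensated t w)%:E = \int[P]_(w in A) (compensated s w)%:E)%E.
Proof.
move=> FA s0 st tT; have s0T : 0 <= s <= T by rewrite s0 (le_trans st).
have t0T : 0 <= t <= T by rewrite tT (le_trans s0).
have mA := F_measurable s0T FA.
pose G j := expectation_on s A (iter j (opL lam) v).
have bG : geo_bounded (exp_bound * C) Lam G.
  have [bE _] := geo_functional_expectation s A tau tau0 taua s0T mA.
  move=> j; apply: le_trans (bE _ _ (geo_bounded_iter lam alpha alpha_gt0 lam_cvg j tau0 (ltW taua) bv)) _.
  by rewrite mulrCA mulrC.
have sub (f : Omega -> R) : P.-integrable setT (EFin \o f) -> P.-integrable A (EFin \o f).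
  exact: integrableS.
have [iI EI] := time_integral_on _ _ g tau0 (ltW taua) bg A s t s0 st tT mA.
(* Passing from [v] to [opL lam v] shifts the coefficients of the series in [r - s], that is,
   differentiates it in time. *)
have shiftG : (fun j => expectation_on s A (iter j (opL lam) g)) = shiftn 1 G.
  by apply/funext => j; rewrite /shiftn /G add1n iterSr.
have ED : (\int[P]_(w in A) (compensated t w - compensated s w) = 0)%R.
  under eq_Rintegral do rewrite compensated_increment//.
  rewrite RintegralB//; last by apply: integrableB_EFin => //; apply: sub; exact: iX.
  rewrite RintegralB//; try by apply: sub; exact: iX.
  rewrite EI (expectation_on_series A s t FA s0 st tT v C bv) -/G.
  have -> : (\int[P]_(w in A) rser v (X s w))%R = G 0%N by [].
  have -> : (\int[lebesgue_measure]_(r in `[s, t]) \int[P]_(w in A) rser g (X r w))%R =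
      (\int[lebesgue_measure]_(r in `[s, t]) rser (shiftn 1 G) (r - s))%R.
    apply: eq_Rintegral => r; rewrite inE /= in_itv/= => /andP[sr rt].
    transitivity (rser (fun j => expectation_on s A (iter j (opL lam) g)) (r - s)).
      exact: (expectation_on_series A s r FA s0 sr (le_trans rt tT) g _ bg).
    by rewrite shiftG.
  rewrite /Rintegral (integral_rser s t (symbol_norm_ge0 lam alpha alpha_gt0 lam_cvg) bG st)/=.
  by rewrite subrr.
have iM r : 0 <= r -> r <= T -> P.-integrable A (EFin \o compensated r).
  by move=> r0 rT; apply: sub; exact: compensated_integrable.
have iMt := iM t (le_trans s0 st) tT; have iMs := iM s s0 (le_trans st tT).
have {}ED : (\int[P]_(w in A) compensated t w = \int[P]_(w in A) compensated s w)%R.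
  by apply/eqP; rewrite -subr_eq0 -(RintegralB mA iMt iMs); exact/eqP.
rewrite -[LHS]fineK; last exact: integrable_fin_num.
rewrite -[RHS]fineK; last exact: integrable_fin_num.
exact: (congr1 EFin ED).
Qed.

Lemma compensated_adapted : adapted T F compensated.
Proof.
move=> t /andP[t0 tT] B mB.
have m0 : 0 <= t <= T by rewrite t0.
have mr : measurable_fun setT (rser v).
  by apply: continuous_measurable_fun; exact: continuous_rser bv.
have mM : measurable_fun (setT : set (g_sigma_algebraType (F t))) (compensated t).
  apply: measurable_funB; last exact: (time_integral_measurable _ _ g tau0 bg).
  by apply: measurable_funB; apply: (measurableT_comp mr);
    apply: (X_measurable_F) => //; rewrite ?t0 ?lexx.
by rewrite -(measurable_F m0) -[X in measurable X]setTI; exact: mM.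
Qed.

Lemma compensated_cadlag w : cadlag_path T (fun t => compensated t w).
Proof.
have [M M0 HM] := path_bounded _ _ g tau0 bg w.
apply: cadlag_path_add.
  exact: (cadlag_path_comp _ _ _ (continuous_rser tau0 bv) (X_cadlag w)).
exact: (cadlag_path_integral _ _ M M0 (path_integrable _ _ g tau0 bg T w (ltW T_gt0) (lexx T)) HM).
Qed.

Lemma compensated_real_martingale : real_martingale P T F compensated.
Proof.
split; first exact: compensated_adapted.
- by move=> w; exact: compensated_cadlag.
- by move=> t /andP[t0 tT]; exact: compensated_integrable.
- by move=> s t s0 st tT A FA; exact: compensated_martingale.
Qed.

End Compensated.

End LevyMartingale.

(** * From martingales to local martingales *)

Section LocalMartingale.
Context {R : realType} {d : measure_display} {Omega : measurableType d}.
Variables (P : probability Omega R) (T : R) (F : R -> set (set Omega)).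
Hypothesis F_filtration : filtration T F.

(** Equality is asked on [[0, T]] only, since stopping at [T] alters a process beyond the
    horizon. *)
Lemma real_martingale_ext (M M' : R -> Omega -> R) :
  (forall t w, 0 <= t <= T -> M t w = M' t w) ->
  real_martingale P T F M -> real_martingale P T F M'.
Proof.
move=> MM' [aM cM iM mM].
have E t : 0 <= t <= T -> M t = M' t by move=> t0T; apply/funext => w; exact: MM'.
split.
- by move=> t t0T B mB; rewrite -(E t t0T); exact: aM.
- move=> w; have [r l] := cM w; split => t /andP[t0 tT].
    rewrite -(E t) ?t0 ?(ltW tT)//; apply: (cvg_trans _ (r t _)); last by rewrite t0.
    apply: near_eq_cvg; near=> s; rewrite (E s)//; apply/andP; split.
      by apply: le_trans t0 _; near: s; exact: nbhs_right_ge.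
    by near: s; exact: nbhs_right_le.
  have /cvg_ex[y Hy] := l t (introT andP (conj t0 tT)).
  apply/cvg_ex; exists y; apply: (cvg_trans _ Hy).
  apply: near_eq_cvg; near=> s; rewrite (E s)//; apply/andP; split.
    by near: s; exact: nbhs_left_ge.
  by apply: le_trans _ tT; near: s; exact: nbhs_left_le.
- by move=> t t0T; rewrite -(E t t0T); exact: iM.
- move=> s t s0 st tT A FA; rewrite -(E t) ?(le_trans s0 st)// -(E s) ?s0 ?(le_trans st tT)//.
  exact: mM.
Unshelve. all: by end_near. Qed.

Lemma martingale_local (M : R -> Omega -> R[i]) : 0 < T -> martingale P T F M ->
  local_martingale P T F M.
Proof.
move=> T0 [mR mI]; split.
- by case: mR => aR _ _ _; case: mI => aI _ _ _.
- by case: mR => _ cR _ _; case: mI => _ cI _ _.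
exists (fun _ _ => T); split => //.
- move=> _; split; first by move=> _; exact: ltW.
  move=> t t0T; have [FA _ _] := F_filtration; have [F0 FC _] := FA t t0T.
  have [tT|tT] := leP T t; last first.
    by rewrite (_ : [set w | _] = set0)//; apply/seteqP; split => w //=; rewrite leNgt tT.
  rewrite (_ : [set w | _] = setT `\` set0); last first.
    by rewrite setD0; apply/seteqP; split.
  exact: FC.
- by apply: aeW => w; exists 0%N.
- move=> _; split; [move: mR|move: mI]; apply: real_martingale_ext => t w /andP[_ tT];
    by rewrite /stopped (min_idPl tT).
Qed.

End LocalMartingale.

(** * The holomorphic process property *)

Section HolomorphicProcess.
Context {R : realType} {d : measure_display} {Omega : measurableType d}.
Local Notation C := R[i].
Variables (P : probability Omega R) (T : R) (F : R -> set (set Omega)).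
Variables (b a alpha : R) (nu : {measure set (measurableTypeR R) -> \bar R}).
Variables (X : R -> Omega -> R) (x0 : R) (S : set R).
Hypothesis T_gt0 : 0 < T.
Hypothesis F_filtration : filtration T F.
Hypothesis X_levy : levy_process P T F b a nu X.
Hypothesis X_S : valued_in T S X.
Hypothesis X_0 : forall w, X 0 w = x0.
Hypothesis alpha_gt0 : 0 < alpha.
Hypothesis nu_levy : levy_measure nu.
Hypothesis exp_moment :
  (\int[nu]_(y in [set y : R | (1 < `|y|)%R]) (expR (alpha * `|y|))%:E < +oo)%E.
Implicit Types (u v : nat -> C) (D t : R).

Lemma cgeo_bounded_le {D t t'} {u} : 0 <= t -> t <= t' -> cgeo_bounded D t u -> cgeo_bounded D t' u.
Proof.
move=> t0 tt' bu k; apply: le_trans (bu k) _.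
by rewrite ler_wpM2l ?(cgeo_bounded_ge0 bu)// lerXn2r// nnegrE// (le_trans t0).
Qed.

Lemma cgeo_bounded_lin {D E t} {u v} (k : C) : cgeo_bounded D t u -> cgeo_bounded E t v ->
  cgeo_bounded (normc k * D + E) t (fun n => k * u n + v n).
Proof.
move=> bu bv n; apply: le_trans (normcD _ _) _; rewrite Normc.normcM mulrDl -mulrA.
by apply: lerD => //; rewrite ler_wpM2l ?normc_ge0.
Qed.

Lemma hser_lin {D E t} {u v} (k z : C) : 0 <= t -> cgeo_bounded D t u -> cgeo_bounded E t v ->
  hser (fun n => k * u n + v n) z = k * hser u z + hser v z.
Proof.
move=> t0 bu bv; rewrite !hser_csum.
rewrite -(csum_lin k (hterm_dominated z t0 bu) (hterm_dominated z t0 bv)).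
by congr csum; apply/funext => n; rewrite /hterm !mulrDl !mulrA.
Qed.

Lemma hser0 z : hser (fun=> 0 : C) z = 0.
Proof.
rewrite /hser (_ : hterm _ z = fun=> 0); last by apply/funext => k; rewrite /hterm !mul0r.
apply: limc_seq => e e0; near=> n.
by rewrite /series /= big1// subrr Normc.normc0 ltW.
Unshelve. all: by end_near. Qed.

(** [h] is exchanged for a power series on the real line, which is all that the generator and the
    process see of it. *)
Lemma restrictR_Vexp h : Vexp alpha h -> exists D t u,
  [/\ 0 < t, t < alpha, cgeo_bounded D t u & restrictR h = restrictR (hser u)].
Proof.
move=> /(Vexp_geo_bounded alpha h alpha_gt0)[t [D [u [t0 ta bu hu]]]].
by exists D, t, u; split => //; apply/funext => x; rewrite /restrictR hu.
Qed.

Lemma Nproc_martingale h : Vexp alpha h -> martingale P T F (Nproc b a nu X (restrictR h)).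
Proof.
move=> /restrictR_Vexp[D [t [u [t0 ta bu ->]]]].
have mart p : geo_bounded D t p -> real_martingale P T F (compensated b a nu X p).
  exact: (compensated_real_martingale P T F b a alpha nu X x0 T_gt0 F_filtration X_levy X_0
    alpha_gt0 nu_levy exp_moment D t p (ltW t0) ta).
have gE x := generator_hser b a alpha nu alpha_gt0 nu_levy exp_moment x (ltW t0) (ltW ta) bu.
have NE s w : Nproc b a nu X (restrictR (hser u)) s w =
    Complex (compensated b a nu X (Re_seq u) s w) (compensated b a nu X (Im_seq u) s w).
  rewrite /Nproc (_ : (fun r => generator b a nu (restrictR (hser u)) (X r w)) =
    (fun r => Complex (rser (opL (levy_symbol b a nu) (Re_seq u)) (X r w))
                      (rser (opL (levy_symbol b a nu) (Im_seq u)) (X r w)))).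
    by rewrite /compensated (restrict_hser (ltW t0) bu).
  by apply/funext => r; exact: gE.
split.
  apply: (real_martingale_ext P T F (compensated b a nu X (Re_seq u))).
    by move=> s w _; rewrite NE.
  by apply: mart; exact: cgeo_bounded_Re.
apply: (real_martingale_ext P T F (compensated b a nu X (Im_seq u))).
  by move=> s w _; rewrite NE.
by apply: mart; exact: cgeo_bounded_Im.
Qed.

Lemma restrictR_Vexp_linear : linear_subset (restrictR @` Vexp alpha).
Proof.
split.
  have b0 : cgeo_bounded 0 0 (fun=> 0 : C) by move=> k; rewrite Normc.normc0 mul0r.
  exists (hser (fun=> 0 : C)); first exact: (Vexp_hser alpha 0 0 _ (lexx 0) alpha_gt0 b0).
  by apply/funext => x; rewrite /restrictR hser0.
move=> k f g [h1 V1 <-] [h2 V2 <-].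
have [D [t [u [t0 ta bu E1]]]] := restrictR_Vexp h1 V1.
have [D' [t' [v [t'0 ta' bv E2]]]] := restrictR_Vexp h2 V2.
pose m := Num.max t t'.
have m0 : 0 <= m by rewrite le_max ltW.
have bu' : cgeo_bounded D m u by apply: cgeo_bounded_le bu; rewrite ?(ltW t0)// le_max lexx.
have bv' : cgeo_bounded D' m v by apply: cgeo_bounded_le bv; rewrite ?(ltW t'0)// le_max lexx orbT.
exists (hser (fun n => k * u n + v n)).
  apply: (Vexp_hser alpha m _ _ m0 _ (cgeo_bounded_lin k bu' bv')).
  by rewrite gt_max ta ta'.
by apply/funext => x; rewrite E1 E2 /restrictR (hser_lin k _ m0 bu' bv').
Qed.

Lemma levy_holomorphic_process : holomorphic_process P T F b a nu S (restrictR @` Vexp alpha) X.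
Proof.
split => //; first exact: restrictR_Vexp_linear.
  move=> _ [h [eh _] <-]; exists 1, h; split => //.
  by move=> z _; exact: eh.
move=> _ [h Vh <-]; have mN := Nproc_martingale h Vh; split.
- have [D [t [u [t0 ta bu ->]]]] := restrictR_Vexp h Vh.
  exact: (generator_domain_hser b a alpha nu alpha_gt0 nu_levy exp_moment S (ltW t0) (ltW ta) bu).
- have [D [t [u [t0 ta bu ->]]]] := restrictR_Vexp h Vh.
  exists 1, (hser (levy_operator b a nu u)); split => //.
    exact: (entire_hser _ (ltW t0) (levy_operator_bounded b a alpha nu alpha_gt0 nu_levy exp_moment
      (ltW t0) (ltW ta) bu)).
  by move=> x _; exact: (generator_levy_operator b a alpha nu alpha_gt0 nu_levy exp_moment x
    (ltW t0) (ltW ta) bu).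
- exact: martingale_local.
Qed.

End HolomorphicProcess.

(** * The dual equation *)

Section DoubleIntegral.
Context {R : realType}.

Lemma double_integral_bounded (E : measurableTypeR R * measurableTypeR R -> \bar R) (T K : R) :
  measurable_fun setT E -> (forall p, (0 <= E p)%E) ->
  (forall s t, 0 <= s <= T -> 0 <= t <= T -> (E (s, t) <= K%:E)%E) ->
  (\int[lebesgue_measure]_(t in `[0%R, T]) \int[lebesgue_measure]_(s in `[0%R, T]) E (s, t) < +oo)%E.
Proof.
move=> mE E0 EK; set B : set (measurableTypeR R) := `[0, T]%classic.
have mB : measurable B by exact: measurable_itv.
have inB t : B t -> 0 <= t <= T by rewrite /B /= in_itv.
have lB : (lebesgue_measure B < +oo)%E.
  by rewrite (_ : lebesgue_measure B = lebesgue_measure `[0, T])// lebesgue_measure_itv/=;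
    case: ifP => _; rewrite ?ltry// -EFinB ltry.
pose J (t : measurableTypeR R) := (\int[lebesgue_measure]_(s in B) E (s, t))%E.
have J0 t : (0 <= J t)%E by exact: integral_ge0.
have mJ : measurable_fun setT J.
  have mEB : measurable_fun setT (E \_ (B `*` setT)).
    apply/(measurable_restrictT _ _).1; first exact: measurableX.
    exact: (measurable_funS measurableT).
  have := @measurable_fun_fubini_tonelli_G _ _ _ _ R lebesgue_measure _ mEB.
  rewrite (_ : fubini_G _ _ = J); first by apply=> p; rewrite /patch; case: ifP.
  apply/funext => t; rewrite /fubini_G /J [RHS]integral_mkcond; apply: eq_integral => s _.
  by rewrite /patch in_setX in_setT andbT.
have bnd (f : measurableTypeR R -> \bar R) (k : \bar R) : measurable_fun setT f ->
    (forall t, (0 <= f t)%E) -> (forall t, B t -> (f t <= k)%E) ->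
    (\int[lebesgue_measure]_(t in B) f t <= `|k| * lebesgue_measure B)%E.
  move=> mf f0 fk; rewrite -integral_cst//; apply: ge0_le_integral => //.
    exact: (measurable_funS measurableT).
  by move=> t Bt; apply: le_trans (fk t Bt) (lee_abs _).
have ltB k : (k \is a fin_num)%E -> (`|k| * lebesgue_measure B < +oo)%E.
  by move=> fk; apply: lte_mul_pinfty => //; rewrite abse_fin_num.
have JB t : B t -> (J t <= `|K%:E| * lebesgue_measure B)%E.
  move=> Bt; apply: bnd => //; last by move=> s Bs; apply: EK; exact: inB.
  exact: (measurableT_comp mE (@measurable_pair2 _ _ _ _ t)).
have KB : (`|K%:E| * lebesgue_measure B < +oo)%E by exact: ltB.
apply: (le_lt_trans (bnd J _ mJ J0 JB)); apply: ltB.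
by rewrite ge0_fin_numE// mule_ge0.
Qed.

Lemma integral_le_sum {d} {T : measurableType d} (mu : {measure set T -> \bar R})
    (f g h : T -> R) (k : R) :
  measurable_fun setT f -> measurable_fun setT (fun w => (g w)%:E) ->
  measurable_fun setT (fun w => (h w)%:E) ->
  (forall w, 0 <= f w) -> (forall w, 0 <= g w) -> (forall w, 0 <= h w) ->
  (forall w, f w <= g w + h w) ->
  (\int[mu]_w (g w)%:E <= k%:E)%E -> (\int[mu]_w (h w)%:E <= k%:E)%E ->
  (\int[mu]_w (f w)%:E <= (k + k)%:E)%E.
Proof.
move=> mf mg mh f0 g0 h0 fgh gk hk.
apply: (@le_trans _ _ (\int[mu]_w ((g w)%:E + (h w)%:E))%E); last first.
  rewrite ge0_integralD//; first by rewrite EFinD; exact: leeD.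
    by move=> w _; rewrite lee_fin.
  by move=> w _; rewrite lee_fin.
apply: ge0_le_integral => //.
- by move=> w _; rewrite lee_fin.
- exact/measurable_EFinP.
- exact: emeasurable_funD.
- by move=> w _; rewrite -EFinD lee_fin.
Qed.

End DoubleIntegral.

(** * Time evolution of a real coefficient sequence *)

Section Evolution.
Context {R : realType}.
Variables (lam : nat -> R) (alpha : R).
Hypothesis alpha_gt0 : 0 < alpha.
Hypothesis lam_cvg : cvgn (series (fun n => `|lam n| * alpha ^+ n)).
Local Notation Lam := (symbol_norm lam alpha).
Variables (C t : R) (p : nat -> R).
Hypotheses (t0 : 0 <= t) (ta : t <= alpha) (bp : geo_bounded C t p).
Implicit Types (s x : R).

(** The coefficients in [s] of the series for [rser (semi lam s p) x]; applying [opL] to the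
    sequence shifts them. *)
Let orbit x j := rser (iter j (opL lam) p) x.

Let Lam0 : 0 <= Lam.
Proof. exact: symbol_norm_ge0 alpha_gt0 lam_cvg. Qed.

Let orbit_bounded x : geo_bounded (C * expR (t * `|x|)) Lam (orbit x).
Proof.
move=> j; apply: le_trans (rser_le x t0 (geo_bounded_iter lam alpha alpha_gt0 lam_cvg j t0 ta bp)) _.
by apply/eq_ler; ring.
Qed.

Lemma rser_opL_semi s x : rser (opL lam (semi lam s p)) x = rser (shiftn 1 (orbit x)) s.
Proof.
rewrite (opL_semi lam alpha alpha_gt0 lam_cvg s t0 ta bp).
rewrite (rser_semi lam alpha alpha_gt0 lam_cvg s x t0 ta (geo_bounded_opL lam alpha alpha_gt0 lam_cvg t0 ta bp)).
by congr (rser _ s); apply/funext => j; rewrite /shiftn /orbit add1n iterSr.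
Qed.

Lemma rser_opL_semi_bounded s :
  geo_bounded (Lam * (C * expR (Lam * `|s|))) t (opL lam (semi lam s p)).
Proof.
apply: (geo_bounded_opL lam alpha alpha_gt0 lam_cvg t0 ta).
exact: (geo_bounded_semi lam alpha alpha_gt0 lam_cvg s t0 ta bp).
Qed.

Lemma continuous_rser_opL_semi x : continuous (fun s => rser (opL lam (semi lam s p)) x).
Proof.
rewrite (_ : (fun s => _) = rser (shiftn 1 (orbit x))).
  by exact: continuous_rser Lam0 (geo_bounded_shift 1 (orbit_bounded x)).
by apply/funext => s; exact: rser_opL_semi.
Qed.

Lemma integral_rser_opL_semi r x : 0 <= r ->
  (\int[lebesgue_measure]_(s in `[0, r]) rser (opL lam (semi lam s p)) x)%R =
  rser (semi lam r p) x - rser p x.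
Proof.
move=> r0; have := integral_rser 0 r Lam0 (orbit_bounded x) r0.
rewrite /Rintegral (rser_semi lam alpha alpha_gt0 lam_cvg r x t0 ta bp) subr0 => E.
rewrite (_ : (\int[_]_(s in _) _)%E = (rser (orbit x) r - orbit x 0)%:E)//.
by rewrite -E; apply: eq_integral => s _; rewrite subr0 rser_opL_semi.
Qed.

(** Jointly in [(s, x)] the function is a pointwise limit of polynomials in [s] whose coefficients
    are continuous in [x]. *)
Lemma measurable_rser_opL_semi :
  measurable_fun setT (fun q : measurableTypeR R * R => rser (opL lam (semi lam q.1 p)) q.2).
Proof.
pose part n (q : measurableTypeR R * R) := \sum_(j < n) orbit q.2 j.+1 * q.1 ^+ j / j`!%:R.
have mpart n : measurable_fun setT (part n).
  apply: measurable_sum => j; apply: measurable_funM => //; apply: measurable_funM.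
    apply: measurableT_comp measurable_snd; apply: continuous_measurable_fun.
    exact: continuous_rser t0 (geo_bounded_iter lam alpha alpha_gt0 lam_cvg j.+1 t0 ta bp).
  by apply: measurable_funX; exact: measurable_fst.
apply: (measurable_fun_cvg mpart) => -[s x] _ /=.
rewrite rser_opL_semi.
have -> : (fun n => part n (s, x)) = series (fun k => shiftn 1 (orbit x) k * s ^+ k / k`!%:R).
  by apply/funext => n; rewrite series_ord; apply: eq_bigr => j _; rewrite /shiftn add1n.
exact: (rser_cvg s Lam0 (geo_bounded_shift 1 (orbit_bounded x))).
Qed.

End Evolution.

(** * The dual equation for complex sequences *)

Section DualEvolution.
Context {R : realType} {d : measure_display} {Omega : measurableType d}.
Local Notation C := R[i].
Variables (P : probability Omega R) (T : R) (F : R -> set (set Omega)).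
Variables (b a alpha : R) (nu : {measure set (measurableTypeR R) -> \bar R}).
Variables (X : R -> Omega -> R) (x0 : R) (S : set R).
Hypothesis T_gt0 : 0 < T.
Hypothesis F_filtration : filtration T F.
Hypothesis X_levy : levy_process P T F b a nu X.
Hypothesis X_0 : forall w, X 0 w = x0.
Hypothesis alpha_gt0 : 0 < alpha.
Hypothesis nu_levy : levy_measure nu.
Hypothesis exp_moment :
  (\int[nu]_(y in [set y : R | (1 < `|y|)%R]) (expR (alpha * `|y|))%:E < +oo)%E.
Local Notation lam := (levy_symbol b a nu).
Local Notation Lam := (symbol_norm lam alpha).
Let lam_cvg := levy_symbol_cvg b a alpha nu alpha_gt0 nu_levy exp_moment.
Variables (D tau : R) (u : nat -> C).
Hypotheses (tau0 : 0 <= tau) (taua : tau < alpha) (bu : cgeo_bounded D tau u).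
Local Notation c := (fun s => levy_semigroup b a nu s u).
Local Notation gen s x := (generator b a nu (restrictR (hser (c s))) x).
Local Notation Q p s x := (rser (opL lam (semi lam s p)) x).

Let bR : geo_bounded D tau (Re_seq u). Proof. exact: cgeo_bounded_Re. Qed.
Let bI : geo_bounded D tau (Im_seq u). Proof. exact: cgeo_bounded_Im. Qed.
Let D0 : 0 <= D. Proof. exact: cgeo_bounded_ge0 bu. Qed.

Let bc s := levy_semigroup_bounded b a alpha nu alpha_gt0 nu_levy exp_moment s tau0 (ltW taua) bu.

Lemma generator_semigroup s x : gen s x = Complex (Q (Re_seq u) s x) (Q (Im_seq u) s x).
Proof.
exact: (generator_hser b a alpha nu alpha_gt0 nu_levy exp_moment x tau0 (ltW taua) (bc s)).
Qed.

Lemma semigroup_hser s x :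
  hser (c s) (ofR x) = Complex (rser (semi lam s (Re_seq u)) x) (rser (semi lam s (Im_seq u)) x).
Proof. exact: (hser_ofR x tau0 (bc s)). Qed.

Lemma semigroup_evolution x :
  cintegrable lebesgue_measure `[0, T] (fun s => gen s x) /\
  forall t, 0 <= t <= T -> hser (c t) (ofR x) = hser u (ofR x) +
    cintegral lebesgue_measure `[0, t] (fun s => gen s x).
Proof.
rewrite (_ : (fun s => gen s x) = (fun s => Complex (Q (Re_seq u) s x) (Q (Im_seq u) s x))); last first.
  by apply/funext => s; exact: generator_semigroup.
split.
  split; apply: continuous_integrable_itv => /=.
    exact: (continuous_rser_opL_semi lam alpha alpha_gt0 lam_cvg D tau _ tau0 (ltW taua) bR).
  exact: (continuous_rser_opL_semi lam alpha alpha_gt0 lam_cvg D tau _ tau0 (ltW taua) bI).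
move=> t /andP[t0 _]; rewrite semigroup_hser (hser_ofR x tau0 bu).
have ER := integral_rser_opL_semi lam alpha alpha_gt0 lam_cvg D tau _ tau0 (ltW taua) bR t x t0.
have EI := integral_rser_opL_semi lam alpha alpha_gt0 lam_cvg D tau _ tau0 (ltW taua) bI t x t0.
have -> : cintegral lebesgue_measure `[0, t] (fun s => Complex (Q (Re_seq u) s x) (Q (Im_seq u) s x)) =
    Complex (rser (semi lam t (Re_seq u)) x - rser (Re_seq u) x)
            (rser (semi lam t (Im_seq u)) x - rser (Im_seq u) x).
  by apply: complexP; [exact: ER|exact: EI].
by apply: complexP; rewrite ?cReD ?cImD /= /Re_seq /Im_seq; ring.
Qed.

Lemma semigroup_expectation :
  cintegrable P setT (fun w => hser u (ofR (X T w))) /\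
  cintegral P setT (fun w => hser u (ofR (X T w))) = hser (c T) (ofR x0).
Proof.
have TT : 0 <= T <= T by rewrite lexx ltW.
have ex p : geo_bounded D tau p -> _ := fun bp => X_expectation P T F b a alpha nu X x0 T_gt0
  F_filtration X_levy X_0 alpha_gt0 nu_levy exp_moment tau0 taua bp TT.
have [iR eR] := ex _ bR; have [iI eI] := ex _ bI.
rewrite (_ : (fun w => _) = fun w => Complex (rser (Re_seq u) (X T w)) (rser (Im_seq u) (X T w))).
  by rewrite semigroup_hser -eR -eI.
by apply/funext => w; exact: hser_ofR bu.
Qed.

Let EA (p : measurableTypeR R * measurableTypeR R) : \bar R :=
  (\int[P]_w (normc (gen p.1 (X p.2 w)))%:E)%E.

Let gen_norm s x : R := Num.sqrt (Q (Re_seq u) s x ^+ 2 + Q (Im_seq u) s x ^+ 2).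

Let gen_normE s x : normc (gen s x) = gen_norm s x.
Proof. by rewrite generator_semigroup. Qed.

Let gen_norm_le s x : gen_norm s x <= `|Q (Re_seq u) s x| + `|Q (Im_seq u) s x|.
Proof. exact: (normc_ReIm (Complex (Q (Re_seq u) s x) (Q (Im_seq u) s x))). Qed.

(** Nothing is known about [X t] for [t] outside [[0, T]]. Freezing time there gives a function
    measurable on the whole plane that agrees with [EA] on the domain of integration. *)
Let EAclip (p : measurableTypeR R * measurableTypeR R) : \bar R :=
  (\int[P]_w (gen_norm p.1 (X (clip T p.2) w))%:E)%E.

Let EA_clip s t : 0 <= t <= T -> EA (s, t) = EAclip (s, t).
Proof.
by move=> tT; rewrite /EAclip /= clip_id//; apply: eq_integral => w _; rewrite gen_normE.
Qed.

Let measurable_gen_norm {d'} {T' : measurableType d'} (f g : T' -> R) :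
  measurable_fun setT (fun z => (f z : measurableTypeR R, g z)) ->
  measurable_fun setT (fun z => gen_norm (f z) (g z)).
Proof.
move=> mfg.
have mQ p : geo_bounded D tau p -> measurable_fun setT (fun z => Q p (f z) (g z)).
  move=> bp; exact: (measurableT_comp
    (measurable_rser_opL_semi lam alpha alpha_gt0 lam_cvg D tau p tau0 (ltW taua) bp) mfg).
have msqrt : measurable_fun setT (@Num.sqrt R) by apply: continuous_measurable_fun; exact: sqrt_continuous.
apply: (measurableT_comp msqrt).
by apply: measurable_funD; apply: measurable_funX; exact: mQ.
Qed.

Let measurable_EAclip : measurable_fun setT EAclip.
Proof.
have mX : measurable_fun setT (fun p : measurableTypeR R * Omega => X (clip T p.1) p.2).
  apply: (measurable_clipped X T T (ltW T_gt0) (lexx T)).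
    by move=> r; exact: (X_measurable P T F b a nu X F_filtration X_levy).
  exact: (X_cadlag P T F b a nu X X_levy).
have mZ : measurable_fun setT (fun z : (measurableTypeR R * measurableTypeR R) * Omega =>
    (z.1.1, X (clip T z.1.2) z.2)).
  apply: measurable_fun_pair; first exact: (measurableT_comp measurable_fst measurable_fst).
  apply: (measurableT_comp mX (g := fun z : (measurableTypeR R * measurableTypeR R) * Omega => (z.1.2, z.2))).
  by apply: measurable_fun_pair => //; exact: (measurableT_comp measurable_snd measurable_fst).
have mn : measurable_fun setT (fun z : (measurableTypeR R * measurableTypeR R) * Omega =>
    (gen_norm z.1.1 (X (clip T z.1.2) z.2))%:E).
  by apply/measurable_EFinP; exact: measurable_gen_norm.
have := @measurable_fun_fubini_tonelli_F _ _ _ _ R P _ mn.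
by apply => z; rewrite lee_fin sqrtr_ge0.
Qed.

(** The constant of [rser_opL_semi_bounded] at the horizon times the exponential moment. It bounds
    the real and the imaginary part each, hence the double of it in the next estimate. *)
Let bound : R := Lam * (D * expR (Lam * T)) * exp_bound T b a alpha nu x0.

Let EAclip_le s t : 0 <= s <= T -> 0 <= t <= T -> (EAclip (s, t) <= (bound + bound)%:E)%E.
Proof.
move=> /andP[s0 sT] tT; rewrite /EAclip /= clip_id//.
have Lam0 : 0 <= Lam by exact: symbol_norm_ge0 alpha_gt0 lam_cvg.
have part p : geo_bounded D tau p ->
    measurable_fun setT (fun w => (`|Q p s (X t w)|)%:E) /\
    (\int[P]_w (`|Q p s (X t w)|)%:E <= bound%:E)%E.
  move=> bp; have bQ := rser_opL_semi_bounded lam alpha alpha_gt0 lam_cvg D tau p tau0 (ltW taua) bp s.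
  have [i1 b1] := X_rser_abs P T F b a alpha nu X x0 T_gt0 F_filtration X_levy X_0 alpha_gt0 nu_levy
    exp_moment tau0 (ltW taua) bQ tT.
  have i2 := integrable_abse i1.
  split; first exact: measurable_int i2.
  rewrite -[leLHS]fineK ?lee_fin; last exact: integrable_fin_num.
  apply: le_trans b1 _; rewrite ler_wpM2r ?exp_bound_ge0// ler_wpM2l// ler_wpM2l// ler_expR.
  by rewrite ger0_norm// ler_wpM2l.
have [mR leR] := part _ bR; have [mI leI] := part _ bI.
apply: (integral_le_sum P _ _ _ bound _ mR mI) leR leI => //; last by move=> w; exact: sqrtr_ge0.
apply: measurable_gen_norm; apply: measurable_fun_pair; first exact: measurable_cst.
exact: (X_measurable P T F b a nu X F_filtration X_levy tT).
Qed.

Lemma semigroup_generator_integrable :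
  measurable_fun (`[0, T] `*` `[0, T]) EA /\
  (\int[lebesgue_measure]_(t in `[0%R, T]) \int[lebesgue_measure]_(s in `[0%R, T]) EA (s, t) < +oo)%E.
Proof.
set B : set (measurableTypeR R) := `[0, T]%classic.
have inB t : t \in B -> 0 <= t <= T by rewrite inE /B /= in_itv.
split.
  apply: (eq_measurable_fun EAclip); last exact: (measurable_funS measurableT).
  by move=> -[s t]; rewrite in_setX => /andP[_ /inB tT]; rewrite EA_clip.
have -> : (\int[lebesgue_measure]_(t in B) \int[lebesgue_measure]_(s in B) EA (s, t) =
    \int[lebesgue_measure]_(t in B) \int[lebesgue_measure]_(s in B) EAclip (s, t))%E.
  by apply: eq_integral => t /inB tT; apply: eq_integral => s _; rewrite EA_clip.
apply: (double_integral_bounded EAclip T (bound + bound)) EAclip_le => // p.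
by apply: integral_ge0 => w _; rewrite lee_fin sqrtr_ge0.
Qed.

End DualEvolution.

Theorem theorem3p29 (R : realType) (d : measure_display)
  (Omega : measurableType d) (P : probability Omega R)
  (T : R) (T_gt0 : 0 < T)
  (F : R -> set (set Omega)) (F_filtration : filtration T F)
  (b a : R) (a_ge0 : 0 <= a)
  (nu : {measure set (measurableTypeR R) -> \bar R})
  (nu_levy : levy_measure nu)
  (S : set R) (x0 : R) (X : R -> Omega -> R)
  (X_levy : levy_process P T F b a nu X)
  (X_S : valued_in T S X)
  (X_0 : forall w, X 0 w = x0)
  (alpha : R) (alpha_gt0 : 0 < alpha)
  (exp_moment :
    (\int[nu]_(y in [set y : R | (1 < `|y|)%R]) (expR (alpha * `|y|))%:E < +oo)%E) :
  let V := Vexp alpha in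
  let A := generator b a nu in
  [/\ holomorphic_process P T F b a nu S (restrictR @` V) X,
      (forall h, V h -> martingale P T F (Nproc b a nu X (restrictR h))),
      (exists L, dual_operator b a nu S V L) &
      forall L, dual_operator b a nu S V L ->
      forall u, Vstar S V u ->
      exists c : R -> nat -> R[i],
        [/\ (forall t : R, 0 <= t <= T -> Vstar S V (c t)),
            (forall x, S x ->
               cintegrable lebesgue_measure `[0, T]
                 (fun s => hser (L (c s)) (ofR x)) /\
               forall t : R, 0 <= t <= T ->
                 hser (c t) (ofR x) = hser u (ofR x) +
                   cintegral lebesgue_measure `[0, t]
                     (fun s => hser (L (c s)) (ofR x))),
            (let EA (p : measurableTypeR R * measurableTypeR R) : \bar R :=
               (\int[P]_w
                  (Normc.normc (A (restrictR (hser (c p.1))) (X p.2 w)))%:E)%E in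
             measurable_fun (`[0, T] `*` `[0, T]) EA /\
             (\int[lebesgue_measure]_(t in `[0%R, T])
                \int[lebesgue_measure]_(s in `[0%R, T]) EA (s, t) < +oo)%E),
            cintegrable P setT (fun w => hser u (ofR (X T w))) &
            cintegral P setT (fun w => hser u (ofR (X T w))) =
              hser (c T) (ofR x0)]].
Proof.
move=> V A; split.
- exact: (levy_holomorphic_process P T F b a alpha nu X x0 S).
- exact: (Nproc_martingale P T F b a alpha nu X x0).
- exists (levy_operator b a nu).
  exact: (levy_operator_dual b a alpha nu alpha_gt0 nu_levy exp_moment S).
move=> L [_ _ LA] u /(geo_Vstar S alpha u alpha_gt0)[t [D [t0 ta bu]]].
have Vc s : Vstar S V (levy_semigroup b a nu s u).
  exact: (Vstar_geo_bounded S alpha t _ _ (ltW t0) ta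
    (levy_semigroup_bounded b a alpha nu alpha_gt0 nu_levy exp_moment s (ltW t0) (ltW ta) bu)).
have [iT eT] := semigroup_expectation P T F b a alpha nu X x0 T_gt0 F_filtration X_levy X_0
  alpha_gt0 nu_levy exp_moment D t u (ltW t0) ta bu.
exists (fun s => levy_semigroup b a nu s u); split => //.
- move=> x Sx.
  (* An arbitrary [L] is known only through the generator identity at points of [S], and the
     equation involves no more than that. *)
  rewrite (_ : (fun s => hser (L (levy_semigroup b a nu s u)) (ofR x)) =
      (fun s => generator b a nu (restrictR (hser (levy_semigroup b a nu s u))) x)).
    exact: (semigroup_evolution T b a alpha nu alpha_gt0 nu_levy exp_moment D t u (ltW t0) ta bu x).
  by apply/funext => s; rewrite -LA.
- exact: (semigroup_generator_integrable P T F b a alpha nu X x0 T_gt0 F_filtration X_levy X_0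
    alpha_gt0 nu_levy exp_moment D t u (ltW t0) ta bu).
Qed.
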